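(* Let $H$ be a fixed tree, let $c>0$ be a fixed constant, and let $m=m(n)$ satisfy $cn\le m(n)\le(1+o(1))n$. Then there exists $\lambda=\lambda(H,c)>0$ such that, writing $t(n)=\lceil \lambda\,\mathrm{add}(n,m)/n\rceil$, $$\mathbf{P}\big[P_{n,m}\text{ has fewer than } t(n) \text{ components with an order-preserving isomorphism to } H\big]<e^{-t(n)}$$ for all large $n$.
   Context: $\mathcal{P}(n,m)$ is the set of simple labelled planar graphs on vertex set $\{1,\ldots,n\}$ with exactly $m$ edges; $P_{n,m}$ is chosen uniformly at random from $\mathcal{P}(n,m)$. For a planar graph $G$, a non-edge $e$ of $G$ is addable if $G+e$ is planar; $\mathrm{add}(n,m)$ is the minimum, over all $G\in\mathcal{P}(n,m)$, of the number of addable non-edges of $G$. $H$ has vertex set $\{1,\ldots,h\}$, and a component $C$ has an order-preserving isomorphism to $H$ if $|C|=h$ and the increasing bijection from $\{1,\ldots,h\}$ to $V(C)$ is an isomorphism between $H$ and $C$. *)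

(* Defs.v *)
From mathcomp Require Import all_boot all_order all_algebra.
From mathcomp Require Import all_classical all_reals all_analysis.

Set Implicit Arguments.
Unset Strict Implicit.
Unset Printing Implicit Defensive.

Import Order.TTheory GRing.Theory Num.Theory.
Import numFieldNormedType.Exports.

Local Open Scope classical_set_scope.
Local Open Scope ring_scope.

(* A graph on the vertex type V is given by its set of edges, an edge being an
   unordered pair of vertices. *)
Definition simple_graph (V : finType) (G : {set {set V}}) : bool :=
  [forall e in G, #|e| == 2%N].

Definition adj (V : finType) (G : {set {set V}}) : rel V :=
  [rel u v | [set u; v]%SET \in G].

Definition components (V : finType) (G : {set {set V}}) : {set {set V}} :=
  equivalence_partition (connect (adj G)) [set: V]%SET.

(* "Connected" means exactly one component, which excludes the empty graph.
   A ucycle of size 2 is an edge traversed back and forth. *)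
Definition is_tree (V : finType) (G : {set {set V}}) : Prop :=
  [/\ simple_graph G,
      #|components G| = 1%N
    & forall s : seq V, ucycle (adj G) s -> (size s <= 2)%N].

(* A drawing in the plane R * R: vertex v is the point p v, and edge e is the
   simple arc a e restricted to [0, 1]. Edges meet vertices and each other only
   at common endpoints. *)
Definition plane_drawing (R : realType) (V : finType) (G : {set {set V}})
    (p : V -> R * R) (a : {set V} -> R -> R * R) : Prop :=
  [/\ injective p,
      forall e, e \in G ->
        [/\ {within `[0 : R, 1]%classic, continuous (a e)},
            {in `[0 : R, 1] &, injective (a e)}
          & [set a e 0; a e 1]%classic = [set p v | v in [set` e]]%classic],
      forall e v (s : R), e \in G -> 0 < s < 1 -> a e s <> p v
    & forall e f (s t : R), e \in G -> f \in G -> e != f ->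
        0 < s < 1 -> 0 < t < 1 -> a e s <> a f t].

Definition planar (R : realType) (V : finType) (G : {set {set V}}) : Prop :=
  exists p : V -> R * R, exists a : {set V} -> R -> R * R, plane_drawing G p a.

(* The vertex set {1, ..., n} is rendered as 'I_n; only its order matters. *)
Definition planar_graphs (R : realType) (n m : nat) : {set {set {set 'I_n}}} :=
  [set G : {set {set 'I_n}} |
    [&& simple_graph G, #|G| == m & `[< planar R G >]]]%SET.

Definition addable (R : realType) (V : finType) (G : {set {set V}}) :
    {set {set V}} :=
  [set e : {set V} |
    [&& #|e| == 2%N, e \notin G & `[< planar R (e |: G)%SET >]]]%SET.

(* 'C(n, 2) bounds the number of non-edges, so it does not affect the minimum
   when there is at least one planar graph with n vertices and m edges. *)
Definition min_addable (R : realType) (n m : nat) : nat :=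
  \big[minn/'C(n, 2)]_(G in planar_graphs R n m) #|addable R G|.

(* f is the increasing bijection from 'I_h onto C. *)
Definition order_iso (h n : nat) (H : {set {set 'I_h}}) (G : {set {set 'I_n}})
    (C : {set 'I_n}) : bool :=
  [exists f : {ffun 'I_h -> 'I_n},
    [&& [forall i : 'I_h, forall j : 'I_h, (i < j)%N ==> (f i < f j)%N],
        f @: [set: 'I_h]%SET == C
      & [forall i : 'I_h, forall j : 'I_h, adj H i j == adj G (f i) (f j)]]].

Definition num_order_iso_components (h n : nat) (H : {set {set 'I_h}})
    (G : {set {set 'I_n}}) : nat :=
  #|[set C in components G | order_iso H G C]%SET|.

(* Probability of E for the uniform distribution on A, for nonempty A (the value
   is 0 when A is empty). *)
Definition uniform_graph_prob (R : realType) (T : finType) (A : {set T})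
    (E : pred T) : R :=
  #|[set x in A | E x]%SET|%:R / #|A|%:R.

Definition tn (R : realType) (lambda : R) (n m : nat) : int :=
  Num.ceil (lambda * (min_addable R n m)%:R / n%:R).

(* Main.v *)
(** Call a vertex low when its degree is at most 2.  In a planar graph with n
    vertices and at most (1 + o(1)) n edges, a positive fraction of the vertices
    is low.  Choose h low vertices and splice them out one by one: delete the
    edges at the vertex and, if it had two neighbours, join these.  The graph
    remains planar, and the number of ways to undo a splice is at most linear in
    n.  Build a copy of H on the h vertices that are now isolated, and repair the
    number of edges by adding addable edges, for each of which there are about
    add(n, m) choices and at most m choices in reverse, or by deleting edges.
    Double counting these switchings gives, for F k the number of graphs with
    fewer than k components order-isomorphic to H,
      F k * (add(n, m) / n) <= C * (k + 8 h) * F (k + 8 h),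
    and t(n) iterations of this inequality give the bound.

    The argument needs add(n, m) / n to be unbounded.  Contracting leaves, paths
    of vertices of degree 2 and cycles partitions the vertices into few blocks,
    any two vertices of one block being adjacent or joined by an addable edge.

    Planarity enters only through closure operations: subgraphs, relabelling,
    a new edge between isolated vertices, suppression of a vertex of degree 2,
    and a triangle erected on an edge.  For the last one an arc uv is doubled:
    drawings are first made radial near u and v; then the points z to which two
    arcs lead from u, meeting only at u and z, form a locally constant set along
    the arc, because two arcs can be cut where they first hit a closed ball and
    continued by straight segments to any point inside that ball. *)

Require Import Defs.
From mathcomp Require Import all_boot all_order all_algebra.
From mathcomp Require Import fingroup perm.
From mathcomp Require Import ring lra zify.
Import Order.TTheory GRing.Theory Num.Theory.
Set Implicit Arguments.
Unset Strict Implicit.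
Unset Printing Implicit Defensive.

(** * Classes of graphs closed under the planar operations *)

Definition isolated_vertex (V : finType) (G : {set {set V}}) (w : V) :=
  [forall e in G, w \notin e].

Record planar_like (V : finType) (P : pred {set {set V}}) : Prop := PlanarLike {
  pl_simple : forall G, P G -> simple_graph G;
  pl_sub : forall G G' : {set {set V}}, G' \subset G -> P G -> P G';
  pl_perm : forall G (s : {perm V}), P G -> P [set s @: e | e : {set V} in G];
  pl_edge : forall G u v, u != v -> isolated_vertex G u -> isolated_vertex G v ->
    P G -> P ([set u; v] |: G);
  pl_suppress : forall (G : {set {set V}}) u v w, u != v -> [set u; w] \in G ->
    [set v; w] \in G -> [set u; v] \notin G ->
    (forall e, e \in G -> w \in e -> e = [set u; w] \/ e = [set v; w]) ->
    P G -> P ([set u; v] |: (G :\ [set u; w] :\ [set v; w]));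
  pl_triangle : forall (G : {set {set V}}) u v w, u != v -> [set u; v] \in G ->
    isolated_vertex G w -> P G -> P ([set u; w] |: ([set v; w] |: G)) }.

Definition nbrs (V : finType) (G : {set {set V}}) (v : V) := [set u | [set u; v] \in G].
Definition deg (V : finType) (G : {set {set V}}) (v : V) := #|nbrs G v|.

Section SimpleGraph.
Variable V : finType.
Implicit Types (G : {set {set V}}) (e : {set V}) (u v w x y : V).

Lemma isolated_vertexP G w : reflect (forall e, e \in G -> w \notin e) (isolated_vertex G w).
Proof. exact: (iffP forall_inP). Qed.

Lemma isolated_setU1 G e w : isolated_vertex G w -> w \notin e -> isolated_vertex (e |: G) w.
Proof.
move=> /isolated_vertexP iw we; apply/isolated_vertexP => f.
by rewrite in_setU1 => /orP[/eqP ->|/iw].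
Qed.

Lemma isolated_sub G G' w : G' \subset G -> isolated_vertex G w -> isolated_vertex G' w.
Proof.
by move=> /subsetP sG /isolated_vertexP iw; apply/isolated_vertexP => f /sG /iw.
Qed.

Lemma in_nbrs G u v : (u \in nbrs G v) = ([set u; v] \in G).
Proof. by rewrite inE. Qed.

Lemma nbrs_sym G u v : (u \in nbrs G v) = (v \in nbrs G u).
Proof. by rewrite !in_nbrs setUC. Qed.

Lemma setU1_mem G e : e \in G -> e |: G = G.
Proof. by move=> eG; apply/setUidPr; rewrite sub1set. Qed.

Lemma set2_inj x y v : [set x; v] = [set y; v] -> x = y.
Proof.
move=> E; have : x \in [set y; v] by rewrite -E set21.
rewrite in_set2 => /orP[/eqP //|/eqP xv].
have : y \in [set x; v] by rewrite E set21.
by rewrite xv in_set2 orbb => /eqP ->.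
Qed.

Section Simple.
Variable G : {set {set V}}.
Hypothesis sG : simple_graph G.

Lemma nbrs_neq u v : u \in nbrs G v -> u != v.
Proof.
rewrite in_nbrs => uv; have /forall_inP/(_ _ uv) := sG.
by rewrite cards2; case: (u != v).
Qed.

Lemma edgeP e v : e \in G -> v \in e -> exists2 u, u \in nbrs G v & e = [set u; v].
Proof.
move=> eG ve; have := sG => /forall_inP /(_ _ eG) /cards2P[a [b [ab eE]]].
move: ve eG; rewrite eE in_set2 => /orP[]/eqP -> abG; [exists b|exists a]; rewrite ?in_nbrs // setUC //.
Qed.

Lemma isolatedE v : isolated_vertex G v = (nbrs G v == set0).
Proof.
apply/isolated_vertexP/eqP => [iv|n0 e eG].
  by apply/setP => u; rewrite in_nbrs in_set0; apply/negP => /iv; rewrite set22.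
by apply/negP => ve; have [u] := edgeP eG ve; rewrite n0 in_set0.
Qed.

Lemma incident_card v : #|[set e in G | v \in e]| = deg G v.
Proof.
have inj : {in nbrs G v &, injective (fun u => [set u; v])} by move=> x y _ _; exact: set2_inj.
rewrite /deg -(card_in_imset inj).
apply: eq_card => e; rewrite inE; apply/andP/imsetP => [[eG /(edgeP eG)[u un ->]]|[u un ->]].
  by exists u.
by rewrite -in_nbrs un set22.
Qed.

Lemma handshake : \sum_v deg G v = 2 * #|G|.
Proof.
under eq_bigr => v _ do rewrite -incident_card -sum1_card.
rewrite (eq_bigr (fun v => \sum_(e in G) (v \in e))); last first.
  move=> v _; rewrite big_mkcond [RHS]big_mkcond; apply: eq_bigr => e _.
  by rewrite inE; case: (e \in G); case: (v \in e).
rewrite exchange_big /= mulnC -sum_nat_const; apply: eq_bigr => e eG.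
rewrite (eq_bigr (fun v => if v \in e then 1 else 0)) => [|v _]; last by case: (v \in e).
by rewrite -big_mkcond sum1_card; have := sG => /forall_inP/(_ _ eG)/eqP.
Qed.

End Simple.

End SimpleGraph.

Section Labelling.
Variables (V : finType) (P : pred {set {set V}}).
Hypothesis HP : planar_like P.
Implicit Types (G : {set {set V}}) (e : {set V}) (u v w x y : V).

Lemma pl_pendant G u v : u != v -> isolated_vertex G v -> P G -> P ([set u; v] |: G).
Proof.
move=> uv iv PG; case: (boolP (isolated_vertex G u)) => [iu|]; first exact: pl_edge.
rewrite negb_forall_in => /exists_inP[e eG]; rewrite negbK => ue.
have sG := pl_simple HP PG; have [y yu eE] := edgeP sG eG ue.
have uy : u != y by rewrite eq_sym; exact: nbrs_neq yu.
have := pl_triangle HP uy _ iv PG; rewrite setUC -eE eG => /(_ isT).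
by apply: (pl_sub HP); apply: setUS; rewrite subsetU1.
Qed.

Definition num_labels (phi : V -> option V) := #|[set phi x | x : V] :\ None|.
Definition num_unlabelled (phi : V -> option V) := #|[set x | phi x == None]|.

Definition relabel (phi : V -> option V) v u : V -> option V :=
  fun x => if x == v then phi u else phi x.

Lemma num_labels_sub (phi psi : V -> option V) :
  (forall x, phi x != None -> exists y, phi x = psi y) -> num_labels phi <= num_labels psi.
Proof.
move=> sub; apply/subset_leq_card/subsetP => o; rewrite !in_setD1 => /andP[on /imsetP[x _ oE]].
rewrite on /=; have [y yE] : exists y, phi x = psi y by apply: sub; rewrite -oE.
by apply/imsetP; exists y; rewrite // oE.
Qed.

Lemma num_unlabelled_relabel phi v u :
  num_unlabelled phi <= (num_unlabelled (relabel phi v u)).+1.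
Proof.
rewrite -[X in _ <= X]add1n -(cards1 v); apply: leq_trans (leq_card_setU _ _).
apply/subset_leq_card/subsetP => x; rewrite !inE /relabel.
by case: (x == v).
Qed.

(* At most 8 (m - n + z) labels, z the number of unlabelled vertices; no truncated
   subtraction in this form. *)
Definition good_labelling G (phi : V -> option V) :=
  (forall x y, x != y -> phi x = phi y -> P ([set x; y] |: G)) /\
  num_labels phi + 8 * #|V| <= 8 * #|G| + 8 * num_unlabelled phi.

Lemma relabel_good G G' phi v u : #|G| = #|G'|.+1 -> good_labelling G' phi ->
  (forall x y, x != y -> x != v -> y != v -> phi x = phi y -> P ([set x; y] |: G)) ->
  (forall y, y != v -> phi u = phi y -> P ([set v; y] |: G)) ->
  good_labelling G (relabel phi v u).
Proof.
move=> cG [_ bnd] Hxy Hv; split.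
  move=> x y xy; rewrite /relabel; case: (eqVneq x v) => [xv|xv].
    by rewrite xv in xy *; rewrite eq_sym (negPf xy) => /Hv; apply; rewrite eq_sym.
  case: (eqVneq y v) => [yv|yv]; last exact: Hxy.
  by rewrite yv (setUC [set x]) => /esym; exact: Hv.
have l : num_labels (relabel phi v u) <= num_labels phi.
  by apply: num_labels_sub => x _; rewrite /relabel; case: eqP => _; [exists u|exists x].
have := num_unlabelled_relabel phi v u; lia.
Qed.

Lemma leaf_labelling G phi u v : P G -> nbrs G v = [set u] ->
  good_labelling (G :\ [set u; v]) phi -> good_labelling G (relabel phi v u).
Proof.
move=> PG nv gl; have sG := pl_simple HP PG.
have unv : u \in nbrs G v by rewrite nv set11.
have uv := nbrs_neq sG unv; have uvG : [set u; v] \in G by rewrite -in_nbrs.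
have GE : [set u; v] |: (G :\ [set u; v]) = G by rewrite setD1K.
have cG : #|G| = #|G :\ [set u; v]|.+1 by rewrite (cardsD1 [set u; v]) uvG.
have iv : isolated_vertex (G :\ [set u; v]) v.
  apply/isolated_vertexP => e; rewrite in_setD1 => /andP[ne eG]; apply: contra ne => ve.
  have [y] := edgeP sG eG ve; rewrite nv in_set1 => /eqP -> ->; exact: eqxx.
have [Hgood _] := gl.
apply: (relabel_good cG gl) => [x y xy xv yv /(Hgood _ _ xy) Pxy|y yv uy].
  rewrite -GE setUCA; apply: pl_pendant => //; apply: isolated_setU1 => //.
  by rewrite in_set2 negb_or eq_sym xv eq_sym.
case: (eqVneq y u) => [->|yu].
  by rewrite (setUC [set v]) setU1_mem.
have Puy : P ([set u; y] |: (G :\ [set u; v])) by apply: Hgood; rewrite // eq_sym.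
have := pl_triangle HP (_ : u != y) (setU11 _ _) (_ : isolated_vertex _ v) Puy.
rewrite eq_sym yu => /(_ isT) => /(_ _) H.
have {}H : P ([set u; v] |: ([set y; v] |: ([set u; y] |: (G :\ [set u; v])))).
  by apply: H; apply: isolated_setU1 => //; rewrite in_set2 negb_or eq_sym uv eq_sym.
apply: (pl_sub HP) H; rewrite -{1}GE setUCA setUS // (setUC [set v]) setUS //.
exact: subsetU1.
Qed.

Lemma suppress_labelling G phi u v w u' : P G -> nbrs G w = [set u; v] -> u != v ->
  nbrs G u = [set w; u'] -> w != u' -> [set u; v] \notin G ->
  good_labelling ([set u; v] |: (G :\ [set u; w] :\ [set v; w])) phi ->
  good_labelling G (relabel phi w u).
Proof.
move=> PG nw uv nu wu' uvG; set G' := (X in good_labelling X phi) => gl.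
have sG := pl_simple HP PG.
have uwG : [set u; w] \in G by rewrite -in_nbrs nw set21.
have vwG : [set v; w] \in G by rewrite -in_nbrs nw set22.
have u'uG : [set u'; u] \in G by rewrite -in_nbrs nu set22.
have uw : u != w by apply: (nbrs_neq sG); rewrite in_nbrs.
have vu : v != u by rewrite eq_sym.
have vw : v != w by apply: (nbrs_neq sG); rewrite in_nbrs.
have u'u : u' != u by apply: (nbrs_neq sG); rewrite in_nbrs.
have degw e : e \in G -> w \in e -> e = [set u; w] \/ e = [set v; w].
  by move=> eG we; have [y + ->] := edgeP sG eG we; rewrite nw in_set2 => /orP[]/eqP ->; [left|right].
have degu e : e \in G -> u \in e -> e = [set u; w] \/ e = [set u'; u].
  move=> eG we; have [y + ->] := edgeP sG eG we; rewrite nu in_set2 => /orP[]/eqP ->; [left|by right].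
  exact: setUC.
have ne : [set v; w] != [set u; w] by apply: contra_neq uv => /set2_inj.
have iw0 : isolated_vertex (G :\ [set u; w] :\ [set v; w]) w.
  apply/isolated_vertexP => e; rewrite !in_setD1 => /and3P[evw euw eG].
  by apply/negP => /(degw _ eG)[] E; [move: euw|move: evw]; rewrite E eqxx.
have iw : isolated_vertex G' w.
  by apply: isolated_setU1 => //; rewrite in_set2 negb_or eq_sym uw eq_sym.
have cG : #|G| = #|G'|.+1.
  rewrite /G' cardsU1 !in_setD1 (negPf uvG) !andbF add1n.
  by rewrite (cardsD1 [set u; w] G) uwG (cardsD1 [set v; w] (G :\ _)) in_setD1 ne vwG.
have [Hgood _] := gl.
have uvG' : [set u; v] \in G' by exact: setU11.
have inG' e : e \in G -> w \notin e -> e \in G'.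
  move=> eG we; rewrite in_setU1 !in_setD1 eG andbT; apply/orP; right.
  by apply/andP; split; apply: contraNneq we => ->; exact: set22.
apply: (relabel_good cG gl) => [x y xy xw yw /(Hgood _ _ xy) Pxy|y yw uy].
  have iw' : isolated_vertex ([set x; y] |: G') w.
    by apply: isolated_setU1 => //; rewrite in_set2 negb_or eq_sym xw eq_sym.
  have := pl_triangle HP uv (setU1r _ uvG') iw' Pxy; apply: (pl_sub HP).
  apply/subsetP => e; rewrite in_setU1 => /orP[/eqP ->|eG].
    by rewrite !in_setU1 eqxx !orbT.
  case: (boolP (w \in e)) => we; last by do 3! apply: setU1r; exact: inG'.
  by have [->|->] := degw e eG we; rewrite !in_setU1 eqxx ?orbT.
case: (eqVneq y u) => [->|yu].
  by rewrite (setUC [set w]) setU1_mem.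
have {Hgood} Puy : P ([set u; y] |: G') by apply: Hgood; rewrite // eq_sym.
pose s := tperm u w; have su : s u = w by exact: tpermL.
have sid x : x != u -> x != w -> s x = x by move=> xu xw; rewrite tpermD // eq_sym.
have im2 a b : s @: [set a; b] = [set s a; s b] by rewrite imsetU !imset_set1.
have Q := pl_perm HP s Puy; set G2 := [set _ | _ in _] in Q.
have i2 : isolated_vertex G2 u.
  apply/isolated_vertexP => _ /imsetP[e eG ->]; apply/negP => /imsetP[x xe ux].
  have xw : x = w by apply: (@perm_inj _ s); rewrite -ux tpermR.
  have : isolated_vertex ([set u; y] |: G') w.
    by apply: isolated_setU1 => //; rewrite in_set2 negb_or eq_sym uw eq_sym.
  by move=> /isolated_vertexP/(_ _ eG); rewrite -xw xe.
have wu'2 : [set w; u'] \in G2.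
  apply/imsetP; exists [set u; u']; last by rewrite im2 su sid // eq_sym.
  rewrite setUC; apply: setU1r; apply: inG' => //.
  by rewrite in_set2 negb_or wu' eq_sym.
have := pl_triangle HP wu' wu'2 i2 Q; apply: (pl_sub HP).
have inG2 e : e \in [set u; y] |: G' -> s @: e \in G2 by move=> eG; apply: imset_f.
apply/subsetP => e; rewrite in_setU1 => /orP[/eqP ->|eG].
  apply: setU1r; apply: setU1r; have := inG2 _ (setU11 _ _).
  by rewrite im2 su sid.
case: (boolP (u \in e)) => ue.
  have [->|->] := degu e eG ue; first by rewrite (setUC [set u]) setU11.
  by apply: setU1r; rewrite setU11.
apply: setU1r; apply: setU1r; case: (boolP (w \in e)) => we.
  have [E|->] := degw e eG we; first by move: ue; rewrite E set21.
  by have := inG2 _ (setU1r _ uvG'); rewrite im2 su sid // (setUC [set w]).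
have <- : s @: e = e.
  rewrite -[RHS]imset_id; apply: eq_in_imset => x xe; apply: sid.
    by apply: contraNneq ue => <-.
  by apply: contraNneq we => <-.
by apply: inG2; apply: setU1r; exact: inG'.
Qed.

End Labelling.

Section Labelling.
Variables (V : finType) (P : pred {set {set V}}).
Hypothesis HP : planar_like P.
Implicit Types (G : {set {set V}}) (e : {set V}) (u v w x y : V).

Definition away G (T : {set V}) : {set {set V}} := [set e in G | [disjoint e & T]].

Lemma triangle_labelling G phi u v w : P G -> u != v -> u != w -> v != w ->
  nbrs G u = [set v; w] -> nbrs G v = [set u; w] -> nbrs G w = [set u; v] ->
  good_labelling P (away G [set u; v; w]) phi ->
  good_labelling P G (fun x => if x \in [set u; v; w] then None else phi x).
Proof.
move=> PG uv uw vw nu nv nw; set T := [set u; v; w]; set G' := away G T => -[Hgood bnd].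
have sG := pl_simple HP PG.
have subG : G' \subset G by apply/subsetP => e; rewrite inE => /andP[].
have PG' := pl_sub HP subG PG.
have iT x : x \in T -> isolated_vertex G' x.
  move=> xT; apply/isolated_vertexP => e; rewrite inE => /andP[_ dT].
  by apply/negP => xe; have := disjointFr dT xe; rewrite xT.
have edges e : e \in G -> [\/ e = [set u; v], e = [set u; w], e = [set v; w] | e \in G'].
  move=> eG; case: (boolP (e \in G')) => [|eG']; first by constructor 4.
  have {eG'} [x xe xT] : exists2 x, x \in e & x \in T.
    move: eG'; rewrite inE eG /= => /pred0Pn[x /andP[xe xT]]; by exists x.
  have [y yn ->] := edgeP sG eG xe; move: xT yn; rewrite !inE -orbA.
  case/or3P => /eqP ->; rewrite -in_nbrs ?nu ?nv ?nw in_set2 => /orP[]/eqP ->.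
  - by constructor 1; rewrite setUC.
  - by constructor 2; rewrite setUC.
  - by constructor 1.
  - by constructor 3; rewrite setUC.
  - by constructor 2.
  - by constructor 3.
have key a b c y : a != b -> y \notin [set a; b; c] -> c != a -> c != b ->
    isolated_vertex G' a -> isolated_vertex G' b -> isolated_vertex G' c ->
    (forall e, e \in G -> [\/ e = [set a; b], e = [set a; c], e = [set b; c] | e \in G']) ->
    P ([set a; y] |: G).
  rewrite !inE !negb_or => ab /andP[/andP[ya yb] yc] ca cball ia ib ic eG.
  have P1 := pl_pendant HP ya ia PG'.
  have ib1 : isolated_vertex ([set y; a] |: G') b.
    by apply: isolated_setU1 => //; rewrite in_set2 negb_or eq_sym yb eq_sym.
  have P2 := pl_pendant HP ab ib1 P1.
  have ic2 : isolated_vertex ([set a; b] |: ([set y; a] |: G')) c.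
    apply: isolated_setU1; first (apply: isolated_setU1 => //);
      by rewrite in_set2 negb_or ?ca ?cball ?andbT // eq_sym.
  have := pl_triangle HP ab (setU11 _ _) ic2 P2; apply: (pl_sub HP).
  apply/subsetP => e; rewrite in_setU1 => /orP[/eqP ->|/eG[->|->|->|eG']].
  - by do 3! apply: setU1r; rewrite setUC setU11.
  - by do 2! apply: setU1r; exact: setU11.
  - exact: setU11.
  - by apply: setU1r; exact: setU11.
  - by do 4! apply: setU1r.
have inT : [/\ u \in T, v \in T & w \in T] by rewrite !inE !eqxx !orbT.
have [uT vT wT] := inT.
have keyT x y : x \in T -> y \notin T -> P ([set x; y] |: G).
  move=> xT yT; have := xT; rewrite !inE -orbA => /or3P[]/eqP ->.
  - by apply: (key u v w) => //; rewrite ?iT // eq_sym.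
  - apply: (key v u w); rewrite ?iT //; try by rewrite eq_sym.
      by move: yT; rewrite !inE !negb_or => /andP[/andP[-> ->] ->].
    by move=> e /edges[->|->|->|eG]; [constructor 1; exact: setUC|constructor 3|constructor 2|constructor 4].
  - apply: (key w u v); rewrite ?iT //; try by rewrite eq_sym.
      by move: yT; rewrite !inE !negb_or => /andP[/andP[-> ->] ->].
    by move=> e /edges[->|->|->|eG]; [constructor 3|constructor 1; exact: setUC|constructor 2; exact: setUC|constructor 4].
have inTG x y : x != y -> x \in T -> y \in T -> [set x; y] \in G.
  have E1 : [set v; u] \in G by rewrite -in_nbrs nu set21.
  have E2 : [set w; u] \in G by rewrite -in_nbrs nu set22.
  have E3 : [set w; v] \in G by rewrite -in_nbrs nv set22.
  move=> xy; rewrite !inE -!orbA => /or3P[]/eqP ? /or3P[]/eqP ?; subst; rewrite ?eqxx // in xy;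
    by rewrite // setUC.
split.
- move=> x y xy; case: ifP => xT; case: ifP => yT.
  + by move=> _; rewrite setU1_mem // inTG.
  + by move=> _; rewrite keyT ?yT.
  + by move=> _; rewrite (setUC [set x]) keyT ?xT.
  move=> /(Hgood _ _ xy) Pxy.
  have inxy z : z \in T -> z \notin [set x; y].
    by move=> zT; rewrite in_set2 negb_or; apply/andP; split; apply: contraTneq zT => ->; rewrite ?xT ?yT.
  have ii z : z \in T -> isolated_vertex ([set x; y] |: G') z.
    by move=> zT; apply: isolated_setU1; [exact: iT|exact: inxy].
  have P1 := pl_edge HP uv (ii _ uT) (ii _ vT) Pxy.
  have iw : isolated_vertex ([set u; v] |: ([set x; y] |: G')) w.
    by apply: isolated_setU1; [exact: ii|rewrite in_set2 negb_or eq_sym uw eq_sym].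
  have := pl_triangle HP uv (setU11 _ _) iw P1; apply: (pl_sub HP).
  apply/subsetP => e; rewrite in_setU1 => /orP[/eqP ->|/edges[->|->|->|eG']].
  + by do 3! apply: setU1r; exact: setU11.
  + by do 2! apply: setU1r; exact: setU11.
  + exact: setU11.
  + by apply: setU1r; exact: setU11.
  + by do 4! apply: setU1r.
have := subset_leq_card subG.
set psi := (fun x => _) => cG.
have l : num_labels psi <= num_labels phi.
  by apply: num_labels_sub => x; rewrite /psi; case: ifP => // _ _; exists x.
have : num_unlabelled phi <= num_unlabelled psi.
  by apply/subset_leq_card/subsetP => x; rewrite !inE /psi; case: ifP.
lia.
Qed.

Lemma base_labelling G : P G -> (forall v, deg G v != 1) ->
  (forall w, deg G w = 2 -> exists2 x, x \in nbrs G w & 2 < deg G x) ->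
  good_labelling P G (fun x => if deg G x == 0 then None else Some x).
Proof.
move=> PG H1 H2; have sG := pl_simple HP PG; split.
  move=> x y xy; case: (eqVneq (deg G x) 0) => [x0|_]; case: (eqVneq (deg G y) 0) => [y0|_] //.
    by move=> _; apply: pl_edge => //; rewrite (isolatedE sG) -cards_eq0; apply/eqP.
  by move=> [xy']; rewrite xy' eqxx in xy.
set phi := (fun x => _).
have lab : num_labels phi <= #|[set x | deg G x != 0]|.
  rewrite /num_labels; apply: leq_trans (leq_imset_card (fun x => Some x) _).
  apply/subset_leq_card/subsetP => o; rewrite in_setD1 => /andP[on /imsetP[x _ oE]].
  move: on; rewrite oE /phi; case: (eqVneq (deg G x) 0) => // x0 _.
  by apply: imset_f; rewrite inE.
have unl : num_unlabelled phi = #|[set x | deg G x == 0]|.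
  by apply: eq_card => x; rewrite !inE /phi; case: (deg G x == 0).
pose D2 := [set x | deg G x == 2]; pose D3 := [set x | 2 < deg G x].
have pos : #|[set x | deg G x != 0]| <= #|D2| + #|D3|.
  apply: leq_trans (leq_card_setU D2 D3); apply/subset_leq_card/subsetP => x.
  by rewrite !inE; case: (deg G x) (H1 x) => [|[|[|k]]].
have tot : #|[set x | deg G x == 0]| + #|[set x | deg G x != 0]| = #|V|.
  rewrite -(cardsC [set x | deg G x == 0]); congr (_ + _).
  by apply: eq_card => x; rewrite !inE.
pose S3 := \sum_(x in D3) deg G x.
have S3ge : 3 * #|D3| <= S3.
  by rewrite mulnC -sum_nat_const; apply: leq_sum => x; rewrite inE.
have D2le : #|D2| <= S3.
  apply: (@leq_trans #|\bigcup_(x in D3) nbrs G x|).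
    apply/subset_leq_card/subsetP => w; rewrite inE => /eqP /H2[x xn dx].
    by apply/bigcupP; exists x; rewrite ?inE // -in_nbrs nbrs_sym.
  rewrite /S3; elim/big_rec2: _ => [|x A B _ le]; first by rewrite cards0.
  by apply: leq_trans (leq_card_setU _ _) _; rewrite leq_add2l.
have sum : 2 * #|D2| + S3 <= 2 * #|G|.
  rewrite -(handshake sG) (bigID (mem D3)) /= addnC leq_add2l mulnC -sum_nat_const.
  rewrite [X in _ <= X](bigID (mem D2)) /=.
  apply: leq_trans (leq_addr _ _); rewrite [X in X <= _]big_mkcond [X in _ <= X]big_mkcond.
  apply: leq_sum => x _; rewrite !inE; case: (eqVneq (deg G x) 2) => [->|] //=.
lia.
Qed.

Lemma labelling_exists G : P G -> exists phi, good_labelling P G phi.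
Proof.
have [n] := ubnP #|G|; elim: n G => // n IHn G; rewrite ltnS => cG PG.
have sG := pl_simple HP PG.
case: (boolP [exists v, deg G v == 1]) => [/existsP[v /cards1P[u nv]]|/existsPn H1].
  have uvG : [set u; v] \in G by rewrite -in_nbrs nv set11.
  have [||phi gl] := IHn (G :\ [set u; v]).
  - by rewrite (cardsD1 [set u; v] G) uvG in cG.
  - by apply: (pl_sub HP) PG; exact: subD1set.
  by exists (relabel phi v u); exact: leaf_labelling.
case: (boolP [exists w, (deg G w == 2) && [forall x in nbrs G w, deg G x == 2]]); last first.
  move=> /existsPn H2; exists (fun x => if deg G x == 0 then None else Some x).
  apply: base_labelling => // w w2; have := H2 w; rewrite w2 eqxx /=.
  rewrite negb_forall_in => /exists_inP[x xn x2]; exists x => //.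
  have : 0 < deg G x by apply/card_gt0P; exists w; rewrite nbrs_sym.
  by have := H1 x; lia.
move=> /existsP[w /andP[/cards2P[u [v [uv nw]]] /forall_inP dn]].
have un : u \in nbrs G w by rewrite nw set21.
have vn : v \in nbrs G w by rewrite nw set22.
have uw := nbrs_neq sG un; have vw := nbrs_neq sG vn.
have uwG : [set u; w] \in G by rewrite -in_nbrs.
have vwG : [set v; w] \in G by rewrite -in_nbrs.
have two (a b : V) (A : {set V}) : #|A| == 2 -> a \in A -> exists2 b, a != b & A = [set a; b].
  move=> /cards2P[c [d [cd ->]]]; rewrite in_set2 => /orP[]/eqP ->; first by exists d.
  by exists c; rewrite 1?eq_sym // setUC.
have [u' wu' nu] : exists2 b, w != b & nbrs G u = [set w; b].
  by apply: two => //; [exact: dn|rewrite nbrs_sym].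
have [v' wv' nv] : exists2 b, w != b & nbrs G v = [set w; b].
  by apply: two => //; [exact: dn|rewrite nbrs_sym].
case: (boolP ([set u; v] \in G)) => uvG.
  have u'E : u' = v.
    have : v \in nbrs G u by rewrite nbrs_sym in_nbrs.
    by rewrite nu in_set2 (negPf vw) => /eqP.
  have v'E : v' = u.
    have : u \in nbrs G v by rewrite in_nbrs.
    by rewrite nv in_set2 (negPf uw) => /eqP.
  have [||phi gl] := IHn (away G [set u; v; w]).
  - apply: leq_trans cG; apply: proper_card; apply/properP; split.
      by apply/subsetP => e; rewrite inE => /andP[].
    exists [set u; v] => //; rewrite inE uvG /=; apply/pred0Pn; exists u.
    by rewrite /= !inE eqxx.
  - by apply: (pl_sub HP) PG; apply/subsetP => e; rewrite inE => /andP[].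
  exists (fun x => if x \in [set u; v; w] then None else phi x).
  apply: triangle_labelling => //.
    by rewrite nu u'E setUC.
  by rewrite nv v'E setUC.
have ne : [set v; w] != [set u; w] by apply: contra_neq uv => /set2_inj.
have [||phi gl] := IHn ([set u; v] |: (G :\ [set u; w] :\ [set v; w])).
- rewrite cardsU1 !in_setD1 (negPf uvG) !andbF add1n.
  by move: cG; rewrite (cardsD1 [set u; w] G) uwG (cardsD1 [set v; w] (G :\ _)) in_setD1 ne vwG.
- apply: (pl_suppress HP) => // e eG we.
  by have [y + ->] := edgeP sG eG we; rewrite nw in_set2 => /orP[]/eqP ->; [left|right].
by exists (relabel phi w u); apply: (@suppress_labelling _ _ HP _ _ _ v _ u').
Qed.

End Labelling.

Section Addable.
Variables (V : finType) (P : pred {set {set V}}).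
Hypothesis HP : planar_like P.
Implicit Types (G : {set {set V}}) (e : {set V}) (u v w x y : V).

Definition addables G : {set {set V}} := [set e : {set V} | [&& #|e| == 2, e \notin G & P (e |: G)]].

Section Labels.
Variable phi : V -> option V.
Let block x := #|[set y | phi y == phi x]|.
Let mono := \sum_x block x.

Lemma mono_sq : num_unlabelled phi ^ 2 <= mono.
Proof.
rewrite /mono -mulnn -sum_nat_const /num_unlabelled [X in X <= _]big_mkcond.
apply: leq_sum => x _; case: ifP => //; rewrite inE => /eqP x0.
by rewrite /block x0.
Qed.

Lemma mono_blocks Q : Q * #|V| <= mono + Q * (Q * (num_labels phi).+1).
Proof.
pose S := [set x | block x < Q].
have cS : #|S| <= Q * (num_labels phi).+1.
  rewrite -sum1_card (partition_big phi (mem (phi @: setT))) /= => [|x _]; last exact: imset_f.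
  apply: (@leq_trans (\sum_(o in phi @: setT) Q)).
    apply: leq_sum => o _; rewrite sum1_card.
    case: (pickP [pred x | (x \in S) && (phi x == o)]) => [x /= /andP[]|none]; last by rewrite eq_card0.
    rewrite inE => /ltnW xS /eqP xo; apply: leq_trans xS; apply: subset_leq_card.
    by apply/subsetP => y /andP[_ /eqP yo]; rewrite inE yo xo.
  rewrite sum_nat_const mulnC leq_mul2l; apply/orP; right.
  rewrite (cardsD1 None) /num_labels -(add1n #|_|) leq_add ?leq_b1 //.
  by apply/subset_leq_card/setSD/subsetP => o /imsetP[x _ ->]; exact: imset_f.
have : Q * #|~: S| <= mono.
  rewrite /mono mulnC -sum_nat_const [X in X <= _]big_mkcond; apply: leq_sum => x _.
  by case: ifP => //; rewrite !inE -leqNgt.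
have := cardsC S; nia.
Qed.

Lemma mono_addables G : P G ->
  (forall x y, x != y -> phi x = phi y -> P ([set x; y] |: G)) ->
  mono <= #|V| + 2 * (#|G| + #|addables G|).
Proof.
move=> PG good; have sG := pl_simple HP PG; pose F := G :|: addables G.
have sF : simple_graph F.
  apply/forall_inP => e; rewrite !inE => /orP[|/and3P[]//].
  by move: sG => /forall_inP; apply.
apply: (@leq_trans (#|V| + 2 * #|F|)); last by rewrite leq_add2l leq_mul2l leq_card_setU.
rewrite -(handshake sF) -sum1_card -big_split /=; apply: leq_sum => x _.
rewrite /block -(cards1 x) /deg; apply: leq_trans (leq_card_setU _ _).
apply/subset_leq_card/subsetP => y; rewrite !inE => /eqP yx.
case: (eqVneq y x) => //= nyx; rewrite cards2 nyx eqxx good // andbT.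
by case: (_ \in G).
Qed.

End Labels.

Lemma many_addables G T : P G -> 0 < T -> 128 * T * #|G| <= 128 * T * #|V| + #|V| ->
  4096 * T ^ 3 + 16 * T <= #|V| -> T * #|V| <= 2 * #|addables G| + #|V| + 2 * #|G|.
Proof.
move=> PG T0 mle nge; have [phi [good bnd]] := labelling_exists HP PG.
move: (mono_addables PG good) (mono_sq phi) (mono_blocks phi (2 * T)) bnd mle nge.
move: (\sum_x _) (num_unlabelled phi) (num_labels phi) #|V| #|G| => S0 z L n m.
move=> mle2 sq bl bnd mle nge; suff : T * n <= S0 by lia.
case: (leqP n (64 * T * z)) => hz.
  have : 64 * T * T <= z by nia.
  nia.
nia.
Qed.

End Addable.

(** * Switchings *)

Lemma sum_card_dep (T C : finType) (Y : {set T}) (ch : T -> {set C}) :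
  \sum_(y in Y) #|ch y| = #|[set p : T * C | (p.1 \in Y) && (p.2 \in ch p.1)]|.
Proof.
under eq_bigr => y _ do rewrite -sum1_card.
by rewrite pair_big_dep -sum1_card; apply: eq_bigl => p; rewrite inE.
Qed.

Lemma double_count (T1 T2 C K : finType) (Y : {set T1}) (Z : {set T2})
    (ch : T1 -> {set C}) (next : T1 -> C -> T2) (code : T1 -> C -> K)
    (codes : T2 -> {set K}) D :
  (forall y c, y \in Y -> c \in ch y -> next y c \in Z /\ code y c \in codes (next y c)) ->
  (forall y c y' c', y \in Y -> c \in ch y -> y' \in Y -> c' \in ch y' ->
     next y c = next y' c' -> code y c = code y' c' -> (y, c) = (y', c')) ->
  (forall z, z \in Z -> #|codes z| <= D) ->
  \sum_(y in Y) #|ch y| <= D * #|Z|.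
Proof.
move=> Hin inj HD; rewrite sum_card_dep.
pose f (p : T1 * C) := (next p.1 p.2, code p.1 p.2).
rewrite -(card_in_imset (f := f)) => [|[y c] [y' c']]; last first.
  by rewrite !inE /= => /andP[yY cy] /andP[yY' cy'] [E1 E2]; exact: inj.
apply: (@leq_trans (\sum_(z in Z) #|codes z|)).
  rewrite sum_card_dep; apply/subset_leq_card/subsetP => q /imsetP[[y c]].
  by rewrite !inE /= => /andP[yY cy] ->; have [-> ->] := Hin y c yY cy.
by rewrite mulnC -sum_nat_const; apply: leq_sum => z; exact: HD.
Qed.

Section Splicing.
Variables (V : finType) (P : pred {set {set V}}).
Hypothesis HP : planar_like P.
Implicit Types (G : {set {set V}}) (e S W : {set V}) (u v w x y : V).

Lemma addables_sub G G' : G \subset G' -> addables P G' \subset addables P G.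
Proof.
move=> sG; apply/subsetP => e; rewrite !inE => /and3P[-> eG' Pe] /=.
rewrite (contra (subsetP sG e) eG') /=; apply: (pl_sub HP) Pe; exact: setUS.
Qed.

Lemma extend_to G M : (forall G', P G' -> #|G'| < M -> 0 < #|addables P G'|) ->
  P G -> #|G| <= M -> exists G', [/\ G \subset G', P G' & #|G'| = M].
Proof.
move=> add0; have [k] := ubnP (M - #|G|); elim: k G => // k IHk G.
rewrite ltnS => lek PG; rewrite leq_eqVlt => /predU1P[|ltM]; first by exists G.
have /card_gt0P[e] := add0 G PG ltM; rewrite inE => /and3P[_ eG Pe].
have ce : #|e |: G| = #|G|.+1 by rewrite cardsU1 eG.
have [||G' [sG' PG' cG']] := IHk (e |: G) _ Pe; [lia|lia|].
by exists G'; split => //; apply: subset_trans sG'; exact: subsetU1.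
Qed.

Definition low G v := deg G v <= 2.

Lemma many_low G : P G -> 3 * #|V| <= 2 * #|G| + 3 * #|[set v | low G v]|.
Proof.
move=> PG; rewrite -(handshake (pl_simple HP PG)) -(cardsC [set v | low G v]) mulnDr addnC leq_add2r.
rewrite mulnC -sum_nat_const big_mkcond; apply: leq_sum => v _.
by case: ifP => //; rewrite !inE -ltnNge.
Qed.

Definition star_edges v (N : {set V}) : {set {set V}} := [set [set u; v] | u in N].

Definition splice G v : {set {set V}} :=
  let G1 := [set e in G | v \notin e] in
  if deg G v == 2 then nbrs G v |: G1 else G1.

Section SpliceFacts.
Variables (G : {set {set V}}) (v : V).
Hypotheses (PG : P G) (lowv : low G v).
Let sG := pl_simple HP PG.
Let N := nbrs G v.

Lemma star_incident : [set e in G | v \in e] = star_edges v N.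
Proof.
apply/setP => e; rewrite inE; apply/andP/imsetP => [[eG /(edgeP sG eG)[u un ->]]|[u un ->]].
  by exists u.
by rewrite -in_nbrs un set22.
Qed.

Lemma v_notin_nbrs : v \notin N.
Proof. by apply/negP => /(nbrs_neq sG); rewrite eqxx. Qed.

Lemma card_incident : #|[set e in G | v \notin e]| + deg G v = #|G|.
Proof.
rewrite -(incident_card sG) addnC -(cardsID [set e : {set V} | v \in e] G); congr (_ + _).
  by apply: eq_card => e; rewrite !inE andbC.
by apply: eq_card => e; rewrite !inE andbC.
Qed.

Lemma card_splice : #|splice G v| + (if deg G v == 2 then (if N \in G then 2 else 1) else deg G v) = #|G|.
Proof.
rewrite -card_incident /splice; case: eqP => // d2; rewrite cardsU1 inE v_notin_nbrs andbT d2.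
by rewrite -/N; case: (N \in G) => /=; lia.
Qed.

Lemma splice_recover : G = star_edges v N :|: (if N \in G then splice G v else splice G v :\ N).
Proof.
have GE : G = star_edges v N :|: [set e in G | v \notin e].
  by rewrite -star_incident; apply/setP => e; rewrite !inE; case: (e \in G); case: (v \in e).
have N1 : (N \in [set e in G | v \notin e]) = (N \in G) by rewrite inE v_notin_nbrs andbT.
rewrite {1}GE; congr (_ :|: _); rewrite /splice -/N.
case: (boolP (N \in G)) => NG; case: eqP => // d2.
- by rewrite setU1_mem // N1.
- by rewrite setU1K // N1.
- apply/esym/setDidPl; rewrite disjoint_sym disjoints1 N1 //.
Qed.

Lemma splice_P : P (splice G v).
Proof.
have sub : [set e in G | v \notin e] \subset G by apply/subsetP => e; rewrite inE => /andP[].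
rewrite /splice; case: ifP => [d2|_]; last exact: (pl_sub HP) sub PG.
have /cards2P[a [b [ab NE]]] := d2; rewrite -/N in NE *.
have an : a \in nbrs G v by rewrite -/N NE set21.
have bn : b \in nbrs G v by rewrite -/N NE set22.
case: (boolP (N \in G)) => NG.
  by apply: (pl_sub HP) PG; rewrite subUset sub1set NG.
have degv e : e \in G -> v \in e -> e = [set a; v] \/ e = [set b; v].
  by move=> eG ve; have [y + ->] := edgeP sG eG ve; rewrite -/N NE in_set2 => /orP[]/eqP ->; [left|right].
have := pl_suppress HP ab _ _ _ degv PG; rewrite -NE -!in_nbrs an bn => /(_ isT isT NG).
apply: (pl_sub HP); apply: setUS; apply/subsetP => e; rewrite inE => /andP[eG ve].
by rewrite !in_setD1 eG andbT; apply/andP; split; apply: contraNneq ve => ->; exact: set22.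
Qed.

Lemma isolated_splice_v : isolated_vertex (splice G v) v.
Proof.
have i1 : isolated_vertex [set e in G | v \notin e] v.
  by apply/isolated_vertexP => e; rewrite inE => /andP[].
by rewrite /splice; case: ifP => // _; apply: isolated_setU1 => //; exact: v_notin_nbrs.
Qed.

Lemma isolated_splice w : isolated_vertex G w -> isolated_vertex (splice G v) w.
Proof.
move=> iw; have i1 : isolated_vertex [set e in G | v \notin e] w.
  by apply: isolated_sub iw; apply/subsetP => e; rewrite inE => /andP[].
rewrite /splice; case: ifP => // _; apply: isolated_setU1 => //.
by rewrite in_nbrs; apply/negP => /(isolated_vertexP _ _ iw); rewrite set21.
Qed.

Lemma splice_local e : (e \in G) != (e \in splice G v) -> e \subset v |: N.
Proof.
have edge : e \in star_edges v N -> e \subset v |: N.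
  by move=> /imsetP[u uN ->]; rewrite subUset !sub1set setU11 setU1r.
rewrite /splice; case: (boolP (v \in e)) => ve.
  case: (boolP (e \in G)) => eG; first by rewrite edge // -star_incident inE eG.
  case: ifP => _; rewrite !inE ?(negPf eG) //= orbF.
  by case: (eqVneq e N) => [-> _|//]; exact: subsetUr.
case: ifP => _; rewrite !inE ve andbT; last by rewrite eqxx.
by case: (eqVneq e N) => [-> _|_ /=]; [exact: subsetUr|rewrite eqxx].
Qed.

End SpliceFacts.

End Splicing.

Record component_family (V : finType) (P : pred {set {set V}}) (h eH : nat)
    (hcomp : {set {set V}} -> {set {set V}}) (place : {set V} -> {set {set V}}) : Prop :=
  ComponentFamily {
  cf_local : forall (G G' : {set {set V}}) (W C : {set V}),
    (forall e, (e \in G) != (e \in G') -> e \subset W) -> C \in hcomp G' ->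
    [disjoint C & W] -> C \in hcomp G;
  cf_trivIset : forall G, trivIset (hcomp G);
  cf_card : forall G C, C \in hcomp G -> #|C| = h;
  cf_closed : forall (G : {set {set V}}) C e, P G -> C \in hcomp G -> e \in G ->
    ~~ [disjoint e & C] -> e \subset C;
  cf_place_card : forall S : {set V}, #|S| = h -> #|place S| = eH;
  cf_place_sub : forall (S e : {set V}), #|S| = h -> e \in place S -> e \subset S;
  cf_place : forall (G : {set {set V}}) (S : {set V}), P G -> #|S| = h ->
    {in S, forall w, isolated_vertex G w} ->
    P (G :|: place S) /\ S \in hcomp (G :|: place S) }.

Section Switching.
Variables (V : finType) (P : pred {set {set V}}) (h eH : nat).
Variables (hcomp : {set {set V}} -> {set {set V}}) (place : {set V} -> {set {set V}}).
Hypothesis HP : planar_like P.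
Hypothesis HC : component_family P h eH hcomp place.
Implicit Types (G : {set {set V}}) (e S W C : {set V}) (u v w x y : V) (j a k d : nat).

Let X G := #|hcomp G|.

Lemma hcomp_change G G' W : (forall e, (e \in G) != (e \in G') -> e \subset W) ->
  X G' <= X G + #|W|.
Proof.
move=> HW; pose B := [set C in hcomp G' | ~~ [disjoint C & W]].
have sub : hcomp G' \subset hcomp G :|: B.
  apply/subsetP => C CG; rewrite in_setU; case: (boolP [disjoint C & W]) => dC.
    by rewrite (cf_local HC HW CG dC).
  by rewrite inE CG dC orbT.
apply: leq_trans (subset_leq_card sub) _; apply: leq_trans (leq_card_setU _ _) _.
rewrite leq_add2l.
have tB : trivIset B.
  by apply: trivIsetS (cf_trivIset HC G'); apply/subsetP => C; rewrite inE => /andP[].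
apply: (@leq_trans #|[set pblock B w | w in W]|); last exact: leq_imset_card.
apply/subset_leq_card/subsetP => C CB; have := CB; rewrite inE => /andP[_ /pred0Pn[w /andP[wC wW]]].
by apply/imsetP; exists w => //; rewrite (def_pblock tB CB wC).
Qed.

Definition iso_sets j a k : {set {set {set V}} * {set V}} :=
  [set p : {set {set V}} * {set V} | [&& P p.1, #|p.1| == a, #|p.2| == j, [forall w in p.2, isolated_vertex p.1 w] & X p.1 < k]].

Definition comp_sets a k : {set {set {set V}} * {set V}} :=
  [set p : {set {set V}} * {set V} | [&& P p.1, #|p.1| == a, p.2 \in hcomp p.1 & X p.1 < k]].

Definition few_comps a k : {set {set {set V}}} := [set G : {set {set V}} | [&& P G, #|G| == a & X G < k]].

Lemma iso_sets0 a k : #|few_comps a k| <= #|iso_sets 0 a k|.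
Proof.
rewrite -(card_in_imset (f := fun G => (G, set0 : {set V}))) => [|G G' _ _ [] //].
apply/subset_leq_card/subsetP => _ /imsetP[G + ->]; rewrite !inE /= cards0 eqxx => /and3P[-> -> ->].
by rewrite andbT /=; apply/forall_inP => w; rewrite in_set0.
Qed.

Lemma comp_sets_few a k : #|comp_sets a k| <= k * #|few_comps a k|.
Proof.
apply: (@leq_trans (\sum_(G in few_comps a k) #|hcomp G|)).
  rewrite sum_card_dep; apply/subset_leq_card/subsetP => -[G S].
  by rewrite !inE /= => /and4P[-> -> -> ->].
rewrite mulnC -sum_nat_const; apply: leq_sum => G; rewrite inE => /and3P[_ _ XG].
exact: ltnW.
Qed.

Lemma splice_count j a k (q : {set {set V}} -> V -> bool) (l D : nat)
    (codes : {set {set V}} -> {set {set V}}) :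
  (forall G v, P G -> low G v -> q G v -> #|splice G v| + l = #|G|) ->
  (forall G v, P G -> low G v -> q G v -> nbrs G v \in codes (splice G v)) ->
  (forall G v G' v', P G -> low G v -> q G v -> P G' -> low G' v' -> q G' v' ->
     (nbrs G v \in G) = (nbrs G' v' \in G')) ->
  (forall G, P G -> #|G| + l = a -> #|codes G| <= D) ->
  \sum_(p in iso_sets j a k) #|[set v | [&& v \notin p.2, low p.1 v & q p.1 v]]| <=
  (j.+1 * D) * #|iso_sets j.+1 (a - l) (k + 3)|.
Proof.
move=> Hl Hcode Hq HD.
apply: (@double_count _ _ _ (V * {set V})%type _ _ _
  (fun p v => (splice p.1 v, v |: p.2)) (fun p v => (v, nbrs p.1 v))
  (fun p => if (#|p.1| + l == a) && P p.1 then setX p.2 (codes p.1) else set0)).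
- move=> [G S] v; rewrite !inE /= => /and5P[PG /eqP cG /eqP cS /forall_inP iS XG].
  move=> /and3P[vS lv qv]; have PE := splice_P HP v PG.
  have cE : #|splice G v| + l = a by rewrite Hl.
  rewrite cE eqxx PE /= inE /= setU11 Hcode //; split => //.
  rewrite -cE addnK eqxx cardsU1 vS cS eqxx /=; apply/andP; split.
    apply/forall_inP => w; rewrite in_setU1 => /predU1P[->|/iS iw]; first exact: (isolated_splice_v HP).
    exact: isolated_splice.
  apply: leq_ltn_trans (hcomp_change (G := G) (W := v |: nbrs G v) _) _.
    by move=> e; exact: (splice_local HP).
  rewrite cardsU1 (v_notin_nbrs HP v PG); have : #|nbrs G v| <= 2 by exact: lv.
  by lia.
- move=> [G S] v [G' S'] v'; rewrite !inE /= => /and5P[PG _ _ _ _] /and3P[vS lv qv].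
  move=> /and5P[PG' _ _ _ _] /and3P[vS' lv' qv'] [E ES] [Ev En]; subst v'.
  have -> : S = S' by rewrite -(setU1K vS) -(setU1K vS') ES.
  have hq := Hq G v G' v PG lv qv PG' lv' qv'.
  suff -> : G = G' by [].
  apply: etrans (splice_recover HP v PG) _; apply: etrans (esym (splice_recover HP v PG')).
  by rewrite hq En E.
- move=> [G S]; rewrite inE /= => /and5P[PG _ /eqP cS _ _].
  case: ifP => [/andP[/eqP cG _]|]; last by rewrite cards0.
  by rewrite cardsX cS leq_mul2l HD // orbT.
Qed.

Lemma iso_sets_rec j a k d :
  (forall G, P G -> #|G| = a -> j + d <= #|[set v | low G v]|) ->
  d * #|iso_sets j a k| <= j.+1 * #|iso_sets j.+1 a (k + 3)| +
    (j.+1 * (#|V| + a)) * #|iso_sets j.+1 (a - 1) (k + 3)| +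
    (j.+1 * a) * #|iso_sets j.+1 (a - 2) (k + 3)|.
Proof.
move=> Hlow.
pose q0 (G : {set {set V}}) v := deg G v == 0.
pose q1 (G : {set {set V}}) v := deg G v == 1.
pose q2 (G : {set {set V}}) v := (deg G v == 2) && (nbrs G v \notin G).
pose q3 (G : {set {set V}}) v := (deg G v == 2) && (nbrs G v \in G).
have nN G v : P G -> deg G v != 2 -> nbrs G v \notin G.
  move=> PG; apply: contra => nG.
  by have /forall_inP/(_ _ nG) := pl_simple HP PG.
pose T (q : {set {set V}} -> V -> bool) (p : {set {set V}} * {set V}) :=
  #|[set v | [&& v \notin p.2, low p.1 v & q p.1 v]]|.
have T0 : \sum_(p in iso_sets j a k) T q0 p <= (j.+1 * 1) * #|iso_sets j.+1 (a - 0) (k + 3)|.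
  apply: (@splice_count j a k q0 0 1 (fun=> [set set0])) => [G v PG lv /eqP d0|G v PG lv||].
  - by rewrite -(card_splice HP PG lv) d0.
  - by rewrite /q0 /deg cards_eq0 inE.
  - move=> G v G' v' PG _ /eqP d0 PG' _ /eqP d0'.
    by rewrite !(negbTE (nN _ _ _ _)) // ?d0 ?d0'.
  - by move=> G _ _; rewrite cards1.
have T1 : \sum_(p in iso_sets j a k) T q1 p <= (j.+1 * #|V|) * #|iso_sets j.+1 (a - 1) (k + 3)|.
  apply: (@splice_count j a k q1 1 #|V| (fun=> [set [set x] | x : V])) => [G v PG lv /eqP d0|G v PG lv||].
  - by rewrite -(card_splice HP PG lv) d0.
  - by move=> /cards1P[x ->]; exact: imset_f.
  - move=> G v G' v' PG _ /eqP d0 PG' _ /eqP d0'.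
    by rewrite !(negbTE (nN _ _ _ _)) // ?d0 ?d0'.
  - by move=> G _ _; exact: leq_imset_card.
have T2 : \sum_(p in iso_sets j a k) T q2 p <= (j.+1 * a) * #|iso_sets j.+1 (a - 1) (k + 3)|.
  apply: (@splice_count j a k q2 1 a id) => [G v PG lv /andP[d0 nG]|G v PG lv /andP[d0 nG]||].
  - by rewrite -(card_splice HP PG lv) d0 (negPf nG).
  - by rewrite /splice d0 setU11.
  - by move=> G v G' v' _ _ /andP[_ /negPf->] _ _ /andP[_ /negPf->].
  - by move=> G _ <-; exact: leq_addr.
have T3 : \sum_(p in iso_sets j a k) T q3 p <= (j.+1 * a) * #|iso_sets j.+1 (a - 2) (k + 3)|.
  apply: (@splice_count j a k q3 2 a id) => [G v PG lv /andP[d0 nG]|G v PG lv /andP[d0 nG]||].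
  - by rewrite -(card_splice HP PG lv) d0 nG.
  - by rewrite /splice d0 setU11.
  - by move=> G v G' v' _ _ /andP[_ ->] _ _ /andP[_ ->].
  - by move=> G _ <-; exact: leq_addr.
have : \sum_(p in iso_sets j a k) d <= \sum_(p in iso_sets j a k) (T q0 p + T q1 p + T q2 p + T q3 p).
  apply: leq_sum => -[G S]; rewrite inE /= => /and5P[PG /eqP cG /eqP cS _ _].
  have := Hlow G PG cG; rewrite -cS.
  have : #|[set v | low G v]| <= #|S| + #|[set v | (v \notin S) && low G v]|.
    apply: leq_trans (leq_card_setU _ _); apply/subset_leq_card/subsetP => v.
    by rewrite !inE; case: (v \in S).
  have : #|[set v | (v \notin S) && low G v]| <= T q0 (G, S) + T q1 (G, S) + T q2 (G, S) + T q3 (G, S).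
    pose U (q : {set {set V}} -> V -> bool) := [set v | [&& v \notin S, low G v & q G v]].
    change (#|[set v | (v \notin S) && low G v]| <= #|U q0| + #|U q1| + #|U q2| + #|U q3|).
    apply: (@leq_trans #|U q0 :|: U q1 :|: U q2 :|: U q3|).
      apply/subset_leq_card/subsetP => v.
      rewrite !inE /= /q0 /q1 /q2 /q3 => /andP[-> lv]; rewrite lv /=.
      by move: lv; rewrite /low; case: (deg G v) => [|[|[|]]] //=; case: (_ \in G).
    do 2! (apply: leq_trans (leq_card_setU _ _) _; rewrite leq_add2r).
    exact: leq_card_setU.
  move=> h1 h2 h3; rewrite -(leq_add2l #|S|).
  by apply: leq_trans h3 (leq_trans h2 _); rewrite leq_add2l.
rewrite sum_nat_const !big_split /= mulnC => le; apply: leq_trans le _.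
rewrite subn0 muln1 in T0; rewrite mulnDr mulnDl addnA.
exact: leq_add (leq_add (leq_add T0 T1) T2) T3.
Qed.

Lemma place_step a k : #|iso_sets h a k| <= #|comp_sets (a + eH) (k + h)|.
Proof.
have dis p : p \in iso_sets h a k -> [disjoint p.1 & place p.2].
  case: p => G S; rewrite inE /= => /and5P[PG _ /eqP cS /forall_inP iS _].
  apply/pred0P => e /=; apply/negP => /andP[eG /(cf_place_sub HC cS) eS].
  have /forall_inP/(_ _ eG)/eqP e2 := pl_simple HP PG.
  have /card_gt0P[w we] : 0 < #|e| by rewrite e2.
  by have := isolated_vertexP _ _ (iS w (subsetP eS _ we)) _ eG; rewrite we.
rewrite -(card_in_imset (f := fun p => (p.1 :|: place p.2, p.2))) => [|[G S] [G' S']]; last first.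
  move=> /dis d1 /dis d2 [/= E ES]; subst S'; congr (_, _).
  have split (A B : {set {set V}}) : [disjoint A & B] -> A = (A :|: B) :\: B.
    by move=> dAB; rewrite setDUl setDv setU0; apply/esym/setDidPl.
  by rewrite (split G _ d1) (split G' _ d2) /= E.
apply/subset_leq_card/subsetP => _ /imsetP[[G S] pin ->]; have := dis _ pin; move: pin.
rewrite !inE /= => /and5P[PG /eqP cG /eqP cS /forall_inP iS XG] dGS.
have [-> ->] := cf_place HC PG cS iS.
rewrite cardsU disjoint_setI0 // cards0 subn0 cG (cf_place_card HC cS) eqxx /=.
apply: leq_ltn_trans (hcomp_change (G := G) (W := S) _) _; last by rewrite cS ltn_add2r.
move=> e; rewrite in_setU; case: (e \in G) => //= eS; apply: (cf_place_sub HC cS).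
by move: eS; case: (e \in place S).
Qed.

Lemma comp_edges_touching S : #|[set e : {set V} | (#|e| == 2) && ~~ [disjoint e & S]]| <= #|S| * #|V|.
Proof.
rewrite -cardsT -cardsX; apply: leq_trans (leq_imset_card (fun p : V * V => [set p.1; p.2]) _).
apply/subset_leq_card/subsetP => e; rewrite inE => /andP[/cards2P[x [y [_ ->]]]].
move=> /pred0Pn[z /= /andP[]]; rewrite in_set2 => /orP[]/eqP -> zS; apply/imsetP.
  by exists (x, y); rewrite ?in_setX ?zS ?inE.
by exists (y, x); rewrite ?in_setX ?zS ?inE //= setUC.
Qed.

Lemma hcomp_away G G' e S : (forall f, (f \in G) != (f \in G') -> f = e) ->
  [disjoint e & S] -> S \in hcomp G -> S \in hcomp G'.
Proof.
move=> He dS SG; apply: (cf_local HC (W := e)) SG _; last by rewrite disjoint_sym.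
by move=> f; rewrite eq_sym => /He ->.
Qed.

Lemma add_step a k d :
  (forall G, P G -> #|G| = a -> d + h * #|V| <= #|addables P G|) ->
  d * #|comp_sets a k| <= a.+1 * #|comp_sets a.+1 (k + 2)|.
Proof.
move=> Hadd.
pose ch (p : {set {set V}} * {set V}) := [set e in addables P p.1 | [disjoint e & p.2]].
apply: (@leq_trans (\sum_(p in comp_sets a k) #|ch p|)).
  rewrite mulnC -sum_nat_const; apply: leq_sum => -[G S]; rewrite inE /= => /and4P[PG /eqP cG SG _].
  have := Hadd G PG cG; rewrite -(cf_card HC SG); have := comp_edges_touching S.
  have : #|addables P G| <= #|ch (G, S)| + #|[set e : {set V} | (#|e| == 2) && ~~ [disjoint e & S]]|.
    apply: leq_trans (leq_card_setU _ _); apply/subset_leq_card/subsetP => e.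
    by rewrite !inE => /and3P[-> -> ->] /=; case: [disjoint e & S].
  move=> h1 h2 h3; rewrite -(leq_add2r (#|S| * #|V|)).
  by apply: leq_trans h3 (leq_trans h1 _); rewrite leq_add2l.
apply: (@double_count _ _ _ {set V} _ _ _
  (fun p e => (e |: p.1, p.2)) (fun p e => e) (fun p => if #|p.1| == a.+1 then p.1 else set0)).
- move=> [G S] e; rewrite !inE /= => /and4P[PG /eqP cG SG XG] /andP[/and3P[/eqP ce eG Pe] dS].
  have cE : #|e |: G| = a.+1 by rewrite cardsU1 eG cG.
  have chg f : (f \in G) != (f \in e |: G) -> f = e.
    by rewrite in_setU1; case: (eqVneq f e) => //= _; rewrite eqxx.
  rewrite cE eqxx setU11 Pe (hcomp_away chg dS SG) /=; split => //.
  apply: leq_ltn_trans (hcomp_change (G := G) (W := e) _) _; last by rewrite ce ltn_add2r.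
  by move=> f /chg ->.
- move=> [G S] e [G' S'] e'; rewrite !inE /= => _ /andP[/and3P[_ eG _] _] _ /andP[/and3P[_ eG' _] _].
  move=> [E ->] ee; subst e'; by rewrite -(setU1K eG) -(setU1K eG') E.
- by move=> [G S] _ /=; case: eqP => [->|]; rewrite ?cards0.
Qed.

Lemma del_step a k d : d + 2 ^ h <= a.+1 ->
  d * #|comp_sets a.+1 k| <= (#|V| ^ 2) * #|comp_sets a (k + 2)|.
Proof.
move=> Hd.
pose ch (p : {set {set V}} * {set V}) := [set e in p.1 | [disjoint e & p.2]].
apply: (@leq_trans (\sum_(p in comp_sets a.+1 k) #|ch p|)).
  rewrite mulnC -sum_nat_const; apply: leq_sum => -[G S]; rewrite inE /= => /and4P[PG /eqP cG SG _].
  have : #|G| <= #|ch (G, S)| + #|powerset S|.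
    apply: leq_trans (leq_card_setU _ _); apply/subset_leq_card/subsetP => e eG.
    by rewrite !inE eG /=; case: (boolP [disjoint e & S]) => //= dS; exact: (cf_closed HC PG SG).
  rewrite card_powerset (cf_card HC SG) cG => le.
  by rewrite -(leq_add2r (2 ^ h)); apply: leq_trans Hd le.
apply: (@double_count _ _ _ {set V} _ _ _
  (fun p e => (p.1 :\ e, p.2)) (fun p e => e) (fun p => [set e : {set V} | #|e| == 2])).
- move=> [G S] e; rewrite !inE /= => /and4P[PG /eqP cG SG XG] /andP[eG dS].
  have /forall_inP/(_ _ eG) ce := pl_simple HP PG.
  have chg f : (f \in G) != (f \in G :\ e) -> f = e.
    by rewrite in_setD1; case: (eqVneq f e) => //= _; rewrite eqxx.
  have cE : #|G :\ e| = a by move: cG; rewrite (cardsD1 e G) eG => -[].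
  rewrite cE eqxx (hcomp_away chg dS SG) ce (pl_sub HP (subD1set _ _) PG) /=; split => //.
  apply: leq_ltn_trans (hcomp_change (G := G) (W := e) _) _; last by rewrite (eqP ce) ltn_add2r.
  by move=> f /chg ->.
- move=> [G S] e [G' S'] e'; rewrite !inE /= => _ /andP[eG _] _ /andP[eG' _].
  move=> [E ->] ee; subst e'; by rewrite -(setD1K eG) -(setD1K eG') E.
- by move=> _ _; rewrite card_draws bin2 -mulnn; case: #|V| => // n /=; nia.
Qed.

End Switching.

Local Open Scope ring_scope.

Section Estimate.
Variables (V : finType) (P : pred {set {set V}}) (h eH : nat).
Variables (hcomp : {set {set V}} -> {set {set V}}) (place : {set V} -> {set {set V}}).
Hypothesis HP : planar_like P.
Hypothesis HC : component_family P h eH hcomp place.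
Hypothesis eH_lt : (eH < h)%N.
Variables (R : realFieldType) (c : R) (m A : nat).
Hypothesis c_gt0 : 0 < c.
Local Notation n := #|V|.
Hypothesis n_gt0 : (0 < n)%N.
Hypothesis m_ge : (2 * h <= m)%N.
Hypothesis m_le : (m <= 2 * n)%N.
Hypothesis cm : c / 2 * n%:R <= m%:R - 2 ^+ h.
Hypothesis A_le : (A <= n ^ 2)%N.
Hypothesis A_ge : (2 * h * n <= A)%N.
Hypothesis A_ge4 : (4 * n <= A)%N.
Hypothesis addA : forall G, P G -> (#|G| < m)%N -> (A <= #|addables P G|)%N.
Variable d : nat.
Hypothesis d_ge : (n <= 8 * d)%N.
Hypothesis lowd : forall G, P G -> (#|G| <= m)%N -> (h + d <= #|[set v | low G v]|)%N.

Let w : R := A%:R / n%:R.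
Let isos j L k : R := #|iso_sets P hcomp j (m - L) k|%:R.
Let comps a k : R := #|comp_sets P hcomp a k|%:R.

Let nR_gt0 : (0 : R) < n%:R. Proof. by rewrite ltr0n. Qed.
Let nR_ge1 : (1 : R) <= n%:R. Proof. by rewrite ler1n. Qed.
Let w_ge4 : 4 <= w.
Proof. by rewrite /w ler_pdivlMr // -natrM ler_nat. Qed.
Let w_le : w <= n%:R.
Proof. by rewrite /w ler_pdivrMr // -natrM ler_nat mulnn. Qed.

Lemma comp_sets_mono a k k' : (k <= k')%N -> comps a k <= comps a k'.
Proof.
move=> kk; rewrite /comps ler_nat; apply/subset_leq_card/subsetP => p.
by rewrite !inE => /and4P[-> -> -> /=] /leq_trans; apply.
Qed.

Lemma isos_rec j L k : (j < h)%N ->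
  isos j L k <= 24 * h%:R * (isos j.+1 L (k + 3) / n%:R +
                     isos j.+1 L.+1 (k + 3) + isos j.+1 L.+2 (k + 3)).
Proof.
move=> jh; have := @iso_sets_rec _ P h eH hcomp place HP HC j (m - L) k d.
have H G : P G -> #|G| = (m - L)%N -> (j + d <= #|[set v | low G v]|)%N.
  move=> PG cG; apply: leq_trans (lowd PG _); last by rewrite cG leq_subr.
  by rewrite leq_add2r ltnW.
move=> /(_ H); rewrite -!subnDA addn1 addn2.
rewrite -(ler_nat R) !(natrD, natrM) -/(isos _ _ _) -/(isos _ _ _) -/(isos _ _ _) -/(isos _ _ _).
have a_le : ((m - L)%N%:R : R) <= 2 * n%:R by rewrite -natrM ler_nat (leq_trans (leq_subr _ _)).
have dn : (n%:R : R) <= 8 * d%:R by rewrite -natrM ler_nat.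
have jhR : (j.+1%:R : R) <= h%:R by rewrite ler_nat.
have j0 : (0 : R) <= j.+1%:R by rewrite ler0n.
have a0 : (0 : R) <= (m - L)%N%:R by rewrite ler0n.
have : 0 <= isos j.+1 L (k + 3) by rewrite ler0n.
have : 0 <= isos j.+1 L.+1 (k + 3) by rewrite ler0n.
have : 0 <= isos j.+1 L.+2 (k + 3) by rewrite ler0n.
have : 0 <= isos j L k by rewrite ler0n.
move: (isos j L k) (isos j.+1 L (k + 3)) (isos j.+1 L.+1 (k + 3)) (isos j.+1 L.+2 (k + 3)).
move: a_le dn jhR j0 a0 nR_gt0.
move: ((m - L)%N%:R : R) (d%:R : R) (j.+1%:R : R) (h%:R : R) (n%:R : R) => a dR jR hR nR.
move=> a_le dn jh' j0 a0 n0 x y0 y1 y2 x0 y20 y10 y00 rec.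
rewrite -(ler_pM2r n0).
have -> : 24 * hR * (y0 / nR + y1 + y2) * nR = hR * (24 * y0 + 24 * nR * y1 + 24 * nR * y2).
  by field; rewrite gt_eqF.
have xd : nR * x <= 8 * dR * x by exact: ler_wpM2r.
have ny1 : (nR + a) * y1 <= 3 * nR * y1 by apply: ler_wpM2r => //; lra.
have ny2 : a * y2 <= 2 * nR * y2 by exact: ler_wpM2r.
have y0' : 0 <= y0 + 3 * nR * y1 + 2 * nR * y2 by nra.
have hy : jR * (y0 + 3 * nR * y1 + 2 * nR * y2) <= hR * (y0 + 3 * nR * y1 + 2 * nR * y2).
  exact: ler_wpM2r.
have jy : jR * (y0 + (nR + a) * y1 + a * y2) <= jR * (y0 + 3 * nR * y1 + 2 * nR * y2).
  by apply: ler_wpM2l => //; lra.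
have : 0 <= hR * (nR * y2) by rewrite !mulr_ge0 // ?(ltW n0) // (le_trans j0).
have : 0 <= hR * y0 by rewrite mulr_ge0 // (le_trans j0).
lra.
Qed.

Lemma comps_up i k : (i <= m)%N -> comps (m - i) k <= (4 / w) ^+ i * comps m (k + 2 * i).
Proof.
elim: i k => [|i IHi] k im; first by rewrite subn0 muln0 addn0 expr0 mul1r.
have -> : (k + 2 * i.+1 = k + 2 + 2 * i)%N by clear; lia.
apply: (@le_trans _ _ (4 / w * comps (m - i) (k + 2))); last first.
  rewrite exprS -(mulrA (4 / w)); apply: ler_wpM2l; last exact/IHi/ltnW.
  by rewrite divr_ge0 // (le_trans _ w_ge4).
have := @add_step _ P h eH hcomp place HC (m - i.+1) k (A - h * n).
have H G : P G -> #|G| = (m - i.+1)%N -> (A - h * n + h * n <= #|addables P G|)%N.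
  move=> PG cG; rewrite subnK; last by apply: leq_trans A_ge; rewrite -mulnA leq_pmull.
  by apply: addA PG _; rewrite cG; clear -im; lia.
move=> /(_ H); rewrite -(ler_nat R) !natrM -!/(comps _ _).
have -> : (m - i.+1).+1 = (m - i)%N by clear -im; lia.
have : (A%:R : R) <= 2 * (A - h * n)%N%:R by rewrite -natrM ler_nat; clear -A_ge; lia.
have : ((m - i)%N%:R : R) <= 2 * n%:R by rewrite -natrM ler_nat (leq_trans (leq_subr _ _)).
have : 0 <= comps (m - i) (k + 2) by rewrite ler0n.
have : 0 <= comps (m - i.+1) k by rewrite ler0n.
have A0 : (0 : R) < A%:R by rewrite ltr0n; apply: leq_trans A_ge4; rewrite muln_gt0.
have -> : 4 / w = 4 * n%:R / A%:R by rewrite /w; field; rewrite !gt_eqF.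
move: (comps _ _) (comps _ _) ((A - h * n)%N%:R : R) ((m - i)%N%:R : R) => x y dR a x0 y0 an Ad rec.
rewrite mulrAC ler_pdivlMr //; nra.
Qed.

Lemma comps_down i k : comps (m + i) k <= (2 * n%:R / c) ^+ i * comps m (k + 2 * i).
Proof.
elim: i k => [|i IHi] k; first by rewrite muln0 !addn0 expr0 mul1r.
have -> : (k + 2 * i.+1 = k + 2 + 2 * i)%N by clear; lia.
apply: (@le_trans _ _ (2 * n%:R / c * comps (m + i) (k + 2))); last first.
  rewrite exprS -(mulrA (2 * _ / c)); apply: ler_wpM2l; last exact: IHi.
  by rewrite divr_ge0 ?ltW // mulr_gt0.
have cn0 : 0 < c / 2 * n%:R by rewrite mulr_gt0 // divr_gt0.
have hm : (2 ^ h <= m)%N.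
  by rewrite -(ler_nat R) natrX -subr_ge0 (le_trans _ cm) // ltW.
have := @del_step _ P h eH hcomp place HP HC (m + i) k (m - 2 ^ h).
rewrite -addnS => /(_ ltac:(clear -hm; lia)); rewrite -(ler_nat R) !natrM -!/(comps _ _) natrB // !natrX.
have : 0 <= comps (m + i) (k + 2) by rewrite ler0n.
have : 0 <= comps (m + i.+1) k by rewrite ler0n.
move: (comps _ _) (comps _ _) cm => x y cm' x0 y0 rec.
rewrite mulrAC ler_pdivlMr // -(ler_pM2r nR_gt0).
have : c / 2 * n%:R * y <= (m%:R - 2 ^+ h) * y by exact: ler_wpM2r.
move: (m%:R - 2 ^+ h) (n%:R : R) rec => t nR rec le.
lra.
Qed.

(* Up to constants, gain j L bounds the number of pairs (graph with m - L edges, j isolated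
   vertices) relative to the number of pairs (graph with m edges, chosen component). *)
Let gain j L : R := if (L < j)%N then n%:R ^+ (j - 1 - L) else w^-1.
Let D0 : R := 4 + (1 + 2 / c) ^+ h.

Lemma isos_end L k : (L <= 2 * h)%N -> isos h L k <= D0 * gain h L * comps m (k + 5 * h).
Proof.
move=> Lh; have Lm := leq_trans Lh m_ge; have w0 : 0 < w by apply: lt_le_trans w_ge4.
have c0 : 0 < 2 / c by rewrite divr_gt0.
have E0 : 1 <= (1 + 2 / c) ^+ h by apply: exprn_ege1; lra.
have Y0 a k' : 0 <= comps a k' by rewrite ler0n.
have w41 : 4 / w <= 1 by rewrite ler_pdivrMr // mul1r.
have w40 : 0 <= 4 / w by rewrite divr_ge0 ?ltW.
apply: (@le_trans _ _ (comps (m - L + eH) (k + h))).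
  by rewrite /isos /comps ler_nat; exact: (place_step HP HC).
case: (leqP L eH) => LeH.
  have -> : (m - L + eH = m + (eH - L))%N by clear -LeH Lm; lia.
  apply: le_trans (comps_down _ _) _.
  have -> : gain h L = n%:R ^+ (h - 1 - L) by rewrite /gain (leq_ltn_trans LeH).
  apply: (@le_trans _ _ ((2 * n%:R / c) ^+ (eH - L) * comps m (k + 5 * h))).
    apply: ler_wpM2l; last by apply: comp_sets_mono; clear -LeH Lh eH_lt; lia.
    by rewrite exprn_ge0 // divr_ge0 ?ltW // mulr_gt0.
  apply: ler_wpM2r => //.
  have -> : 2 * n%:R / c = (2 / c) * n%:R by ring.
  rewrite exprMn; apply: ler_pM.
  - by rewrite exprn_ge0 // ltW.
  - by rewrite exprn_ge0.
  - apply: (@le_trans _ _ ((1 + 2 / c) ^+ h)); last by rewrite /D0; lra.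
    apply: (@le_trans _ _ ((1 + 2 / c) ^+ (eH - L))).
      by apply: lerXn2r; rewrite ?nnegrE; lra.
    apply: ler_weXn2l; [lra|clear -LeH eH_lt; lia].
  - by apply: ler_weXn2l => //; clear -LeH eH_lt; lia.
have -> : (m - L + eH = m - (L - eH))%N by clear -LeH Lm; lia.
have im : (L - eH <= m)%N by clear -Lm; lia.
apply: le_trans (comps_up _ im) _.
apply: (@le_trans _ _ ((4 / w) ^+ (L - eH) * comps m (k + 5 * h))).
  apply: ler_wpM2l; last by apply: comp_sets_mono; clear -LeH Lh eH_lt; lia.
  by rewrite exprn_ge0.
apply: ler_wpM2r => //.
have p1 : (4 / w) ^+ (L - eH) <= 4 / w.
  rewrite -[leRHS]expr1; apply: ler_wiXn2l => //; clear -LeH; lia.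
have : 4 / w <= D0 * gain h L; last exact: le_trans.
rewrite /gain; case: ifP => _; last by rewrite ler_pM2r ?invr_gt0 // /D0; lra.
have : 1 <= (n%:R : R) ^+ (h - 1 - L) by apply: exprn_ege1.
by rewrite /D0; nra.
Qed.

Lemma gain_step j L : [/\ gain j.+1 L / n%:R <= gain j L, gain j.+1 L.+1 <= gain j L
  & gain j.+1 L.+2 <= gain j L].
Proof.
have w0 : 0 < w by apply: lt_le_trans w_ge4.
have wi1 : w^-1 <= 1 by rewrite invf_le1 //; have := w_ge4; lra.
rewrite /gain !ltnS; case: (ltnP L j) => Lj.
  have n1 : 1 <= (n%:R : R) ^+ (j - 1 - L) by apply: exprn_ege1.
  rewrite (ltnW Lj); split.
  - have -> : (j.+1 - 1 - L = (j - 1 - L).+1)%N by clear -Lj; lia.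
    by rewrite exprSr mulfK // gt_eqF.
  - by have -> : (j.+1 - 1 - L.+1 = j - 1 - L)%N by clear -Lj; lia.
  - case: ifP => _; last exact: le_trans n1.
    by apply: ler_weXn2l => //; clear -Lj; lia.
have -> : (L.+1 < j)%N = false by clear -Lj; lia.
split => //.
case: leqP => Lj'.
  have -> : (j.+1 - 1 - L = 0)%N by clear -Lj Lj'; lia.
  by rewrite expr0 mul1r lef_pV2 ?posrE.
by rewrite ler_piMr ?invr_ge0 ?(ltW w0) // invf_le1.
Qed.

Lemma isos_bound i k : (i <= h)%N -> forall L, (L <= 2 * (h - i))%N ->
  isos (h - i) L (k + 3 * (h - i)) <=
  (72 * h%:R) ^+ i * (D0 * gain (h - i) L) * comps m (k + 8 * h).
Proof.
elim: i => [|i IHi] ih L Lh.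
  rewrite subn0 in Lh *; rewrite expr0 mul1r.
  have -> : (k + 8 * h = k + 3 * h + 5 * h)%N by clear; lia.
  exact: isos_end.
have jE : (h - i = (h - i.+1).+1)%N by clear -ih; lia.
set j := (h - i.+1)%N in jE Lh *; rewrite jE in IHi.
have jh : (j < h)%N by rewrite -jE leq_subr.
apply: le_trans (isos_rec _ _ jh) _.
have kE : (k + 3 * j + 3 = k + 3 * j.+1)%N by clear; lia.
rewrite kE.
have B0 := IHi (ltnW ih) L ltac:(clear -Lh; lia).
have B1 := IHi (ltnW ih) L.+1 ltac:(clear -Lh; lia).
have B2 := IHi (ltnW ih) L.+2 ltac:(clear -Lh; lia).
have [g0 g1 g2] := gain_step j L.
have c0 : 0 < 2 / c by rewrite divr_gt0.
have D00 : 0 <= D0 by rewrite /D0 addr_ge0 // exprn_ge0 //; lra.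
set Q := (72 * h%:R) ^+ i * D0 * comps m (k + 8 * h).
have Q0 : 0 <= Q by rewrite !mulr_ge0 // ?exprn_ge0 ?ler0n // mulr_ge0.
have QE L' : (72 * h%:R) ^+ i * (D0 * gain j.+1 L') * comps m (k + 8 * h) = Q * gain j.+1 L'.
  by rewrite /Q; ring.
rewrite !QE in B0 B1 B2.
have {B0} C0 : isos j.+1 L (k + 3 * j.+1) / n%:R <= Q * gain j L.
  apply: le_trans (ler_wpM2l Q0 g0).
  by rewrite mulrA ler_wpM2r // invr_ge0.
have {B1} C1 := le_trans B1 (ler_wpM2l Q0 g1).
have {B2} C2 := le_trans B2 (ler_wpM2l Q0 g2).
have -> : (72 * h%:R) ^+ i.+1 * (D0 * gain j L) * comps m (k + 8 * h) =
   24 * h%:R * (3 * (Q * gain j L)) by rewrite /Q exprS; ring.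
apply: ler_wpM2l; first by rewrite mulr_ge0.
lra.
Qed.

Theorem few_comps_step k :
  #|few_comps P hcomp m k|%:R * w <=
  (72 * h%:R) ^+ h * D0 * (k + 8 * h)%N%:R * #|few_comps P hcomp m (k + 8 * h)|%:R.
Proof.
have w0 : 0 < w by apply: lt_le_trans w_ge4.
have := isos_bound k (leqnn h) (L := 0) isT.
rewrite subnn muln0 addn0 /gain ltnn => B.
have F0 : #|few_comps P hcomp m k|%:R <= isos 0 0 k.
  by rewrite /isos subn0 ler_nat; exact: iso_sets0.
have Y : comps m (k + 8 * h) <= (k + 8 * h)%N%:R * #|few_comps P hcomp m (k + 8 * h)|%:R.
  by rewrite -natrM ler_nat; exact: comp_sets_few.
have c0 : 0 < 2 / c by rewrite divr_gt0.
have D00 : 0 <= D0 by rewrite /D0 addr_ge0 // exprn_ge0 //; lra.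
rewrite -ler_pdivlMr //; apply: le_trans F0 _; apply: le_trans B _.
rewrite mulrA -!mulrA ler_wpM2l ?exprn_ge0 ?mulr_ge0 // ler_wpM2l //.
by rewrite mulrC !mulrA ler_wpM2r ?invr_ge0 ?(ltW w0).
Qed.

End Estimate.

Local Close Scope ring_scope.

(** * Components order-isomorphic to a tree *)

Section Forests.
Variable U : finType.
Implicit Types (F : {set {set U}}) (u v : U).

Definition acyclic F := forall s : seq U, ucycle (adj F) s -> size s <= 2.

Lemma adj_sym F : symmetric (adj F).
Proof. by move=> u v; rewrite /adj /= setUC. Qed.

Lemma acyclic_sub F F' : F' \subset F -> acyclic F -> acyclic F'.
Proof.
move=> /subsetP sF aF s /andP[cs us]; apply: aF; rewrite /ucycle us andbT.
by apply: sub_cycle cs => u v; exact: sF.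
Qed.

Lemma acyclic_leaf F : simple_graph F -> acyclic F -> F != set0 -> exists v, deg F v == 1.
Proof.
move=> sF aF /set0Pn[e eF]; apply/existsP; apply: contraT => /existsPn noleaf.
have long k : exists x p, [/\ path (adj F) x p, uniq (x :: p) & size p = k.+1].
  elim: k => [|k [x [p [pp up sp]]]].
    have /forall_inP/(_ _ eF)/cards2P[a [b [ab eE]]] := sF.
    by exists a, [:: b]; rewrite /= inE ab /adj /= -eE eF.
  case: p pp up sp => // y p pp up sp.
  have yx : y \in nbrs F x by move: pp; rewrite /= inE setUC => /andP[].
  have [z zx zy] : exists2 z, z \in nbrs F x & z != y.
    have : 0 < #|nbrs F x :\ y|.
      have := cardsD1 y (nbrs F x); rewrite yx -/(deg F x).
      by have := noleaf x; case: #|nbrs F x :\ y| => // /eqP d1 d1'; case: d1.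
    by move=> /card_gt0P[z]; rewrite in_setD1 => /andP[]; exists z.
  have xz : x != z by rewrite eq_sym; exact: nbrs_neq zx.
  have exz : adj F z x by rewrite /adj /= -in_nbrs.
  case: (boolP (z \in x :: y :: p)) => [|zp]; last first.
    by exists z, (x :: y :: p); split; [rewrite /= exz|rewrite cons_uniq zp|rewrite /= -sp].
  rewrite inE eq_sym (negPf xz) /= => zp; exfalso.
  have [q qE] : exists q, q = y :: p by exists (y :: p).
  rewrite -qE in pp up zp; case/splitPr: zp pp up qE => p1 p2 pp up qE.
  have := aF (x :: rcons p1 z); rewrite /ucycle.
  have -> : path.cycle (adj F) (x :: rcons p1 z).
    rewrite /= rcons_path last_rcons exz andbT.
    by move: pp; rewrite -cat_rcons cat_path => /andP[].
  have -> : uniq (x :: rcons p1 z).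
    by move: up; rewrite -cat_rcons -cat_cons cat_uniq => /andP[].
  move=> /(_ isT); rewrite /= size_rcons; case: p1 qE {pp up} => //= -[E].
  by rewrite E eqxx in zy.
have [x [p [_ up sp]]] := long #|U|.
by have := card_uniqP up; have := max_card (mem (x :: p)); rewrite /= sp => le E; rewrite E ltnNge leqnSn in le.
Qed.

Lemma acyclic_ind (Q : {set {set U}} -> Prop) : Q set0 ->
  (forall F u v, simple_graph F -> acyclic F -> u != v -> [set u; v] \in F ->
     isolated_vertex (F :\ [set u; v]) v -> Q (F :\ [set u; v]) -> Q F) ->
  forall F, simple_graph F -> acyclic F -> Q F.
Proof.
move=> Q0 QS F; have [k] := ubnP #|F|; elim: k F => // k IHk F cF sF aF.
have [->//|F0] := eqVneq F set0.
have [v /cards1P[u nv]] := acyclic_leaf sF aF F0.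
have un : u \in nbrs F v by rewrite nv set11.
have uvF : [set u; v] \in F by rewrite -in_nbrs.
have sub : F :\ [set u; v] \subset F by exact: subD1set.
apply: (QS F u v) => //; first exact: nbrs_neq un.
  apply/isolated_vertexP => e; rewrite in_setD1 => /andP[ne eF]; apply: contra ne => ve.
  by have [y + ->] := edgeP sF eF ve; rewrite nv in_set1 => /eqP ->.
apply: IHk; last exact: acyclic_sub aF.
  by move: cF; rewrite (cardsD1 [set u; v] F) uvF.
by apply/forall_inP => e /(subsetP sub) eF; have /forall_inP := sF; apply.
Qed.

Lemma acyclic_card F : simple_graph F -> acyclic F -> 0 < #|U| -> #|F| < #|U|.
Proof.
move=> sF aF U0; pose live F' := [set u | ~~ isolated_vertex F' u].
suff [->|lt] : F = set0 \/ #|F| < #|live F|; first by rewrite cards0.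
  by apply: leq_trans lt (max_card _).
apply: (acyclic_ind (Q := fun F => F = set0 \/ #|F| < #|live F|)) => // [|{sF aF}F' u v sF aF uv uvF iv IH]; first by left.
right; have cF : #|F'| = #|F' :\ [set u; v]|.+1 by rewrite (cardsD1 [set u; v] F') uvF.
have lv : v \in live F' by rewrite inE; apply/negP => /isolated_vertexP/(_ _ uvF); rewrite set22.
have lu : u \in live F' by rewrite inE; apply/negP => /isolated_vertexP/(_ _ uvF); rewrite set21.
case: IH => [F0|lt].
  rewrite cF F0 cards0; have : [set u; v] \subset live F' by rewrite subUset !sub1set lu.
  by move/subset_leq_card; rewrite cards2 uv.
rewrite cF (cardsD1 v (live F')) lv add1n ltnS; apply: leq_trans lt _.
apply/subset_leq_card/subsetP => w; rewrite in_setD1 !inE => nw.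
apply/andP; split; first by apply: contraNneq nw => ->.
by apply: contra nw; apply: isolated_sub; exact: subD1set.
Qed.

End Forests.

Section PlaceForest.
Variables (U V : finType) (P : pred {set {set V}}).
Hypothesis HP : planar_like P.
Variables (f : U -> V) (G : {set {set V}}).
Hypotheses (injf : injective f) (PG : P G) (isof : forall u, isolated_vertex G (f u)).

Definition graph_image (F : {set {set U}}) : {set {set V}} := [set f @: e | e : {set U} in F].

Lemma imset_set2 u v : f @: [set u; v] = [set f u; f v].
Proof. by rewrite imsetU !imset_set1. Qed.

Lemma place_forest F : simple_graph F -> acyclic F -> P (G :|: graph_image F).
Proof.
move: F; apply: (acyclic_ind (Q := fun F => P (G :|: graph_image F))).
  by rewrite /graph_image imset0 setU0.
move=> F u v sF aF uv uvF iv IH.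
have -> : G :|: graph_image F =
    [set f u; f v] |: (G :|: graph_image (F :\ [set u; v])).
  rewrite setUCA; congr (_ :|: _).
  by rewrite /graph_image -imset_set2 -(imsetU1 (fun e : {set U} => f @: e)) setD1K.
apply: (pl_pendant HP) => //; first by apply: contra_neq uv => /injf.
apply/isolated_vertexP => e; rewrite in_setU => /orP[|/imsetP[e' eF ->]].
  exact: (isolated_vertexP _ _ (isof v)).
rewrite mem_imset //; exact: (isolated_vertexP _ _ iv).
Qed.

End PlaceForest.

Section Components.
Variable V : finType.
Implicit Types (G : {set {set V}}) (C W e : {set V}).

Lemma componentsP G C : reflect (exists x, C = [set y | connect (adj G) x y]) (C \in components G).
Proof.
apply: (iffP imsetP) => [[x _ ->]|[x ->]]; exists x => //; apply/setP => y; by rewrite !inE.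
Qed.

Lemma components_trivIset G : trivIset (components G).
Proof.
have /and3P[_ ? _] : partition (components G) [set: V]; last by [].
apply: equivalence_partitionP => x y z _ _ _; split; first exact: connect0.
by move=> xy; apply: same_connect => //; apply: sym_connect_sym; exact: adj_sym.
Qed.

Lemma connect_local (e e' : rel V) x C : C = [set y | connect e x y] ->
  (forall z z', z \in C -> e z z' = e' z z') -> C = [set y | connect e' x y].
Proof.
move=> CE loc; have step (r : rel V) : (forall z z', z \in C -> r z z' = e z z') ->
    forall p z, z \in C -> path r z p -> last z p \in C /\ path e z p.
  move=> rE; elim=> [|z' p IH] z zC //= /andP[zz' pp].
  have ezz' : e z z' by rewrite -rE.
  have z'C : z' \in C.
    by move: zC; rewrite CE !inE => xz; apply: connect_trans xz (connect1 ezz').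
  by have [? ->] := IH z' z'C pp; rewrite ezz'.
have xC : x \in C by rewrite CE inE connect0.
apply/setP => y; rewrite inE; apply/idP/connectP => [|[p pp ->]]; last first.
  by have [] := step e' (fun z z' zC => esym (loc z z' zC)) p x xC pp.
rewrite {1}CE inE => /connectP[p pp ->]; exists p => //.
elim: p x xC pp {CE} => //= z' p IH z zC /andP[zz' pp]; rewrite -loc // zz' /=.
have [] := step e (fun _ _ _ => erefl) [:: z'] z zC; first by rewrite /= zz'.
by move=> z'C _; exact: IH.
Qed.

Lemma components_local G G' W C :
  (forall e, (e \in G) != (e \in G') -> e \subset W) -> C \in components G' ->
  [disjoint C & W] -> C \in components G /\
  forall z z', z \in C -> adj G z z' = adj G' z z'.
Proof.
move=> HW /componentsP[x CE] dCW.
have loc z z' : z \in C -> adj G z z' = adj G' z z'.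
  move=> zC; apply/eqP; apply: contraT => /HW; rewrite subUset sub1set => /andP[zW _].
  by have := disjointFr dCW zC; rewrite zW.
split => //; apply/componentsP; exists x; apply: connect_local CE _ => z z' zC.
by rewrite loc.
Qed.

End Components.

Section TreeComponents.
Variables (h n : nat) (H : {set {set 'I_h}}) (P : pred {set {set 'I_n}}).
Hypothesis HP : planar_like P.
Hypothesis treeH : is_tree H.
Implicit Types (G : {set {set 'I_n}}) (S C W e : {set 'I_n}).

Definition order_iso_components G := [set C in components G | order_iso H G C].

Definition increasing_onto S (f : {ffun 'I_h -> 'I_n}) :=
  [forall i : 'I_h, forall j : 'I_h, (i < j) ==> (f i < f j)] && (f @: [set: 'I_h] == S).

Definition order_copy S : {set {set 'I_n}} :=
  if [pick f | increasing_onto S f] is Some f then graph_image f H else set0.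

Lemma increasing_inj (f : {ffun 'I_h -> 'I_n}) :
  [forall i : 'I_h, forall j : 'I_h, (i < j) ==> (f i < f j)] -> injective f.
Proof.
move=> /forallP inc i j fij; apply/eqP; apply: contraT => nij.
have /forallP/(_ j)/implyP ij := inc i; have /forallP/(_ i)/implyP ji := inc j.
have : (i : nat) != j by [].
by rewrite neq_ltn => /orP[/ij|/ji]; rewrite fij ltnn.
Qed.

Lemma increasing_exists S : #|S| = h -> exists f, increasing_onto S f.
Proof.
move=> cS; pose f := [ffun i : 'I_h => enum_val (cast_ord (esym cS) i)].
have srt : sorted (fun x y : 'I_n => x < y) (enum S).
  rewrite /enum_mem; apply: sorted_filter; first by move=> x y z; exact: ltn_trans.
  have : sorted ltn (map val (Finite.enum 'I_n)) by rewrite -enumT val_enum_ord; exact: iota_ltn_sorted.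
  by rewrite sorted_map.
exists f; apply/andP; split.
  apply/forallP => i; apply/forallP => j; apply/implyP => ij; rewrite !ffunE.
  have x0 : 'I_n := enum_val (cast_ord (esym cS) i).
  rewrite !(enum_val_nth x0); apply: (sorted_ltn_nth _ x0 srt) => //; rewrite ?inE -?cardE.
  - by move=> y x z; exact: ltn_trans.
  - by rewrite /= cS.
  - by rewrite /= cS.
apply/eqP/setP => x; apply/imsetP/idP => [[i _ ->]|xS]; first by rewrite ffunE enum_valP.
exists (cast_ord cS (enum_rank_in xS x)) => //.
by rewrite ffunE cast_ord_comp cast_ord_id enum_rankK_in.
Qed.

Lemma order_copyP S : #|S| = h -> exists f : {ffun 'I_h -> 'I_n}, [/\ injective f, f @: [set: 'I_h] = S,
  increasing_onto S f & order_copy S = graph_image f H].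
Proof.
move=> cS; rewrite /order_copy; case: pickP => [f fS|none]; last first.
  by have [f] := increasing_exists cS; rewrite none.
by exists f; have := fS => /andP[/increasing_inj ? /eqP ?].
Qed.

Lemma connectH i j : connect (adj H) i j.
Proof.
have [_ /eqP/cards1P[C EC] _] := treeH.
have mem k : [set y | connect (adj H) k y] = C.
  by apply/eqP; rewrite -in_set1 -EC; apply/componentsP; exists k.
have : j \in [set y | connect (adj H) j y] by rewrite inE connect0.
by rewrite mem -(mem i) inE.
Qed.

Lemma tree_h_gt0 : 0 < h.
Proof.
have [_ /eqP/cards1P[C EC] _] := treeH.
have : C \in components H by rewrite EC set11.
by move=> /componentsP[[i ih] _]; exact: leq_ltn_trans ih.
Qed.

Lemma tree_card : #|H| < h.
Proof.
have [sH _ aH] := treeH; have := acyclic_card sH aH.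
by rewrite card_ord => /(_ tree_h_gt0).
Qed.

Lemma order_iso_card G C : order_iso H G C -> #|C| = h.
Proof.
move=> /existsP[f /and3P[/increasing_inj injf /eqP <- _]].
by rewrite card_imset // cardsT card_ord.
Qed.

Lemma tree_component_family : component_family P h #|H| order_iso_components order_copy.
Proof.
have [sH _ aH] := treeH; split.
- move=> G G' W C HW; rewrite !inE => /andP[CG' /existsP[f /and3P[inc /eqP fC /forallP iso]]] dC.
  have [CG loc] := components_local HW CG' dC.
  rewrite CG; apply/existsP; exists f; rewrite inc fC eqxx /=.
  apply/forallP => i; apply/forallP => j; rewrite loc; last by rewrite -fC imset_f.
  by have /forallP := iso i; apply.
- move=> G; apply: trivIsetS (components_trivIset G).
  by apply/subsetP => C; rewrite inE => /andP[].
- by move=> G C; rewrite inE => /andP[_]; exact: order_iso_card.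
- move=> G C e PG; rewrite inE => /andP[/componentsP[x CE] _] eG /pred0Pn[y /andP[/= ye yC]].
  have [z zn ->] := edgeP (pl_simple HP PG) eG ye; rewrite subUset !sub1set yC andbT.
  move: yC; rewrite CE !inE => xy; apply: connect_trans xy (connect1 _).
  by rewrite /adj /= -in_nbrs nbrs_sym.
- move=> S /order_copyP[f [injf _ _ ->]].
  by rewrite card_imset //; exact: imset_inj.
- move=> S e /order_copyP[f [_ <- _ ->]] /imsetP[e' _ ->]; exact: imsetS (subsetT _).
move=> G S PG cS iS; have [f [injf fS /andP[inc _] ->]] := order_copyP cS.
have fSi i : f i \in S by rewrite -fS imset_f.
have isof i : isolated_vertex G (f i) by apply: iS.
split; first exact: place_forest.
set G2 := G :|: _.
have edge i j : adj H i j = adj G2 (f i) (f j).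
  rewrite /adj /= in_setU -imset_set2 mem_imset; last exact: imset_inj.
  case: (boolP (f @: [set i; j] \in G)) => // fG.
  by have := isolated_vertexP _ _ (isof i) _ fG; rewrite imset_f ?set21.
rewrite inE; apply/andP; split; last first.
  apply/existsP; exists f; rewrite inc fS eqxx /=.
  by apply/forallP => i; apply/forallP => j; rewrite edge.
pose i0 := Ordinal tree_h_gt0; apply/componentsP; exists (f i0).
apply/setP => y; rewrite inE; apply/idP/connectP => [|[p pp ->]].
  rewrite -fS => /imsetP[j _ ->]; have /connectP[p pp ->] := connectH i0 j.
  exists (map f p); last by rewrite last_map.
  by rewrite path_map; apply: sub_path pp => a b /=; rewrite -edge.
have : f i0 \in S by [].
elim: p (f i0) pp => //= z p IH x /andP[xz pp] xS; apply: IH pp _.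
move: xz; rewrite /adj /= in_setU => /orP[xzG|/imsetP[e _ E]].
  by have := isolated_vertexP _ _ (iS _ xS) _ xzG; rewrite set21.
have : z \in f @: e by rewrite -E set22.
by move=> /imsetP[j _ ->].
Qed.

End TreeComponents.

From mathcomp Require Import all_classical all_reals all_analysis.
Import numFieldNormedType.Exports.
Local Open Scope classical_set_scope.
Local Open Scope ring_scope.

(** * Simple arcs in the plane *)

Section Arcs.
Variables (R : realType) (V : normedModType R).
Implicit Types (f g : R -> V) (A B K : set V) (x y z q : V) (r s t : R).

(* The retraction of R onto [0, 1]: paths are extended to R by precomposition. *)
Definition clamp t : R := (`|t| - `|t - 1| + 1) / 2.

Lemma clamp_id t : 0 <= t <= 1 -> clamp t = t.
Proof.
move=> /andP[t0 t1]; rewrite /clamp ger0_norm // ler0_norm; last by rewrite subr_le0.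
by field.
Qed.

Lemma clamp_le0 t : t <= 0 -> clamp t = 0.
Proof.
by move=> t0; rewrite /clamp ler0_norm // ler0_norm; [field | lra].
Qed.

Lemma clamp_ge1 t : 1 <= t -> clamp t = 1.
Proof.
by move=> t0; rewrite /clamp !ger0_norm; [field | lra | lra].
Qed.

Lemma clamp_itv t : 0 <= clamp t <= 1.
Proof.
case: (leP t 0) => [/clamp_le0 ->|t0]; first by rewrite lexx ler01.
case: (leP 1 t) => [/clamp_ge1 ->|t1]; first by rewrite lexx ler01.
by rewrite clamp_id ?ltW.
Qed.

Lemma clamp_continuous : continuous clamp.
Proof.
move=> t; rewrite /clamp; apply: cvgMl; apply: cvgD; last exact: cvg_cst.
apply: cvgB; first exact: cvg_norm.
by apply: cvg_norm; apply: cvgB; [exact: cvg_id | exact: cvg_cst].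
Qed.

Lemma within_clamp (f : R -> V) : {within `[0 : R, 1], continuous f} ->
  continuous (f \o clamp).
Proof.
move=> /subspace_continuousP cf t.
have /cf fc : `[0 : R, 1]%classic (clamp t) by rewrite /= in_itv /= clamp_itv.
apply: cvg_comp fc => B /(@clamp_continuous t) nB.
have : \forall u \near (t : R), B (clamp u); last by [].
have {}nB : \forall u \near (t : R), `[0, 1]%classic (clamp u) -> B (clamp u) by [].
near=> u; apply: (near nB u) => //=; by rewrite in_itv /= clamp_itv.
Unshelve. all: by end_near.
Qed.

Definition simple_arc A x y := exists f,
  [/\ continuous f, {in `[0 : R, 1] &, injective f}, f 0 = x, f 1 = y
    & f @` `[0 : R, 1] = A].

Lemma affine_continuous (a b : R) : continuous (fun t => a + t * b).
Proof.
move=> t; apply: cvgD; first exact: cvg_cst.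
by apply: cvgMl; exact: cvg_id.
Qed.

Lemma comp_continuous (h : R -> R) f :
  continuous h -> continuous f -> continuous (f \o h).
Proof. by move=> ch cf t; apply: continuous_comp; [exact: ch | exact: cf]. Qed.

Lemma reparam_continuous (a b : R) f :
  continuous f -> continuous (f \o (fun t => a + t * b)).
Proof. by move=> cf; apply: comp_continuous cf; exact: affine_continuous. Qed.

Lemma sub_arc f s t : continuous f -> {in `[0 : R, 1] &, injective f} ->
  0 <= s -> s < t -> t <= 1 -> simple_arc (f @` `[s, t]) (f s) (f t).
Proof.
move=> cf injf s0 st t1; exists (f \o (fun a => s + a * (t - s))); split.
- exact: reparam_continuous.
- move=> a b; rewrite !in_itv /= => /andP[a0 a1] /andP[b0 b1] /injf eq_ab.
  have: s + a * (t - s) = s + b * (t - s).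
    by apply: eq_ab; rewrite in_itv /=; nra.
  by move=> /addrI /mulIf; apply; rewrite subr_eq0 gt_eqF.
- by rewrite /= mul0r addr0.
- by rewrite /= mul1r addrC subrK.
- apply/seteqP; split => x [a /=]; rewrite in_itv /= => /andP[a0 a1] <-.
    by exists (s + a * (t - s)) => //; rewrite /= in_itv /=; nra.
  have ts : t - s != 0 by rewrite subr_eq0 gt_eqF.
  exists ((a - s) / (t - s)) => /=.
    rewrite in_itv /= divr_ge0 ?subr_ge0 ?(ltW st) //=.
    by rewrite ler_pdivrMr ?subr_gt0 // mul1r lerD2r.
  by rewrite divfK // addrC subrK.
Qed.

Lemma arc_start A x y : simple_arc A x y -> A x.
Proof. by move=> [f [_ _ <- _ <-]]; exists 0 => //=; rewrite in_itv /= lexx ler01. Qed.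

Lemma arc_end A x y : simple_arc A x y -> A y.
Proof. by move=> [f [_ _ _ <- <-]]; exists 1 => //=; rewrite in_itv /= lexx ler01. Qed.

Lemma arc_neq A x y : simple_arc A x y -> x != y.
Proof.
move=> [f [_ injf <- <- _]]; apply/eqP => /injf.
rewrite !in_itv /= !lexx ler01 => /(_ isT isT) /eqP.
by rewrite eq_sym oner_eq0.
Qed.

Lemma arc_sym A x y : simple_arc A x y -> simple_arc A y x.
Proof.
move=> [f [cf injf f0 f1 fA]]; exists (f \o (fun a => 1 + a * (-1))); split.
- exact: reparam_continuous.
- move=> a b; rewrite !in_itv /= => /andP[a0 a1] /andP[b0 b1] /injf eq_ab.
  have: 1 + a * (-1) = 1 + b * (-1) by apply: eq_ab; rewrite in_itv /=; lra.
  lra.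
- by rewrite /= mul0r addr0.
- by rewrite /= mul1r subrr.
- rewrite -fA; apply/seteqP; split => z [a /=]; rewrite in_itv /= => /andP[a0 a1] <-.
    by exists (1 + a * (-1)) => //; rewrite /= in_itv /=; lra.
  exists (1 + a * (-1)); first by rewrite /= in_itv /=; lra.
  by rewrite /=; congr f; lra.
Qed.

Lemma arc_compact A x y : simple_arc A x y -> compact A.
Proof.
move=> [f [cf _ _ _ <-]]; apply: continuous_compact (@segment_compact _ _ _).
exact: continuous_subspaceT.
Qed.

Lemma arc_closed A x y : simple_arc A x y -> closed A.
Proof.
by move=> /arc_compact cA; apply: compact_closed cA; exact: norm_hausdorff.
Qed.

(* Clamping both parametrizations turns the concatenation into a sum, which is
   continuous without any gluing. *)
Lemma arc_cat A B x y z : simple_arc A x y -> simple_arc B y z ->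
  (forall w, A w -> B w -> w = y) -> simple_arc (A `|` B) x z.
Proof.
move=> [f [cf injf f0 f1 fA]] [g [cg injg g0 g1 gB]] AB.
pose h t := f (clamp (0 + t * 2)) + g (clamp (-1 + t * 2)) - y.
have hf t : 0 <= t -> t <= 1/2 -> h t = f (t * 2).
  move=> t0 t1; rewrite /h add0r (clamp_id (t := t * 2)); last by lra.
  by rewrite clamp_le0 ?g0 ?addrK //; lra.
have hg t : 1/2 <= t -> t <= 1 -> h t = g (-1 + t * 2).
  move=> t0 t1; rewrite /h add0r (clamp_ge1 (t := t * 2)); last by lra.
  by rewrite f1 clamp_id ?(addrC y) ?addrK //; lra.
have fhit t : 0 <= t <= 1 -> A (f t) by rewrite -fA; exists t.
have ghit t : 0 <= t <= 1 -> B (g t) by rewrite -gB; exists t.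
exists h; split.
- have cc a : continuous (fun t : R => clamp (a + t * 2)).
    move=> t; apply: (continuous_comp (f := fun t => a + t * 2)).
      exact: affine_continuous.
    exact: clamp_continuous.
  move=> t; rewrite /h; apply: cvgB; last exact: cvg_cst.
  by apply: cvgD; [apply: (comp_continuous (cc _) cf) | apply: (comp_continuous (cc _) cg)].
- have mixed a b : 0 <= a -> a <= 1/2 -> 1/2 <= b -> b <= 1 ->
      h a = h b -> a = b.
    move=> a0 a1 b0 b1; rewrite hf // hg // => E.
    have Ey : f (a * 2) = y.
      by apply: AB; [apply: fhit; lra | rewrite E; apply: ghit; lra].
    have /injf : f (a * 2) = f 1 by rewrite Ey.
    rewrite !in_itv /= => /(_ ltac:(lra) ltac:(lra)) a2.
    have /injg : g (-1 + b * 2) = g 0 by rewrite -E Ey.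
    rewrite !in_itv /= => /(_ ltac:(lra) ltac:(lra)) b2.
    lra.
  move=> a b; rewrite !in_itv /= => /andP[a0 a1] /andP[b0 b1].
  case: (leP a (1/2)) => ha; case: (leP b (1/2)) => hb.
  + rewrite !hf // => /injf; rewrite !in_itv /=.
    by move=> /(_ ltac:(lra) ltac:(lra)); lra.
  + by apply: mixed => //; lra.
  + by move=> E; apply/esym; apply: mixed => //; lra.
  + rewrite !hg //; try exact: ltW.
    move=> /injg; rewrite !in_itv /=.
    by move=> /(_ ltac:(lra) ltac:(lra)); lra.
- by rewrite hf ?mul0r //; lra.
- by rewrite hg; [rewrite -g1; congr g; lra | lra | lra].
- apply/seteqP; split => w.
    move=> [t /=]; rewrite in_itv /= => /andP[t0 t1] <-.
    case: (leP t (1/2)) => ht; [left; rewrite hf //|right; rewrite hg ?(ltW ht) //].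
      by apply: fhit; lra.
    by apply: ghit; lra.
  rewrite -fA -gB => -[[t]|[t]] /=; rewrite in_itv /= => /andP[t0 t1] <-.
    exists (t / 2); first by rewrite /= in_itv /=; lra.
    by rewrite hf; [congr f; lra|lra|lra].
  exists ((t + 1) / 2); first by rewrite /= in_itv /=; lra.
  by rewrite hg; [congr g; lra|lra|lra].
Qed.

Lemma first_hit f K (b : R) : continuous f -> closed K -> 0 <= b -> K (f b) ->
  exists s, [/\ 0 <= s, s <= b, K (f s) & forall t, 0 <= t -> t < s -> ~ K (f t)].
Proof.
move=> cf cK b0 Kb; pose S := `[0 : R, b] `&` f @^-1` K.
have Sb : S b by split => //=; rewrite in_itv /= lexx b0.
have lS : has_lbound S by exists 0 => t [+ _]; rewrite /= in_itv /= => /andP[].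
have hS : has_inf S by split => //; exists b.
have cS : closed S.
  apply: closedI; first exact: interval_closed.
  by apply: closed_comp cK => t _; exact: cf.
have Si : S (inf S).
  apply: cS => U /nbhs_ballP[e /= e0 Ue].
  have [t St tl] := inf_adherent e0 hS; exists t; split => //; apply: Ue.
  rewrite /ball /= distrC ger0_norm ?subr_ge0; first by rewrite ltrBlDl.
  exact: ge_inf.
have [+ Ki] := Si; rewrite /= in_itv /= => /andP[i0 ib].
exists (inf S); split => // t t0 ti Kt.
have : inf S <= t.
  by apply: ge_inf => //; split => //=; rewrite in_itv /= t0 (le_trans (ltW ti)).
by rewrite leNgt ti.
Qed.

Lemma arc_hit A x y K z : simple_arc A x y -> closed K -> ~ K x -> A z -> K z ->
  exists q A', [/\ simple_arc A' x q, A' `<=` A, K q & forall w, A' w -> K w -> w = q].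
Proof.
move=> [f [cf injf f0 f1 fA]] cK Kx; rewrite -{1}fA => -[b /=].
rewrite in_itv /= => /andP[b0 b1] <- Kb.
have [s [s0 sb Ks Hs]] := first_hit cf cK b0 Kb.
have {}s0 : 0 < s.
  by rewrite lt_neqAle s0 andbT; apply/eqP => s0'; apply: Kx; rewrite -f0 s0'.
exists (f s), (f @` `[0, s]); split => //.
- by rewrite -f0; apply: sub_arc => //; exact: le_trans b1.
- move=> w [t /=]; rewrite in_itv /= => /andP[t0 ts] <-; rewrite -fA.
  by exists t => //=; rewrite in_itv /= t0 (le_trans ts) // (le_trans sb).
- move=> w [t /=]; rewrite in_itv /= => /andP[t0 ts] <- Kt.
  by move: ts; rewrite le_eqVlt => /predU1P[-> //|/(Hs _ t0)/(_ Kt)].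
Qed.

Lemma arc_split A x y q : simple_arc A x y -> A q -> q != x -> q != y ->
  exists A1 A2, [/\ simple_arc A1 x q, simple_arc A2 q y, A = A1 `|` A2
    & forall w, A1 w -> A2 w -> w = q].
Proof.
move=> [f [cf injf f0 f1 fA]]; rewrite -{1}fA => -[s /=].
rewrite in_itv /= => /andP[s0 s1] <- qx qy.
have {}s0 : 0 < s.
  by rewrite lt_neqAle s0 andbT; apply: contraNneq qx => <-; rewrite f0.
have {}s1 : s < 1.
  by rewrite lt_neqAle s1 andbT; apply: contraNneq qy => ->; rewrite f1.
exists (f @` `[0, s]), (f @` `[s, 1]); split.
- by rewrite -f0; apply: sub_arc => //; exact: ltW.
- by rewrite -f1; apply: sub_arc => //; exact: ltW.
- rewrite -fA -image_setU; congr (f @` _); apply/seteqP; split => t /=;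
    rewrite !in_itv /=.
    by move=> /andP[t0 t1]; case: (leP t s) => ts; [left|right]; rewrite ?t0 ?t1 ?(ltW ts).
  by move=> [/andP[t0 ts]|/andP[ts t1]]; apply/andP; split => //; lra.
- move=> w [a /= + <-] [b /= + /injf E]; rewrite !in_itv /=.
  move=> /andP[a0 a1] /andP[b0 b1]; congr f.
  have : b = a by apply: E; rewrite in_itv /=; lra.
  lra.
Qed.

Lemma arc_point_near A x y (e : R) : simple_arc A x y -> 0 < e ->
  exists q, [/\ A q, q != x, q != y & `|q - x| < e].
Proof.
move=> arcA e0; have xy := arc_neq arcA.
have [f [cf injf f0 f1 fA]] := arcA.
have /cvgrPdist_lt/(_ e e0)/nbhs_ballP[d /= d0 Hd] := cf 0.
pose s := Num.min (d / 2) (1 / 2).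
have s0 : 0 < s by rewrite lt_min; apply/andP; split; lra.
have s1 : s <= 1/2 by rewrite ge_min lexx orbT.
have sd : s < d.
  by apply: (@le_lt_trans _ _ (d/2)); [rewrite ge_min lexx|lra].
exists (f s); split.
- by rewrite -fA; exists s => //=; rewrite in_itv /=; lra.
- rewrite -f0; apply/eqP => /injf; rewrite !in_itv /= => /(_ ltac:(lra) ltac:(lra)).
  lra.
- rewrite -f1; apply/eqP => /injf; rewrite !in_itv /= => /(_ ltac:(lra) ltac:(lra)).
  lra.
- rewrite distrC -f0; apply: Hd; rewrite /ball /= sub0r normrN gtr0_norm //.
Qed.

End Arcs.

Section Segments.
Variables (R : realType) (V : normedModType R).
Implicit Types (A B K F : set V) (x y z q w c : V) (r s t : R).

Definition seg x y : set V := (fun t => x + t *: (y - x)) @` `[0 : R, 1].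

Definition cball c r : set V := [set x | `|x - c| <= r].

Lemma lerp x y t : x + t *: (y - x) = (1 - t) *: x + t *: y.
Proof. by rewrite scalerBr scalerBl scale1r addrAC addrA. Qed.

Lemma lerpB x y c t :
  x + t *: (y - x) - c = (1 - t) *: (x - c) + t *: (y - c).
Proof. by rewrite -lerp opprB addrA subrK addrAC. Qed.

Lemma segP x y z :
  seg x y z <-> exists t : R, [/\ 0 <= t, t <= 1 & z = x + t *: (y - x)].
Proof.
split=> [[t /=]|[t [t0 t1 ->]]]; first by rewrite in_itv /= => /andP[? ?] <-; exists t.
by exists t => //=; rewrite in_itv /= t0.
Qed.

Lemma seg_sym x y : (seg x y = seg y x)%classic.
Proof.
suff sub a b : seg a b `<=` seg b a by apply/seteqP; split; exact: sub.
move=> z /segP[t [t0 t1 ->]]; apply/segP; exists (1 - t); split; [lra|lra|].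
by rewrite !lerp opprB addrCA subrr addr0 addrC.
Qed.

Lemma arc_seg x y : x != y -> simple_arc (seg x y) x y.
Proof.
move=> xy; exists (fun t => x + t *: (y - x)); split => //.
- move=> t; apply: cvgD; first exact: cvg_cst.
  by apply: cvgZr_tmp; exact: cvg_id.
- move=> a b _ _ /addrI /eqP.
  by rewrite -subr_eq0 -scalerBl scaler_eq0 !subr_eq0 eq_sym [y == x]eq_sym (negPf xy) orbF => /eqP.
- by rewrite scale0r addr0.
- by rewrite scale1r addrC subrK.
Qed.

Lemma cball_closed c r : closed (cball c r).
Proof.
rewrite (_ : cball c r = (fun x => `|x - c|) @^-1` `]-oo, r]).
  apply: closed_comp; last exact: interval_closed.
  by move=> x _; apply: cvg_norm; apply: cvgB; [exact: cvg_id|exact: cvg_cst].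
by apply/seteqP; split => x /=; rewrite in_itv.
Qed.

Lemma seg_cball c r x y : cball c r x -> cball c r y -> seg x y `<=` cball c r.
Proof.
move=> cx cy z /segP[t [t0 t1 ->]]; rewrite /cball /=.
rewrite lerpB; apply: le_trans (ler_normD _ _) _; rewrite !normrZ !ger0_norm ?subr_ge0 //.
move: cx cy; rewrite /cball /= => cx cy.
nra.
Qed.

Lemma seg_ball c r q z w : cball c r q -> `|z - c| < r -> seg q z w -> w != q ->
  `|w - c| < r.
Proof.
move=> cq cz /segP[t [t0 t1 ->]] wq.
have {}t0 : 0 < t.
  rewrite lt_neqAle t0 andbT; apply: contraNneq wq => <-.
  by rewrite scale0r addr0.
rewrite lerpB; apply: le_lt_trans (ler_normD _ _) _; rewrite !normrZ [`|t|]gtr0_norm // ger0_norm ?subr_ge0 //.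
move: cq; rewrite /cball /= => cq; nra.
Qed.

(* Distinct points of a sphere lie on distinct rays from any interior point, whatever
   the norm. *)
Lemma cone_disjoint c r q1 q2 z w : `|q1 - c| = r -> `|q2 - c| = r ->
  `|z - c| < r -> q1 != q2 -> seg z q1 w -> seg z q2 w -> w = z.
Proof.
wlog suff : q1 q2 / forall a b, `|q1 - c| = r -> `|q2 - c| = r ->
    `|z - c| < r -> q1 != q2 -> 0 <= a -> a <= b -> b <= 1 ->
    w = z + a *: (q1 - z) -> w = z + b *: (q2 - z) -> w = z.
  move=> H n1 n2 nz q12 /segP[a [a0 a1 wa]] /segP[b [b0 b1 wb]].
  have [ab|ba] := leP a b; first exact: (H q1 q2 a b).
  by apply: (H q2 q1 b a) => //; rewrite 1?eq_sym ?ltW.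
move=> a b n1 n2 nz q12 a0 ab b1 wa wb.
have [b0|b0] := eqVneq b 0; first by rewrite wb b0 scale0r addr0.
have {}b0 : 0 < b by rewrite lt_neqAle eq_sym b0 (le_trans a0 ab).
have q2E : q2 = z + (a / b) *: (q1 - z).
  have : b *: (q2 - z) = a *: (q1 - z) by apply: (addrI z); rewrite -wa -wb.
  move=> /(congr1 (fun u => b^-1 *: u)); rewrite !scalerA mulVf ?gt_eqF // scale1r.
  by rewrite mulrC => <-; rewrite addrC subrK.
have q2s : seg q1 z q2.
  rewrite seg_sym; apply/segP; exists (a / b); split => //.
    by rewrite divr_ge0 // ltW.
  by rewrite ler_pdivrMr // mul1r.
have := seg_ball (_ : cball c r q1) nz q2s; rewrite /cball /= n1 lexx n2 ltxx eq_sym q12.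
by move=> /(_ isT isT).
Qed.

Lemma off_closed F z : closed F -> ~ F z ->
  exists2 r, 0 < r & forall x, `|x - z| <= r -> ~ F x.
Proof.
move=> cF Fz; have : nbhs z (~` F) by apply: open_nbhs_nbhs; split => //; exact: closed_openC.
move=> /nbhs_ballP[e /= e0 He]; exists (e / 2); first by rewrite divr_gt0.
by move=> x xz; apply: He; rewrite -ball_normE /= distrC (le_lt_trans xz) //; lra.
Qed.

End Segments.

Lemma itv_locally_constant (R : realType) (P : R -> Prop) :
  (forall t, 0 < t < 1 -> exists2 e, 0 < e & forall t1 t2, 0 < t1 < 1 ->
     0 < t2 < 1 -> `|t1 - t| < e -> `|t2 - t| < e -> P t1 -> P t2) ->
  forall a b, 0 < a < 1 -> 0 < b < 1 -> P a -> P b.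
Proof.
move=> lc.
have Pop (Q : R -> Prop) : (forall t, 0 < t < 1 -> exists2 e, 0 < e & forall t1 t2, 0 < t1 < 1 ->
     0 < t2 < 1 -> `|t1 - t| < e -> `|t2 - t| < e -> Q t1 -> Q t2) ->
     open [set t | 0 < t < 1 /\ Q t].
  move=> lQ; rewrite openE => t /= [t01 Qt]; have [e e0 He] := lQ t t01.
  have h1 : \forall s \near t, 0 < s < 1.
    have : open (`]0 : R, 1[%classic) by exact: interval_open.
    rewrite openE => /(_ t); rewrite /= in_itv /= => /(_ t01).
    by apply: filterS => s /=; rewrite in_itv.
  have h2 : \forall s \near t, `|s - t| < e.
    by apply: filterS (nbhsx_ballx t e e0) => s; rewrite /ball /= distrC.
  by near=> s; split; [near: s|apply: (He t); rewrite ?subrr ?normr0 //; near: s].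
have : connected `]0 : R, 1[%classic by apply/connected_intervalP; exact: interval_is_interval.
move=> con a b a01 b01 Pa.
suff E : [set t | 0 < t < 1 /\ P t] = `]0 : R, 1[%classic.
  have : `]0 : R, 1[%classic b by rewrite /= in_itv.
  by rewrite -E => -[].
apply: con; first by exists a.
- exists [set t | 0 < t < 1 /\ P t]; first exact: Pop.
  by apply/seteqP; split => t /=; rewrite in_itv /=; tauto.
- exists (~` [set t | 0 < t < 1 /\ ~ P t]).
    apply: open_closedC; apply: Pop => t /lc[e e0 He]; exists e => // t1 t2 ? ? ? ? nP Pt.
    by apply: nP; apply: He Pt.
  apply/seteqP; split => t /=; rewrite in_itv /=; first by tauto.
  by move=> [t01 H]; split => //; apply: contrapT => nP; apply: H.
Unshelve. all: by end_near.
Qed.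

Section Doubling.
Variable (R : realType).
Implicit Types (A F : set (R * R)) (u v x z w : R * R).

Lemma arc_hit_sphere A x c (r : R) z :
  simple_arc A x z -> ~ cball c r x -> cball c r z ->
  exists q A', [/\ simple_arc A' x q, A' `<=` A, `|q - c| = r
    & forall w, A' w -> cball c r w -> w = q].
Proof.
move=> arcA Kx Kz.
have [q [A' [arcA' sA Kq HA']]] := arc_hit arcA (@cball_closed _ _ c r) Kx (arc_end arcA) Kz.
exists q, A'; split => //; apply/eqP; rewrite eq_le Kq /= leNgt; apply/negP => qr.
have e0 : 0 < r - `|q - c| by rewrite subr_gt0.
have [w [Aw wq _ wn]] := arc_point_near (arc_sym arcA') e0.
move/eqP: wq; apply; apply: HA' => //; rewrite /cball /=.
rewrite -[w - c](subrK (q - c)) (le_trans (ler_normD _ _)) //.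
by rewrite (_ : w - c - (q - c) = w - q) ?opprB ?addrA ?subrK //; lra.
Qed.

Lemma off_line u z (e : R) : u != z -> 0 < e -> exists b,
  [/\ b != u, b != z, `|b - z| < e & [/\ forall w, seg u b w -> seg u z w -> w = u,
    forall w, seg b z w -> seg u z w -> w = z
    & forall w, seg u b w -> seg b z w -> w = b]].
Proof.
move=> uz e0; pose d := z - u; pose p : R * R := (- d.2, d.1).
pose k := e / (2 * (`|p| + 1)).
have p0 : 0 <= `|p| by [].
have k0 : 0 < k by rewrite /k divr_gt0 //; lra.
have zE : z = u + d by rewrite /d addrC subrK.
have D0 : 0 < d.1 * d.1 + d.2 * d.2.
  have: d != 0 by rewrite subr_eq0 eq_sym.
  case: (d) => d1 d2 /= dn; rewrite lt_neqAle eq_sym; apply/andP; split; last by nra.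
  apply: contra_neq dn => E; have ->: d1 = 0 by nra.
  by have ->: d2 = 0 by nra.
have kp : `|k *: p| < e.
  by rewrite normrZ gtr0_norm // /k mulrAC ltr_pdivrMr; nra.
have ext w1 w2 : w1.1 = w2.1 -> w1.2 = w2.2 -> w1 = w2 :> R * R.
  by case: w1 w2 => [? ?] [? ?] /= -> ->.
exists (z + k *: p); move: k k0 kp => k k0 kp.
have bz : `|z + k *: p - z| < e by rewrite [z + _]addrC addrK.
move: bz D0; rewrite zE /p; case: d {zE p kp p0} => d1 d2 /=; case: u {uz} => u1 u2 bz D0.
have kz a : k * a = 0 -> a = 0.
  by move=> /eqP; rewrite mulf_eq0 gt_eqF //= => /eqP.
have dz a : a * (d1 * d1 + d2 * d2) = 0 -> a = 0.
  by move=> /eqP; rewrite mulf_eq0 (gt_eqF D0) orbF => /eqP.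
split.
- apply/eqP => /= -[]; rewrite /GRing.scale /= => E1 E2; nra.
- apply/eqP => /= -[]; rewrite /GRing.scale /= => E1 E2.
  have d10 : d1 = 0 by apply: kz; lra.
  have d20 : d2 = 0 by apply: kz; lra.
  by move: D0; rewrite d10 d20 mulr0 addr0 ltxx.
- exact: bz.
split => w /segP[t [t0 t1 ->]] /segP[s [s0 s1]] /= -[]; rewrite /GRing.scale /= => E1 E2.
- have E1' := congr1 (fun a => d2 * a) E1; have E2' := congr1 (fun a => d1 * a) E2.
  have -> : t = 0 by apply: dz; apply: kz; lra.
  by apply: ext => /=; rewrite /GRing.scale /=; lra.
- have E1' := congr1 (fun a => d2 * a) E1; have E2' := congr1 (fun a => d1 * a) E2.
  have : 1 - t = 0 by apply: dz; apply: kz; lra.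
  move=> /eqP; rewrite subr_eq0 => /eqP <-.
  by apply: ext => /=; rewrite /GRing.scale /=; lra.
- have E1' := congr1 (fun a => d1 * a) E1; have E2' := congr1 (fun a => d2 * a) E2.
  have : 1 - t = 0 by apply: dz; lra.
  move=> /eqP; rewrite subr_eq0 => /eqP <-.
  by apply: ext => /=; rewrite /GRing.scale /=; lra.
Qed.

Definition radial F u (r : R) := forall x s, F x -> `|x - u| <= r ->
  0 <= s -> s * `|x - u| <= r -> F (u + s *: (x - u)).

Definition lens F u z := exists A1 A2, [/\ simple_arc A1 u z, simple_arc A2 u z,
  forall w, A1 w -> A2 w -> w = u \/ w = z,
  forall w, A1 w -> F w -> w = u & forall w, A2 w -> F w -> w = u].

Lemma radial_seg F u (r : R) x w : radial F u r -> cball u r x -> ~ F x ->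
  seg u x w -> F w -> w = u.
Proof.
move=> rF xr Fx /segP[t [t0 t1 ->]] Fw.
have [t00|tn0] := eqVneq t 0; first by rewrite t00 scale0r addr0.
have E : u + t *: (x - u) - u = t *: (x - u) by rewrite addrAC subrr add0r.
case: Fx; have := rF _ t^-1 Fw; rewrite !E scalerA mulVf // scale1r.
rewrite [u + (x - u)]addrC subrK normrZ ger0_norm // mulrA mulVf // mul1r; apply => //.
  by apply: le_trans xr; rewrite ler_piMl.
by rewrite invr_ge0.
Qed.

Lemma lens_start F u z (r : R) : closed F -> radial F u r -> ~ F z ->
  `|z - u| < r -> z != u -> lens F u z.
Proof.
move=> cF rF Fz zr zu; have [e e0 He] := off_closed cF Fz.
have d0 : 0 < Num.min e (r - `|z - u|) by rewrite lt_min e0 subr_gt0.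
have uz : u != z by rewrite eq_sym.
have [b [bu bz]] := off_line uz d0; rewrite lt_min => /andP[be br] [Hu Hz Hb].
have bur : cball u r b.
  rewrite /cball /= -(subrK z b) -addrA (le_trans (ler_normD _ _)) //; lra.
have Fb : ~ F b by apply: He; exact: ltW.
exists (seg u z), (seg u b `|` seg b z); split.
- exact: arc_seg.
- by apply: arc_cat (arc_seg _) (arc_seg _) Hb => //; rewrite eq_sym.
- by move=> w uzw [ubw|bzw]; [left; apply: Hu|right; apply: Hz].
- by move=> w; apply: radial_seg rF _ Fz; exact: ltW.
- move=> w [|bzw Fw]; first exact: radial_seg rF bur Fb.
  case: (He w) => //; apply: (seg_cball (c := z)) bzw; first exact: ltW.
  by rewrite /cball /= subrr normr0 ltW.
Qed.

Lemma lens_hit F u z c (r : R) : lens F u z -> ~ cball c r u -> `|z - c| < r ->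
  exists q1 q2 A1 A2, [/\ simple_arc A1 u q1 /\ simple_arc A2 u q2,
    [/\ q1 != q2, `|q1 - c| = r & `|q2 - c| = r],
    (forall w, A1 w -> A2 w -> w = u),
    (forall w, A1 w -> cball c r w -> w = q1) /\ (forall w, A2 w -> cball c r w -> w = q2)
    & (forall w, A1 w -> F w -> w = u) /\ (forall w, A2 w -> F w -> w = u)].
Proof.
move=> [A1 [A2 [arc1 arc2 A12 AF1 AF2]]] cu cz.
have [q1 [B1 [arcB1 s1 n1 H1]]] := arc_hit_sphere arc1 cu (ltW cz).
have [q2 [B2 [arcB2 s2 n2 H2]]] := arc_hit_sphere arc2 cu (ltW cz).
have znq w : B1 w -> B2 w -> w = u.
  move=> B1w B2w; have [//|wz] := A12 _ (s1 _ B1w) (s2 _ B2w).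
  have : w = q1 by apply: H1 => //; rewrite wz; exact: ltW.
  by move=> wq; move: cz n1; rewrite -wz wq => + n1; rewrite n1 ltxx.
exists q1, q2, B1, B2; split => //; split.
- apply/eqP => q12; have := znq q1 (arc_end arcB1); rewrite q12 => /(_ (arc_end arcB2)) q2u.
  by apply: cu; rewrite /cball /= -q2u n2.
- exact: n1.
- exact: n2.
- by move=> w /s1; exact: AF1.
- by move=> w /s2; exact: AF2.
Qed.

Lemma lens_move F u y0 (r : R) z z' : F u -> (forall x, `|x - y0| <= r -> ~ F x) ->
  `|z - y0| < r -> `|z' - y0| < r -> lens F u z -> lens F u z'.
Proof.
move=> Fu off zr z'r L; have cu : ~ cball y0 r u by move=> /off.
have [q1 [q2 [A1 [A2 [[arc1 arc2] [q12 n1 n2] A12 [H1 H2] [F1 F2]]]]]] := lens_hit L cu zr.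
have c1 : cball y0 r q1 by rewrite /cball /= n1.
have c2 : cball y0 r q2 by rewrite /cball /= n2.
have qz q : `|q - y0| = r -> q != z' by move=> nq; apply: contraTneq z'r => <-; rewrite nq ltxx.
have segc q w : cball y0 r q -> seg q z' w -> cball y0 r w by move=> cq; apply: seg_cball => //; exact: ltW.
have noseg q w : cball y0 r q -> `|w - y0| = r -> seg q z' w -> w = q.
  move=> cq nw sw; apply/eqP; apply: contraT => wq.
  by have := seg_ball cq z'r sw wq; rewrite nw ltxx.
exists (A1 `|` seg q1 z'), (A2 `|` seg q2 z'); split.
- apply: arc_cat arc1 (arc_seg (qz _ n1)) _ => w A1w sw.
  by apply: H1 => //; apply: segc sw.
- apply: arc_cat arc2 (arc_seg (qz _ n2)) _ => w A2w sw.
  by apply: H2 => //; apply: segc sw.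
- move=> w [A1w|s1w] [A2w|s2w]; [by left; exact: A12| | |].
  + have wq : w = q1 by apply: H1 => //; apply: segc s2w.
    by case/eqP: q12; rewrite -wq; apply: noseg s2w => //; rewrite wq.
  + have wq : w = q2 by apply: H2 => //; apply: segc s1w.
    by case/eqP: q12; apply/esym; rewrite -wq; apply: noseg s1w => //; rewrite wq.
  + by right; apply: cone_disjoint n1 n2 z'r q12 _ _; rewrite seg_sym.
- by move=> w [|s1w Fw]; [exact: F1|case: (off w) => //; apply: segc s1w].
- by move=> w [|s2w Fw]; [exact: F2|case: (off w) => //; apply: segc s2w].
Qed.

Theorem double_arc F u v (ru rv : R) A : closed F -> F u -> F v ->
  0 < ru -> 0 < rv -> radial F u ru -> radial F v rv -> ~ cball v rv u ->
  simple_arc A u v -> (forall w, A w -> F w -> w = u \/ w = v) ->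
  exists A1 A2, [/\ simple_arc A1 u v, simple_arc A2 u v,
    forall w, A1 w -> A2 w -> w = u \/ w = v,
    forall w, A1 w -> F w -> w = u \/ w = v
    & forall w, A2 w -> F w -> w = u \/ w = v].
Proof.
move=> cF Fu Fv ru0 rv0 rFu rFv uv arcA AF.
have [f [cf injf f0 f1 fA]] := arcA.
have offF t : 0 < t < 1 -> ~ F (f t).
  move=> t01 Ff; have Af : A (f t) by rewrite -fA; exists t => //=; rewrite in_itv /=; lra.
  by have [] := AF _ Af Ff; rewrite -?f0 -?f1 => /injf;
    rewrite !in_itv /= => /(_ ltac:(lra) ltac:(lra)); lra.
have near_end w : A w -> w != u -> w != v -> exists2 t, 0 < t < 1 & f t = w.
  rewrite -{1}fA => -[t /=]; rewrite in_itv /= => /andP[t0 t1] <- wu wv; exists t => //.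
  rewrite !lt_neqAle t0 t1 !andbT; apply/andP; split.
    by apply: contraNneq wu => <-; rewrite f0.
  by apply: contraNneq wv => ->; rewrite f1.
have [z0 [Az0 z0u z0v z0r]] := arc_point_near arcA ru0.
have [z1 [Az1 z1v z1u z1r]] := arc_point_near (arc_sym arcA) rv0.
have [a a01 fa] := near_end _ Az0 z0u z0v.
have [b b01 fb] := near_end _ Az1 z1u z1v.
have Lz1 : lens F u z1.
  rewrite -fb; move: a b a01 b01 fa {fb} => a b a01 b01 fa.
  apply: (@itv_locally_constant _ (fun t => lens F u (f t)) _ a b a01 b01) => [t t01|]; last first.
    rewrite fa; apply: lens_start cF rFu _ z0r z0u; rewrite -fa; exact: offF.
  have [r r0 Hr] := off_closed cF (offF _ t01).
  have /cvgrPdist_lt/(_ r r0)/nbhs_ballP[e /= e0 He] := cf t.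
  exists e => // t1 t2 _ _ t1e t2e.
  by apply: lens_move Fu Hr _ _; rewrite distrC; apply: He; rewrite /ball /= distrC.
have [q1 [q2 [A1 [A2 [[arc1 arc2] [q12 n1 n2] A12 [H1 H2] [F1 F2]]]]]] := lens_hit Lz1 uv z1r.
have c1 : cball v rv q1 by rewrite /cball /= n1.
have c2 : cball v rv q2 by rewrite /cball /= n2.
have vv : `|v - v| < rv by rewrite subrr normr0.
have qv q : `|q - v| = rv -> q != v.
  by move=> nq; apply/eqP => qE; move: rv0; rewrite -nq qE subrr normr0 ltxx.
have segc q w : cball v rv q -> seg q v w -> cball v rv w by move=> cq; apply: seg_cball => //; exact: ltW.
have noseg q w : cball v rv q -> `|w - v| = rv -> seg q v w -> w = q.
  move=> cq nw sw; apply/eqP; apply: contraT => wq.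
  by have := seg_ball cq vv sw wq; rewrite nw ltxx.
have Fq1 : ~ F q1 by move=> /(F1 _ (arc_end arc1)) qu; apply: uv; rewrite -qu.
have Fq2 : ~ F q2 by move=> /(F2 _ (arc_end arc2)) qu; apply: uv; rewrite -qu.
exists (A1 `|` seg q1 v), (A2 `|` seg q2 v); split.
- apply: arc_cat arc1 (arc_seg (qv _ n1)) _ => w A1w sw.
  by apply: H1 => //; apply: segc sw.
- apply: arc_cat arc2 (arc_seg (qv _ n2)) _ => w A2w sw.
  by apply: H2 => //; apply: segc sw.
- move=> w [A1w|s1w] [A2w|s2w]; [by left; exact: A12| | |].
  + have wq : w = q1 by apply: H1 => //; apply: segc s2w.
    by case/eqP: q12; rewrite -wq; apply: noseg s2w => //; rewrite wq.
  + have wq : w = q2 by apply: H2 => //; apply: segc s1w.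
    by case/eqP: q12; apply/esym; rewrite -wq; apply: noseg s1w => //; rewrite wq.
  + by right; apply: cone_disjoint n1 n2 vv q12 _ _; rewrite seg_sym.
- move=> w [A1w Fw|s1w Fw]; first by left; exact: F1.
  by right; apply: radial_seg rFv c1 Fq1 _ Fw; rewrite seg_sym.
- move=> w [A1w Fw|s1w Fw]; first by left; exact: F2.
  by right; apply: radial_seg rFv c2 Fq2 _ Fw; rewrite seg_sym.
Qed.

End Doubling.

(** * Drawings of planar graphs *)

Section Drawings.
Variables (R : realType) (V : finType).
Implicit Types (G : {set {set V}}) (e f g : {set V}) (u v w y : V).
Implicit Types (p : V -> R * R) (A : {set V} -> set (R * R)) (x z : R * R).

Definition arc_drawing G p A :=
  [/\ injective p,
      forall e, e \in G -> exists u v,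
        [/\ e = [set u; v]%SET, u != v & simple_arc (A e) (p u) (p v)],
      forall e w, e \in G -> A e (p w) -> w \in e
    & forall e f x, e \in G -> f \in G -> e != f -> A e x -> A f x ->
        exists w, [/\ w \in e, w \in f & x = p w]].

Lemma planarP G : planar R G <-> exists p A, arc_drawing G p A.
Proof.
split=> [[p [a [injp ae av ef]]]|[p [A [injp Ae Av Aef]]]].
  have ends e : e \in G -> exists u v, [/\ e = [set u; v]%SET, u != v, a e 0 = p u & a e 1 = p v].
    move=> eG; have [_ inja Ea] := ae e eG.
    have [u eu pu] : [set p v | v in [set` e]] (a e 0) by rewrite -Ea; left.
    have [v ev pv] : [set p v | v in [set` e]] (a e 1) by rewrite -Ea; right.
    exists u, v; split => //.
      apply/setP => w; rewrite in_set2; apply/idP/orP => [we|[/eqP ->|/eqP ->]] //.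
      have : [set a e 0; a e 1] (p w) by rewrite Ea; exists w.
      by move=> [|]; rewrite -?pu -?pv => /injp ->; [left|right].
    apply/eqP => uv; have : a e 0 = a e 1 by rewrite -pu -pv uv.
    move=> /inja; rewrite !in_itv /= !lexx ler01 => /(_ isT isT)/eqP.
    by rewrite eq_sym oner_eq0.
  have int_or e s : e \in G -> 0 <= s <= 1 -> 0 < s < 1 \/ exists2 w, w \in e & a e s = p w.
    move=> eG /andP[s0 s1]; have [u [v [eE _ a0 a1]]] := ends e eG.
    have [->|sn0] := eqVneq s 0; first by right; exists u => //; rewrite eE set21.
    have [->|sn1] := eqVneq s 1; first by right; exists v => //; rewrite eE set22.
    by left; rewrite !lt_neqAle s0 s1 [0 == s]eq_sym sn0 sn1.
  exists p, (fun e => a e @` `[0 : R, 1]); split => //.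
  - move=> e eG; have [ca inja _] := ae e eG; have [u [v [eE uv a0 a1]]] := ends e eG.
    exists u, v; split => //; exists (a e \o @clamp R); split => //.
    + exact: within_clamp.
    + by move=> s t; rewrite !in_itv /= => s1 t1; rewrite !clamp_id // => /inja; apply; rewrite in_itv.
    + by rewrite /= clamp_id ?lexx ?ler01.
    + by rewrite /= clamp_id ?lexx ?ler01.
    + by apply/seteqP; split => x [t /=]; rewrite in_itv /= => t1 <-; exists t;
        rewrite /= ?in_itv /= ?clamp_id.
  - move=> e w eG [s /=]; rewrite in_itv /= => s01 asw.
    have [s1|[y ye ay]] := int_or e s eG s01; first by have := av e w s eG s1.
    have /injp -> : p w = p y by rewrite -asw.
    by [].
  - move=> e f x eG fG nef [s /=]; rewrite in_itv /= => s01 asx [t /=].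
    rewrite in_itv /= => t01 atx.
    have [s1|[y ye ay]] := int_or e s eG s01; have [t1|[y' ye' ay']] := int_or f t fG t01.
    + by have := ef e f s t eG fG nef s1 t1; rewrite asx atx.
    + by have := av e y' s eG s1; rewrite asx -ay' atx.
    + by have := av f y t fG t1; rewrite atx -ay asx.
    + exists y; split => //; last by rewrite -ay.
      by have -> : y = y' by apply: injp; rewrite -ay -ay' asx atx.
have /choice[F HF] : forall e, exists h : R -> R * R, e \in G -> exists u v,
   [/\ e = [set u; v]%SET, h 0 = p u & h 1 = p v] /\
   [/\ continuous h, {in `[0 : R, 1] &, injective h} & h @` `[0 : R, 1] = A e].
  move=> e; case: (boolP (e \in G)) => [eG|_]; last by exists (fun=> 0).
  have [u [v [eE uv [h [ch injh h0 h1 hA]]]]] := Ae e eG.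
  by exists h => _; exists u, v.
exists p, F; split => //.
- move=> e eG; have [u [v [[eE h0 h1] [ch injh hA]]]] := HF e eG; split => //.
    exact: continuous_subspaceT.
  rewrite h0 h1 eE; apply/seteqP; split => x /=.
    by move=> [->|->]; [exists u|exists v]; rewrite //= in_set2 eqxx ?orbT.
  by move=> [w]; rewrite in_set2 => /orP[/eqP ->|/eqP ->] <-; [left|right].
- move=> e w s eG /andP[s0 s1] Esw; have [u [v [[eE h0 h1] [ch injh hA]]]] := HF e eG.
  have : w \in e by apply: Av => //; rewrite -hA -Esw; exists s => //=; rewrite in_itv /=; lra.
  rewrite eE in_set2 => /orP[] /eqP wE; move: Esw; rewrite wE -?h0 -?h1 => /injh;
    rewrite !in_itv /= => /(_ ltac:(lra) ltac:(lra)); lra.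
- move=> e f s t eG fG nef /andP[s0 s1] /andP[t0 t1] Est.
  have [u [v [[eE h0 h1] [ch injh hA]]]] := HF e eG.
  have [_ [_ [_ [_ _ hAf]]]] := HF f fG.
  have [w [we wf wE]] : exists w, [/\ w \in e, w \in f & F e s = p w].
    apply: Aef nef _ _ => //; first by rewrite -hA; exists s => //=; rewrite in_itv /=; lra.
    by rewrite Est -hAf; exists t => //=; rewrite in_itv /=; lra.
  move: we; rewrite eE in_set2 => /orP[] /eqP wE'; move: wE; rewrite wE' -?h0 -?h1 => /injh;
    rewrite !in_itv /= => /(_ ltac:(lra) ltac:(lra)); lra.
Qed.

Lemma drawing_arc G p A u v : arc_drawing G p A -> [set u; v]%SET \in G ->
  u != v /\ simple_arc (A [set u; v]%SET) (p u) (p v).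
Proof.
move=> [_ Ae _ _] /Ae[a [b [E ab arcab]]].
have ua : u \in [set a; b]%SET by rewrite -E set21.
have va : v \in [set a; b]%SET by rewrite -E set22.
have bu : b \in [set u; v]%SET by rewrite E set22.
have au : a \in [set u; v]%SET by rewrite E set21.
move: ua va bu au; rewrite !in_set2.
move=> /orP[]/eqP ? /orP[]/eqP ? ; subst.
- by rewrite !orbb => /eqP bE; rewrite bE eqxx in ab.
- by split.
- by split; [rewrite eq_sym|exact: arc_sym].
- by rewrite !orbb => _ /eqP bE; rewrite bE eqxx in ab.
Qed.

Lemma drawing_sub G G' p A : G' \subset G -> arc_drawing G p A -> arc_drawing G' p A.
Proof.
move=> /fintype.subsetP sG [injp Ae Av Aef]; split => //.
- by move=> e /sG; exact: Ae.
- by move=> e w /sG; exact: Av.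
- by move=> e f x /sG eG /sG fG; exact: Aef.
Qed.

Definition move_to p w z := fun y => if y == w then z else p y.

Lemma drawing_move G p A w z : arc_drawing G p A -> (forall e, e \in G -> w \notin e) ->
  (forall y, p y <> z) -> (forall e, e \in G -> ~ A e z) ->
  arc_drawing G (move_to p w z) A.
Proof.
move=> [injp Ae Av Aef] iso zp zA.
have pE e y : e \in G -> y \in e -> move_to p w z y = p y.
  by move=> eG ye; rewrite /move_to; case: eqP => // yw; rewrite yw (negPf (iso e eG)) in ye.
split.
- move=> y y'; rewrite /move_to; case: eqP => [->|yw]; case: eqP => [-> //|y'w]; last exact: injp.
    by move=> /esym /zp.
  by move=> /zp.
- move=> e eG; have [u [v [eE uv arcuv]]] := Ae e eG; exists u, v; split => //.
  by rewrite !(pE e) // eE ?set21 ?set22.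
- by move=> e y eG; rewrite /move_to; case: eqP => [_ /(zA _ eG)|_ /(Av _ _ eG)].
- move=> e f x eG fG ef Aex Afx; have [y [ye yf ->]] := Aef e f x eG fG ef Aex Afx.
  by exists y; split => //; rewrite (pE e).
Qed.

Lemma drawing_add G p A u v B : arc_drawing G p A -> [set u; v]%SET \notin G ->
  simple_arc B (p u) (p v) -> (forall y, B (p y) -> y = u \/ y = v) ->
  (forall g x, g \in G -> B x -> A g x -> exists y, [/\ y \in g, y = u \/ y = v & x = p y]) ->
  arc_drawing ([set u; v]%SET |: G)%SET p
    (fun g => if g == [set u; v]%SET then B else A g).
Proof.
move=> [injp Ae Av Aef] fG arcB Bv Bg; have uv : u != v.
  by have := arc_neq arcB; apply: contra_neq => ->.
have notf e : e \in G -> (e == [set u; v]%SET) = false.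
  by move=> eG; apply/negbTE; apply: contraNneq fG => <-.
split => //.
- move=> e; rewrite in_setU1 => /orP[/eqP ->|eG]; first by exists u, v; rewrite eqxx.
  by rewrite notf //; exact: Ae.
- move=> e w; rewrite in_setU1 => /orP[/eqP ->|eG]; last by rewrite notf //; exact: Av.
  by rewrite eqxx in_set2 => /Bv[] ->; rewrite eqxx ?orbT.
- move=> e f x; rewrite !in_setU1 => /orP[/eqP ->|eG] /orP[/eqP ->|gG].
  + by rewrite eqxx.
  + rewrite eqxx notf // => _ Bx Afx; have [y [yf yuv ->]] := Bg f x gG Bx Afx.
    by exists y; split => //; rewrite in_set2; case: yuv => ->; rewrite eqxx ?orbT.
  + rewrite eqxx notf // => _ Afx Bx; have [y [yf yuv ->]] := Bg e x eG Bx Afx.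
    by exists y; split => //; rewrite in_set2; case: yuv => ->; rewrite eqxx ?orbT.
  + by rewrite !notf //; exact: Aef.
Qed.

Lemma finite_radius (I : finType) (P : I -> R -> Prop) :
  (forall i, exists2 r, 0 < r & forall s, 0 < s -> s < r -> P i s) ->
  exists2 r, 0 < r & forall s, 0 < s -> s < r -> forall i, P i s.
Proof.
move=> HP; suff [r r0 Hr] : exists2 r, 0 < r &
    forall s, 0 < s -> s < r -> forall i, i \in enum I -> P i s.
  by exists r => // s s0 sr i; apply: Hr => //; rewrite mem_enum.
elim: (enum I) => [|i l [r r0 Hr]]; first by exists 1.
have [r' r'0 Hr'] := HP i; exists (Num.min r r'); first by rewrite lt_min r0.
move=> s s0; rewrite lt_min => /andP[sr sr'] j; rewrite inE => /orP[/eqP ->|jl].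
  exact: Hr'.
exact: Hr.
Qed.

Lemma drawing_bounded G p A : arc_drawing G p A ->
  exists2 M : R, 0 < M & (forall y, `|p y| <= M) /\
    (forall e x, e \in G -> A e x -> `|x| <= M).
Proof.
move=> [_ Ae _ _].
have [r r0 Hr] : exists2 r : R, 0 < r & forall s, 0 < s -> s < r -> forall y, `|p y| * s <= 1.
  apply: finite_radius => y; exists (`|p y| + 1)^-1; first by rewrite invr_gt0 ltr_wpDl.
  move=> s s0 sr; have : s * (`|p y| + 1) < 1.
    by rewrite -ltr_pdivlMr ?div1r // ltr_wpDl.
  by have := normr_ge0 (p y); nra.
have [r' r'0 Hr'] : exists2 r : R, 0 < r & forall s, 0 < s -> s < r ->
    forall e, e \in G -> forall x, A e x -> `|x| * s <= 1.
  apply: finite_radius => e; case: (boolP (e \in G)) => [eG|_]; last by exists 1.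
  have [u [v [_ _ /arc_compact/compact_bounded[M [_ HM]]]]] := Ae e eG.
  pose N := `|M| + 1; have N0 : 0 < N by rewrite ltr_wpDl.
  have {}HM x : A e x -> `|x| <= N.
    by apply: HM; rewrite (le_lt_trans (ler_norm M)) // ltrDl.
  exists N^-1; first by rewrite invr_gt0.
  move=> s s0 sN _ x /HM xN; have : s * N < 1 by rewrite -ltr_pdivlMr ?div1r.
  have := normr_ge0 x; nra.
pose s := Num.min r r' / 2.
have m0 : 0 < Num.min r r' by rewrite lt_min r0.
have s0 : 0 < s by rewrite divr_gt0.
have /andP[sr sr'] : (s < r) && (s < r') by rewrite -lt_min /s; lra.
exists s^-1; first by rewrite invr_gt0.
by split => [y|e x eG Ax]; rewrite -[s^-1]div1r ler_pdivlMr //; [exact: Hr|apply: Hr' Ax].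
Qed.

(* In a small ball around u each arc is cut where, coming from its other end, it first
   hits the ball, and continued by a radius. *)
Lemma tame_vertex G p A u : arc_drawing G p A ->
  exists2 r0 : R, 0 < r0 & forall r, 0 < r -> r < r0 -> exists A',
  [/\ arc_drawing G p A',
      forall w, w != u -> ~ cball (p u) r (p w),
      forall f, f \in G -> u \notin f -> A' f = A f /\ forall x, A f x -> ~ cball (p u) r x
    & forall f, f \in G -> u \in f -> (forall x, A' f x -> A f x \/ cball (p u) r x) /\
      exists2 b, `|b - p u| = r & forall x, cball (p u) r x -> (A' f x <-> seg (p u) b x)].
Proof.
move=> D; have [injp Ae Av Aef] := D.
have [r1 r10 H1] : exists2 r0 : R, 0 < r0 & forall r, 0 < r -> r < r0 ->
    forall w, w != u -> ~ cball (p u) r (p w).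
  apply: finite_radius => w; exists (if w == u then 1 else `|p w - p u|).
    by case: eqP => // /eqP wu; rewrite normr_gt0 subr_eq0; apply: contra_neq wu => /injp.
  by move=> s s0; case: eqP => //= _ sw _; rewrite /cball /= leNgt sw.
have [r2 r20 H2] : exists2 r0 : R, 0 < r0 & forall r, 0 < r -> r < r0 ->
    forall f, f \in G -> u \notin f -> forall x, A f x -> ~ cball (p u) r x.
  apply: finite_radius => f; case: (boolP (f \in G)) => fG; last by exists 1.
  case: (boolP (u \in f)) => uf; first by exists 1.
  have [a [b [_ _ /arc_closed cA]]] := Ae f fG.
  have [r r0 Hr] := off_closed cA (fun h => negP uf (Av f u fG h)).
  by exists r => // s s0 sr _ _ x Ax cx; apply: (Hr x) => //; apply: le_trans cx (ltW sr).
exists (Num.min r1 r2); first by rewrite lt_min r10.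
move=> r r0; rewrite lt_min => /andP[/(H1 _ r0){}H1 /(H2 _ r0){}H2].
have /choice[A' HA'] : forall f, exists T : set (R * R),
    if (f \in G) && (u \in f) then exists v q B,
      [/\ f = [set u; v]%SET, T = seg (p u) q `|` B, simple_arc T (p u) (p v), `|q - p u| = r
        & [/\ B `<=` A f, B q & forall x, B x -> cball (p u) r x -> x = q]]
    else T = A f.
  move=> f; case: (boolP ((f \in G) && (u \in f))) => [/andP[fG uf]|_]; last by exists (A f).
  have [v fE] : exists v, f = [set u; v]%SET.
    have [a [b [fE _ _]]] := Ae f fG; move: uf; rewrite fE in_set2.
    by move=> /orP[]/eqP ->; [exists b|exists a; rewrite finset.setUC].
  have [uv arcf] : u != v /\ simple_arc (A f) (p u) (p v).
    by rewrite fE; apply: drawing_arc D _; rewrite -fE.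
  have nv : ~ cball (p u) r (p v) by apply: H1; rewrite eq_sym.
  have cu : cball (p u) r (p u) by rewrite /cball /= subrr normr0 ltW.
  have [q [B [arcB sB nq HB]]] := arc_hit_sphere (arc_sym arcf) nv cu.
  exists (seg (p u) q `|` B), v, q, B; split => //.
    have uq : p u != q by apply/eqP => uq; move: r0; rewrite -nq uq subrr normr0 ltxx.
    apply: arc_cat (arc_seg uq) (arc_sym arcB) _ => w sw Bw; apply: HB => //.
    by apply: seg_cball cu _ _ sw; rewrite /cball /= nq.
  by split => //; exact: arc_end arcB.
have spec f : f \in G -> u \in f -> exists v q B,
      [/\ f = [set u; v]%SET, A' f = seg (p u) q `|` B, simple_arc (A' f) (p u) (p v), `|q - p u| = r
        & [/\ B `<=` A f, B q & forall x, B x -> cball (p u) r x -> x = q]].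
  by move=> fG uf; have := HA' f; rewrite fG uf.
have same f : f \in G -> u \notin f -> A' f = A f.
  by move=> fG uf; have := HA' f; rewrite (negPf uf) andbF.
have cu : cball (p u) r (p u) by rewrite /cball /= subrr normr0 ltW.
have segc q x : `|q - p u| = r -> seg (p u) q x -> cball (p u) r x.
  by move=> nq; apply: seg_cball => //; rewrite /cball /= nq.
have onlyu w : cball (p u) r (p w) -> w = u.
  by move=> cw; apply/eqP; apply: contraT => /H1 /(_ cw).
exists A'; split => //.
- split => //.
  + move=> f fG; case: (boolP (u \in f)) => uf; last by rewrite same //; exact: Ae.
    have [v [q [B [fE _ arcf _ _]]]] := spec f fG uf; exists u, v; split => //.
    by have := arc_neq arcf; apply: contra_neq => ->.
  + move=> f w fG; case: (boolP (u \in f)) => uf; last by rewrite same //; exact: Av.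
    have [v [q [B [fE -> _ nq [sB _ _]]]]] := spec f fG uf.
    by move=> [/(segc _ _ nq) /onlyu ->|/sB] //; exact: Av.
  + move=> e f x eG fG ef.
    case: (boolP (u \in e)) => ue; case: (boolP (u \in f)) => uf; last first.
    * by rewrite !same //; exact: Aef.
    * have [v [q [B [fE -> _ nq [sB _ _]]]]] := spec f fG uf; rewrite same // => Aex.
      by move=> [/(segc _ _ nq) /(H2 _ eG ue _ Aex)|/sB] //; exact: Aef.
    * have [v [q [B [fE -> _ nq [sB _ _]]]]] := spec e eG ue; rewrite same // => + Afx.
      by move=> [/(segc _ _ nq) /(H2 _ fG uf _ Afx)|/sB] // Aex; exact: Aef ef _ _.
    have [v [q [B [_ -> _ nq [sB Bq HB]]]]] := spec e eG ue.
    have [v' [q' [B' [_ -> _ nq' [sB' B'q' HB']]]]] := spec f fG uf.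
    have qq' : q != q'.
      apply/eqP => qq; have [w [_ _ wE]] := Aef e f q eG fG ef (sB _ Bq) ltac:(by rewrite qq; exact: sB').
      have /onlyu wu : cball (p u) r (p w) by rewrite -wE /cball /= nq.
      by move: r0; rewrite -nq wE wu subrr normr0 ltxx.
    have sph q1 q2 : `|q1 - p u| = r -> `|q2 - p u| = r -> seg (p u) q1 q2 -> q2 = q1.
      move=> n1 n2; rewrite seg_sym => s12; apply/eqP; apply: contraT => n12.
      have c1 : cball (p u) r q1 by rewrite /cball /= n1.
      have := seg_ball c1 (_ : `|p u - p u| < r) s12 n12.
      by rewrite subrr normr0 n2 ltxx => /(_ r0).
    move=> [sx|Bx] [sx'|B'x].
    * exists u; split => //.
      by apply: (cone_disjoint nq nq' _ qq' sx sx'); rewrite subrr normr0.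
    * have xq' : x = q' by apply: HB' => //; exact: segc sx.
      by case/eqP: qq'; apply/esym; apply: sph => //; rewrite -xq'.
    * have xq : x = q by apply: HB => //; exact: segc sx'.
      by case/eqP: qq'; apply: sph => //; rewrite -xq.
    * by apply: Aef ef _ _ => //; [exact: sB|exact: sB'].
- by move=> f fG uf; split; [exact: same|exact: H2].
- move=> f fG uf; have [v [q [B [fE -> _ nq [sB Bq HB]]]]] := spec f fG uf; split.
    by move=> x [/(segc _ _ nq)|/sB]; [right|left].
  exists q => // x cx; split; last by left.
  move=> [//|/HB/(_ cx) ->]; rewrite seg_sym; apply/segP; exists 0.
  by rewrite lexx ler01 scale0r addr0.
Qed.

End Drawings.

Section PlanarOperations.
Variables (R : realType) (V : finType).
Implicit Types (G : {set {set V}}) (e f g : {set V}) (u v w y : V).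

Lemma planar_sub G G' : G' \subset G -> planar R G -> planar R G'.
Proof.
by move=> sG /planarP[p [A D]]; apply/planarP; exists p, A; exact: drawing_sub D.
Qed.

Lemma planar_perm G (s : {perm V}) : planar R G ->
  planar R [set s @: e | e : {set V} in G]%SET.
Proof.
move=> [p [a [injp ae av ef]]].
have sK e : s^-1%g @: (s @: e) = e.
  by rewrite -imset_comp -[RHS]imset_id; apply: eq_imset => x /=; rewrite permK.
exists (p \o s^-1%g), (fun e => a (s^-1%g @: e)); split.
- by apply: inj_comp => //; exact: perm_inj.
- move=> _ /imsetP[e eG ->]; rewrite sK; have [? ? ->] := ae e eG; split => //.
  apply/seteqP; split => x [w /= we <-]; last first.
    by exists (s^-1%g w) => //; rewrite -(sK e); exact: imset_f.
  by exists (s w); rewrite /= ?permK ?imset_f.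
- by move=> _ v r /imsetP[e eG ->]; rewrite sK; exact: av.
- move=> _ _ r t /imsetP[e eG ->] /imsetP[f fG ->] nef; rewrite !sK; apply: ef => //.
  by apply: contra_neq nef => ->.
Qed.

Lemma far_points G (p : V -> R * R) A : arc_drawing G p A ->
  exists z1 z2 : R * R, [/\ z1 != z2,
    forall x y, seg z1 z2 x -> p y <> x
    & forall x e, e \in G -> seg z1 z2 x -> ~ A e x].
Proof.
move=> /drawing_bounded[M M0 [pM AM]].
pose z1 : R * R := (M + 1, 0); pose z2 : R * R := (M + 2, 0).
have far x : seg z1 z2 x -> M < `|x|.
  move=> /segP[t [t0 t1 ->]]; apply: lt_le_trans (_ : M < `|M + 1 + t|) _.
    by rewrite ger0_norm; lra.
  rewrite prod_normE /= le_max; apply/orP; left.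
  rewrite /GRing.scale /=; have -> : M + 1 + t * (M + 2 - (M + 1)) = M + 1 + t by ring.
  by [].
exists z1, z2; split.
- by apply/eqP => -[]; lra.
- by move=> x y /far xM pE; have := pM y; rewrite pE leNgt xM.
- by move=> x e eG /far xM /(AM _ _ eG); rewrite leNgt xM.
Qed.

Lemma planar_edge_isolated2 G u v : u != v -> isolated_vertex G u -> isolated_vertex G v ->
  planar R G -> planar R ([set u; v] |: G)%SET.
Proof.
move=> uv /isolated_vertexP iu /isolated_vertexP iv /planarP[p [A D]].
have [z1 [z2 [z12 offp offA]]] := far_points D.
have s1 : seg z1 z2 z1 by exact: arc_start (arc_seg z12).
have s2 : seg z1 z2 z2 by exact: arc_end (arc_seg z12).
have D1 : arc_drawing G (move_to p u z1) A.
  by apply: drawing_move => // [y|e eG]; [exact: offp|exact: offA].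
have D2 : arc_drawing G (move_to (move_to p u z1) v z2) A.
  apply: drawing_move => // [y|e eG]; last exact: offA.
  by rewrite /move_to; case: eqP => [_ /eqP|_]; [rewrite (negPf z12)|exact: offp].
apply/planarP; eexists; eexists; apply: (drawing_add (B := seg z1 z2)) D2 _ _ _ _.
- by apply/negP => /iu; rewrite set21.
- by rewrite /move_to !eqxx (negPf uv); exact: arc_seg.
- move=> y; rewrite /move_to; case: eqP => [->|_]; first by right.
  by case: eqP => [->|_ sy]; [left|case: (offp _ y sy)].
- by move=> g x gG sx /(offA _ _ gG sx).
Qed.

Lemma planar_suppress G u v w : u != v -> [set u; w]%SET \in G ->
  [set v; w]%SET \in G -> [set u; v]%SET \notin G ->
  (forall e, e \in G -> w \in e -> e = [set u; w]%SET \/ e = [set v; w]%SET) ->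
  planar R G -> planar R ([set u; v] |: (G :\ [set u; w] :\ [set v; w]))%SET.
Proof.
move=> uv uwG vwG uvG degw /planarP[p [A D]].
have [uw arcu] := drawing_arc D uwG; have [vw arcv] := drawing_arc D vwG.
have [injp Ae Av Aef] := D.
set G' := (G :\ _ :\ _)%SET.
have sG : G' \subset G by apply: fintype.subset_trans (subD1set _ _) (subD1set _ _).
have G'P e : e \in G' -> [/\ e != [set v; w]%SET, e != [set u; w]%SET & e \in G].
  by rewrite !in_setD1 => /and3P[].
have [z1 [z2 [z12 offp offA]]] := far_points D.
have s1 : seg z1 z2 z1 by exact: arc_start (arc_seg z12).
have D1 : arc_drawing G' (move_to p w z1) A.
  apply: drawing_move (drawing_sub sG D) _ _ _ => [e /G'P[evw euw eG]|y|e /G'P[_ _ eG]].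
  - by apply/negP => /(degw _ eG)[] E; [rewrite E eqxx in euw|rewrite E eqxx in evw].
  - exact: offp.
  - exact: offA.
have wg g : g != [set v; w]%SET -> g != [set u; w]%SET -> g \in G -> w \in g -> False.
  by move=> gv gu gG /(degw _ gG)[] E; [move: gu|move: gv]; rewrite E eqxx.
have ne : [set u; w]%SET != [set v; w]%SET.
  apply/eqP => E; have : u \in [set v; w]%SET by rewrite -E set21.
  by rewrite in_set2 (negPf uv) (negPf uw).
apply/planarP; eexists; eexists.
apply: (drawing_add (B := A [set u; w]%SET `|` A [set v; w]%SET)) D1 _ _ _ _.
- by apply/negP => /G'P[_ _]; rewrite (negPf uvG).
- rewrite /move_to (negPf uw) (negPf vw); apply: arc_cat arcu (arc_sym arcv) _ => x Au Avx.
  have [y [yu yv ->]] := Aef _ _ _ uwG vwG ne Au Avx; congr p.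
  move: yu yv; rewrite !in_set2 => /orP[]/eqP -> //.
  by rewrite (negPf uv) (negPf uw).
- move=> y; rewrite /move_to; case: eqP => [_ [/(offA _ _ uwG)|/(offA _ _ vwG)]//|/eqP yw].
  by move=> [/(Av _ _ uwG)|/(Av _ _ vwG)]; rewrite in_set2 (negPf yw) orbF => /eqP ->; [left|right].
- move=> g x /G'P[gv gu gG] + Agx; rewrite /move_to.
  move=> [Aux|Avx].
  + have [y [yu yg xE]] := Aef _ _ _ uwG gG ltac:(by rewrite eq_sym) Aux Agx.
    have yw : y != w by apply/eqP => yw; apply: (wg g) => //; rewrite -yw.
    exists y; rewrite (negPf yw); split => //; left.
    by move: yu; rewrite in_set2 (negPf yw) orbF => /eqP.
  + have [y [yu yg xE]] := Aef _ _ _ vwG gG ltac:(by rewrite eq_sym) Avx Agx.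
    have yw : y != w by apply/eqP => yw; apply: (wg g) => //; rewrite -yw.
    exists y; rewrite (negPf yw); split => //; right.
    by move: yu; rewrite in_set2 (negPf yw) orbF => /eqP.
Qed.

End PlanarOperations.

Section PlanarTriangle.
Variables (R : realType) (V : finType).
Implicit Types (G : {set {set V}}) (e f g : {set V}) (u v w y : V).

Lemma planar_parallel_edge G (p : V -> R * R) A u v : u != v -> [set u; v]%SET \in G ->
  arc_drawing G p A -> exists A', [/\ arc_drawing (G :\ [set u; v]%SET) p A' &
  exists B1 B2, [/\ simple_arc B1 (p u) (p v), simple_arc B2 (p u) (p v),
    forall x, B1 x -> B2 x -> x = p u \/ x = p v,
    forall x, (exists y, x = p y) \/ (exists2 e, e \in G :\ [set u; v]%SET & A' e x) ->
      B1 x -> x = p u \/ x = p v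
    & forall x, (exists y, x = p y) \/ (exists2 e, e \in G :\ [set u; v]%SET & A' e x) ->
      B2 x -> x = p u \/ x = p v]].
Proof.
move=> uv eG D0; have [injp _ _ _] := D0.
have puv0 : 0 < `|p u - p v|.
  by rewrite normr_gt0 subr_eq0; apply: contra_neq uv => /injp.
have mid (r1 r2 : R) x : r1 < `|p u - p v| / 2 -> r2 < `|p u - p v| / 2 ->
    cball (p u) r1 x -> cball (p v) r2 x -> False.
  rewrite /cball /= => h1 h2 cu cv; have := ler_normB (x - p v) (x - p u).
  have -> : x - p v - (x - p u) = p u - p v by rewrite opprB addrC addrA subrK.
  lra.
have [r1 r10 /(_ (Num.min (r1 / 2) (`|p u - p v| / 3)))] := tame_vertex u D0.
set ru := Num.min _ _; have ru0 : 0 < ru by rewrite lt_min; apply/andP; split; lra.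
have [ru1 ruh] : ru < r1 /\ ru < `|p u - p v| / 2.
  have : ru <= r1 / 2 by rewrite ge_min lexx.
  have : ru <= `|p u - p v| / 3 by rewrite ge_min lexx orbT.
  by split; lra.
move=> /(_ ru0 ru1)[A1 [D1 farU outU inU]].
have [r2 r20 /(_ (Num.min (r2 / 2) (`|p u - p v| / 3)))] := tame_vertex v D1.
set rv := Num.min _ _; have rv0 : 0 < rv by rewrite lt_min; apply/andP; split; lra.
have [rv2 rvh] : rv < r2 /\ rv < `|p u - p v| / 2.
  have : rv <= r2 / 2 by rewrite ge_min lexx.
  have : rv <= `|p u - p v| / 3 by rewrite ge_min lexx orbT.
  by split; lra.
move=> /(_ rv0 rv2)[A2 [D2 farV outV inV]].
have [_ Ae Av Aef] := D2.
set e0 := [set u; v]%SET in eG *.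
have subG : G :\ e0 \subset G by exact: subD1set.
pose F : set (R * R) := range p `|` \bigcup_(e in [set` G :\ e0]%SET) A2 e.
have FE x : F x <-> (exists y, x = p y) \/ (exists2 e, e \in G :\ e0 & A2 e x).
  by split=> [[[y _ <-]|[e eG' Ae']]|[[y ->]|[e eG' Ae']]];
    [left; exists y|right; exists e|left; exists y|right; exists e].
have cF : closed F.
  apply: closedU.
    rewrite (_ : range p = \bigcup_(y in [set: V]) [set p y]).
      apply: closed_bigcup => [|y _]; first exact: finite_finset.
      by apply: accessible_closed_set1; apply: hausdorff_accessible; exact: norm_hausdorff.
    by apply/seteqP; split => x [y _]; [move=> <-|move=> ->]; exists y.
  apply: closed_bigcup => [|e /= eG']; first exact: finite_finset.
  have [a [b [_ _]]] := Ae e (fintype.subsetP subG _ eG'); exact: arc_closed.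
have radial_in (q b : R * R) r (B : set (R * R)) : 0 < r -> `|b - q| = r ->
    (forall x, cball q r x -> (B x <-> seg q b x)) ->
    forall x s, B x -> cball q r x -> 0 <= s -> s * `|x - q| <= r -> B (q + s *: (x - q)).
  move=> r0 nb HB x s Bx cx s0 sr.
  have cy : cball q r (q + s *: (x - q)).
    by rewrite /cball /= addrAC subrr add0r normrZ ger0_norm.
  apply/(HB _ cy); move/(HB _ cx): Bx => /segP[t [t0 t1 xE]]; apply/segP; exists (s * t).
  have xq : x - q = t *: (b - q) by rewrite xE addrAC subrr add0r.
  move: sr; rewrite xq normrZ (ger0_norm t0) nb scalerA mulrA => st.
  split => //; first exact: mulr_ge0.
  by rewrite -(ler_pM2r r0) mul1r.
have other e : e \in G :\ e0 -> u \in e -> v \notin e.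
  rewrite in_setD1 => /andP[ne0 eG'] ue; apply: contra ne0 => ve.
  have [a [b [eE _ _]]] := Ae e eG'; move: ue ve; rewrite eE !in_set2 /e0.
  move=> /orP[]/eqP ? /orP[]/eqP ?; subst; rewrite ?eqxx // in uv *.
  by rewrite finset.setUC.
have rU : radial F (p u) ru.
  move=> x s /FE[[y ->]|[e eG' Aex]] xr s0 sr; apply/FE.
    have -> : y = u by apply/eqP; apply: contraT => /farU.
    by left; exists u; rewrite subrr scaler0 addr0.
  right; exists e => //; have eG2 := fintype.subsetP subG _ eG'.
  case: (boolP (u \in e)) => ue; last first.
    exfalso; have [A1e out] := outU e eG2 ue.
    case: (boolP (v \in e)) => ve.
      have [/(_ x Aex)[A1x|cv] _] := inV e eG2 ve; last exact: (mid ru rv x).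
      by rewrite A1e in A1x; exact: (out x).
    by have [A2e _] := outV e eG2 ve; apply: (out x) => //; rewrite -A1e -A2e.
  have [A2e _] := outV e eG2 (other e eG' ue); rewrite A2e in Aex *.
  have [_ [b nb HB]] := inU e eG2 ue.
  exact: (radial_in (p u) b ru).
have rV : radial F (p v) rv.
  move=> x s /FE[[y ->]|[e eG' Aex]] xr s0 sr; apply/FE.
    have -> : y = v by apply/eqP; apply: contraT => /farV.
    by left; exists v; rewrite subrr scaler0 addr0.
  right; exists e => //; have eG2 := fintype.subsetP subG _ eG'.
  case: (boolP (v \in e)) => ve; last first.
    by have [A2e out] := outV e eG2 ve; case: (out x) => //; rewrite -A2e.
  have [_ [b nb HB]] := inV e eG2 ve.
  exact: (radial_in (p v) b rv).
have [_ arc0] := drawing_arc D2 eG.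
have [||||B1 [B2 [b1 b2 B12 B1F B2F]]] := double_arc cF _ _ ru0 rv0 rU rV _ arc0.
- by apply/FE; left; exists u.
- by apply/FE; left; exists v.
- exact: farV.
- move=> x A0x /FE[[y xE]|[e]].
    by move: A0x; rewrite xE => /(Av _ _ eG); rewrite in_set2 => /orP[]/eqP ->; [left|right].
  rewrite in_setD1 => /andP[ne eG'] Aex; have [y [y0 _ ->]] := Aef _ _ x eG eG' ltac:(by rewrite eq_sym) A0x Aex.
  by move: y0; rewrite in_set2 => /orP[]/eqP ->; [left|right].
exists A2; split; first exact: drawing_sub D2.
exists B1, B2; split => //.
  by move=> x /FE Fx B1x; exact: B1F.
by move=> x /FE Fx B2x; exact: B2F.
Qed.

Lemma planar_triangle G u v w : u != v -> [set u; v]%SET \in G -> isolated_vertex G w ->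
  planar R G -> planar R ([set u; w] |: ([set v; w] |: G))%SET.
Proof.
move=> uv eG /isolated_vertexP iw /planarP[p [A D]].
have uw : u != w by apply: contraNneq (iw _ eG) => <-; exact: set21.
have vw : v != w by apply: contraNneq (iw _ eG) => <-; exact: set22.
have [A2 [D2 [B1 [B2 [b1 b2 B12 B1F B2F]]]]] := planar_parallel_edge uv eG D.
set G' := (G :\ _)%SET in D2 B1F B2F.
have [injp Ae Av Aef] := D2.
have [z [Bz zu zv _]] := arc_point_near b2 (@ltr01 R).
have [C1 [C2 [c1 c2 B2E C12]]] := arc_split b2 Bz zu zv.
have zF x : (exists y, x = p y) \/ (exists2 e, e \in G' & A2 e x) -> x <> z.
  by move=> Fx xz; have [] := B2F x Fx; rewrite xz // => /eqP; rewrite ?(negPf zu) ?(negPf zv).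
have iw' e : e \in G' -> w \notin e by rewrite in_setD1 => /andP[_]; exact: iw.
have D3 : arc_drawing G' (move_to p w z) A2.
  apply: drawing_move D2 iw' _ _ => [y|e eG' Az]; first by apply: zF; left; exists y.
  by apply: (zF z) => //; right; exists e.
have C1B x : C1 x -> B2 x by rewrite B2E; left.
have C2B x : C2 x -> B2 x by rewrite B2E; right.
have C1v : ~ C1 (p v) by move=> /C12/(_ (arc_end c2))/eqP; rewrite eq_sym (negPf zv).
have C2u : ~ C2 (p u) by move=> /(C12 _ (arc_start c1))/eqP; rewrite eq_sym (negPf zu).
have pu : move_to p w z u = p u by rewrite /move_to (negPf uw).
have pv : move_to p w z v = p v by rewrite /move_to (negPf vw).
have pw : move_to p w z w = z by rewrite /move_to eqxx.
have B1z : ~ B1 z.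
  by move=> B1z; have [/eqP|/eqP] := B12 _ B1z Bz; rewrite ?(negPf zu) ?(negPf zv).
have onp y : y <> w -> move_to p w z y = p y by rewrite /move_to; case: eqP.
have meetF g x : g \in G' -> A2 g x -> (exists y, x = p y) \/ (exists2 e, e \in G' & A2 e x).
  by move=> gG Ax; right; exists g.
have D4 := drawing_add (u := u) (v := v) (B := B1) D3.
have e0G' : [set u; v]%SET \notin G' by rewrite in_setD1 eqxx.
rewrite pu pv in D4; have {}D4 := D4 e0G' b1.
have {}D4 : arc_drawing ([set u; v] |: G')%SET (move_to p w z)
    (fun g => if g == [set u; v]%SET then B1 else A2 g).
  apply: D4 => [y|g x gG B1x Agx].
    have [->|/eqP yw] := eqVneq y w; first by rewrite pw => /B1z.
    by rewrite onp // => /B1F[|/injp ->|/injp ->]; [left; exists y|left|right].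
  have [xE|xE] := B1F x (meetF _ _ gG Agx) B1x.
    by exists u; rewrite pu; split => //; [apply: Av => //; rewrite -xE|left].
  by exists v; rewrite pv; split => //; [apply: Av => //; rewrite -xE|right].
rewrite finset.setD1K // in D4.
have vwG : [set v; w]%SET \notin G by apply/negP => /iw; rewrite set22.
have uwG : [set u; w]%SET \notin G by apply/negP => /iw; rewrite set22.
have D5 := drawing_add (B := C2) D4 vwG; rewrite pv pw in D5.
have {}D5 := D5 (arc_sym c2).
have {}D5 : arc_drawing ([set v; w] |: G)%SET (move_to p w z)
    (fun g => if g == [set v; w]%SET then C2 else
              if g == [set u; v]%SET then B1 else A2 g).
  apply: D5 => [y|g x gG C2x].
    have [->|/eqP yw] := eqVneq y w; first by right.
    rewrite onp // => C2y; have [|/injp yu|/injp ->] := B2F (p y) _ (C2B _ C2y).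
    - by left; exists y.
    - by move: C2y; rewrite yu.
    - by left.
  case: eqP => [->|/eqP ge0] Agx.
    have [xu|xv] := B12 _ Agx (C2B _ C2x); first by move: C2x; rewrite xu.
    by exists v; rewrite pv set22; split => //; left.
  have gG' : g \in G' by rewrite in_setD1 ge0.
  have [xu|xv] := B2F x (meetF _ _ gG' Agx) (C2B _ C2x); first by move: C2x; rewrite xu.
  by exists v; rewrite pv; split => //; [apply: Av => //; rewrite -xv|left].
have uwv : [set u; w]%SET \notin ([set v; w] |: G)%SET.
  rewrite in_setU1 negb_or uwG andbT; apply/eqP => E.
  have : u \in [set v; w]%SET by rewrite -E set21.
  by rewrite in_set2 (negPf uv) (negPf uw).
apply/planarP; eexists; eexists; apply: (drawing_add (B := C1)) D5 uwv _ _ _.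
- by rewrite pu pw.
- move=> y; have [->|/eqP yw] := eqVneq y w; first by right.
  rewrite onp // => C1y; have [|/injp ->|/injp yv] := B2F (p y) _ (C1B _ C1y).
  + by left; exists y.
  + by left.
  + by move: C1y; rewrite yv.
move=> g x + C1x; rewrite in_setU1; case: (eqVneq g [set v; w]%SET) => [->|gvw] /= gG.
  by move=> /(C12 _ C1x) ->; exists w; rewrite pw set22; split => //; right.
case: eqP => [->|/eqP ge0] Agx.
  have [xu|xv] := B12 _ Agx (C1B _ C1x); last by move: C1x; rewrite xv.
  by exists u; rewrite pu set21; split => //; left.
have gG' : g \in G' by rewrite in_setD1 ge0.
have [xu|xv] := B2F x (meetF _ _ gG' Agx) (C1B _ C1x); last by move: C1x; rewrite xv.
by exists u; rewrite pu; split => //; [apply: Av => //; rewrite -xu|left].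
Qed.

End PlanarTriangle.

(** * The random planar graph *)

Section PlanarClass.
Variables (R : realType) (V : finType).
Implicit Types (G : {set {set V}}).

Definition planar_simple G := simple_graph G && `[< planar R G >].

Lemma simple_setU1 G (e : {set V}) : simple_graph G -> #|e| = 2%N -> simple_graph (e |: G)%SET.
Proof.
move=> /forall_inP sG e2; apply/forall_inP => f; rewrite in_setU1 => /orP[/eqP ->|/sG //].
exact/eqP.
Qed.

Lemma simple_sub G G' : G' \subset G -> simple_graph G -> simple_graph G'.
Proof.
by move=> /fintype.subsetP sG /forall_inP H; apply/forall_inP => e /sG; exact: H.
Qed.

Lemma planar_simple_like : planar_like planar_simple.
Proof.
split.
- by move=> G /andP[].
- move=> G G' sG /andP[sim /asboolP pl]; apply/andP; split; first exact: simple_sub sim.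
  by apply/asboolP; exact: planar_sub pl.
- move=> G s /andP[/forall_inP sim /asboolP pl]; apply/andP; split.
    by apply/forall_inP => _ /imsetP[e eG ->]; rewrite card_imset ?sim //; exact: perm_inj.
  by apply/asboolP; exact: planar_perm.
- move=> G u v uv iu iv /andP[sim /asboolP pl]; apply/andP; split.
    by apply: simple_setU1 => //; rewrite cards2 uv.
  by apply/asboolP; exact: planar_edge_isolated2.
- move=> G u v w uv uwG vwG uvG degw /andP[sim /asboolP pl]; apply/andP; split.
    apply: simple_setU1; last by rewrite cards2 uv.
    by apply: simple_sub sim; apply: fintype.subset_trans (subD1set _ _) (subD1set _ _).
  by apply/asboolP; exact: planar_suppress.
- move=> G u v w uv uvG iw /andP[sim /asboolP pl]; apply/andP; split.
    have /isolated_vertexP iw' := iw.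
    apply: simple_setU1; first apply: simple_setU1 => //; rewrite cards2.
      by case: eqP => // vw; have := iw' _ uvG; rewrite -vw set22.
    by case: eqP => // uw; have := iw' _ uvG; rewrite -uw set21.
  by apply/asboolP; exact: planar_triangle.
Qed.

Lemma addable_planar G : planar_simple G -> addable R G = addables planar_simple G.
Proof.
move=> /andP[sim _]; apply/setP => e; rewrite !inE /planar_simple.
by case: eqP => //= e2; rewrite simple_setU1.
Qed.

End PlanarClass.

Lemma bigmin_le (I : eqType) (l : seq I) (F : I -> nat) b i : i \in l ->
  (\big[minn/b]_(j <- l) F j <= F i)%N.
Proof.
elim: l => // j l IHl; rewrite inE big_cons => /orP[/eqP <-|/IHl le]; first exact: geq_minl.
by apply: leq_trans le; exact: geq_minr.
Qed.

Section Minimum.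
Variables (R : realType) (n m : nat).

Lemma planar_graphsE (G : {set {set 'I_n}}) :
  (G \in planar_graphs R n m) = planar_simple R G && (#|G| == m).
Proof. by rewrite inE /planar_simple -andbA [X in _ && X]andbC. Qed.

Lemma min_addable_le G : G \in planar_graphs R n m -> (min_addable R n m <= #|addable R G|)%N.
Proof.
move=> GA; rewrite /min_addable -big_filter.
by apply: (@bigmin_le _ _ (fun G => #|addable R G|)); rewrite mem_filter GA mem_index_enum.
Qed.

Lemma min_addable_bin : (min_addable R n m <= 'C(n, 2))%N.
Proof.
rewrite /min_addable; elim/big_rec: _ => // G a _ le.
by apply: leq_trans le; rewrite geq_minr.
Qed.

Lemma min_addable_ge b : (b <= 'C(n, 2))%N ->
  (forall G, G \in planar_graphs R n m -> (b <= #|addable R G|)%N) ->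
  (b <= min_addable R n m)%N.
Proof.
move=> b0 bG; rewrite /min_addable; elim/big_rec: _ => // G a GA le.
by rewrite leq_min bG.
Qed.

End Minimum.

Lemma decay_iterate (R : realFieldType) (F : nat -> R) (q : R) (s t i : nat) : 0 <= q ->
  (forall j, (j < t)%N -> F (t + j * s)%N <= q * F (t + j.+1 * s)%N) ->
  (i <= t)%N -> F t <= q ^+ i * F (t + i * s)%N.
Proof.
move=> q0 HF; elim: i => [|i IHi] it; first by rewrite mul0n addn0 expr0 mul1r.
apply: le_trans (IHi (ltnW it)) _; rewrite exprSr -mulrA ler_wpM2l ?exprn_ge0 //.
exact: HF.
Qed.

Section LargeGraphs.
Variables (R : realType) (h : nat) (H : {set {set 'I_h}}) (c : R).
Hypotheses (treeH : is_tree H) (c_gt0 : 0 < c).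

Definition switch_factor : R := (72 * h%:R) ^+ h * (4 + (1 + 2 / c) ^+ h) * (1 + 8 * h)%:R.
(* The value exp(-2) leaves a factor exp(t) to spare after t steps. *)
Definition decay : R := expR (- 2).
Definition target_rate : R := decay / (2 * switch_factor).
Definition addable_density := (2 * h + 4 + Num.bound (2 * switch_factor / decay))%N.
Definition slack := (2 * addable_density + 5)%N.

Let h_gt0 : (0 < h)%N. Proof. exact: tree_h_gt0 treeH. Qed.
Let decay_gt0 : 0 < decay. Proof. exact: expR_gt0. Qed.
Let switch_factor_gt0 : 0 < switch_factor.
Proof.
have hR : (0 : R) < h%:R by rewrite ltr0n.
have c0 : 0 < 2 / c by rewrite divr_gt0.
by rewrite /switch_factor !mulr_gt0 ?ltr0n // ?exprn_gt0 ?mulr_gt0 // addr_gt0 // exprn_gt0 //; lra.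
Qed.
Lemma target_rate_gt0 : 0 < target_rate. Proof. by rewrite divr_gt0 // mulr_gt0. Qed.

Definition large n := [/\ (4096 * slack ^ 3 + 16 * slack <= n)%N, (slack + (6 * h + 6) <= n)%N
  & (2 * h)%:R + 2 * 2 ^+ h <= c * n%:R].

Section OneSize.
Variables (n m : nat).
Hypotheses (n_large : large n) (cm : c * n%:R <= m%:R).
Hypothesis mn : (128 * slack * m <= 128 * slack * n + n)%N.

Let P := @planar_simple R 'I_n.
Let HP : planar_like P := @planar_simple_like R 'I_n.
Let A := min_addable R n m.
Let w : R := A%:R / n%:R.
Let F k := #|few_comps P (order_iso_components H) m k|.
Let t := tn target_rate n m.

Let n_gt0 : (0 < n)%N.
Proof. by have [_ le _] := n_large; apply: leq_trans le; rewrite addnA addnS. Qed.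

Let slack_gt0 : (0 < slack)%N. Proof. by rewrite /slack addn_gt0 orbT. Qed.

Lemma m_small : (128 * m <= 129 * n)%N.
Proof. by move: mn slack_gt0; clear; nia. Qed.

Lemma addables_large G : P G -> (#|G| <= m)%N -> (addable_density * n <= #|addables P G|)%N.
Proof.
move=> PG Gm; have [le _ _] := n_large.
have := many_addables HP PG slack_gt0; rewrite card_ord => /(_ _ _) H0.
have {}H0 : (slack * n <= 2 * #|addables P G| + n + 2 * #|G|)%N.
  apply: H0; first by apply: leq_trans mn; rewrite leq_mul2l Gm orbT.
  exact: le.
move: H0 m_small Gm; rewrite /slack; move: #|addables P G| #|G| => a g; clear; nia.
Qed.

Lemma min_addable_large : (addable_density * n <= A)%N.
Proof.
apply: min_addable_ge => [|G].
  have [_ le _] := n_large; rewrite bin2.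
  have {}le : (2 * addable_density + 5 <= n)%N by apply: leq_trans le; exact: leq_addr.
  move: addable_density le => k; clear; rewrite -divn2 leq_divRL //; case: n => // n'; nia.
rewrite planar_graphsE => /andP[PG /eqP cG]; rewrite addable_planar //.
by apply: addables_large; rewrite ?cG.
Qed.

Lemma min_addable_addables G : P G -> (#|G| < m)%N -> (A <= #|addables P G|)%N.
Proof.
move=> PG Gm; have [|G' [sG PG' cG']] := extend_to (P := P) (M := m) _ PG (ltnW Gm).
  move=> G' PG' G'm; apply: leq_trans (addables_large PG' (ltnW G'm)).
  by rewrite muln_gt0 n_gt0 andbT /addable_density addn_gt0 addn_gt0 orbT.
apply: leq_trans (_ : #|addables P G'| <= _)%N; last exact/subset_leq_card/(addables_sub HP).
by rewrite -addable_planar //; apply: min_addable_le; rewrite planar_graphsE cG' eqxx andbT.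
Qed.

Let w_ge : addable_density%:R <= w.
Proof. by rewrite /w ler_pdivlMr ?ltr0n // -natrM ler_nat; exact: min_addable_large. Qed.

Lemma few_comps_ratio k : (F k)%:R * w <=
  (72 * h%:R) ^+ h * (4 + (1 + 2 / c) ^+ h) * (k + 8 * h)%:R * (F (k + 8 * h))%:R.
Proof.
have [_ le lec] := n_large; have KA := min_addable_large.
have h2 : 2 * 2 ^+ h + (2 * h)%:R <= (m%:R : R) by apply: le_trans cm; rewrite addrC.
have pow0 : (0 : R) <= 2 ^+ h by exact: exprn_ge0.
have fam := tree_component_family HP treeH.
have := @few_comps_step 'I_n P h #|H| (order_iso_components H) (@order_copy h n H) HP fam
  (tree_card treeH) R c m A c_gt0; rewrite card_ord.
move=> /(_ n_gt0 _ _ _ _ _ _ min_addable_addables (n %/ 8).+1 _ _ k); apply.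
- by rewrite -(ler_nat R); apply: le_trans h2; rewrite lerDr mulr_ge0.
- by move: m_small; clear; lia.
- have : 2 * 2 ^+ h <= (m%:R : R) by apply: le_trans h2; rewrite lerDl.
  move: cm; move: (2 ^+ h) (m%:R : R) (n%:R : R) => x y z le1 le2; lra.
- apply: leq_trans (min_addable_bin _ _ _) _; rewrite bin2 -mulnn; clear.
  by case: n => // n' /=; nia.
- by apply: leq_trans KA; rewrite leq_mul2r /addable_density; clear; lia.
- by apply: leq_trans KA; rewrite leq_mul2r /addable_density; clear; lia.
- by clear; lia.
move=> G PG Gm; have := many_low HP PG; rewrite card_ord.
have {}le : (6 * h + 6 <= n)%N by apply: leq_trans le; exact: leq_addl.
move: le m_small Gm; move: #|G| #|[set v | low G v]%SET| => g l.
clear; lia.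
Qed.

Lemma few_comps_decay (s : nat) : t = s%:Z -> (0 < s)%N -> (F s)%:R <= decay ^+ s * (F (s + s * (8 * h)))%:R.
Proof.
move=> ts s0; apply: (decay_iterate (F := fun k => (F k)%:R)) => //; first exact: ltW.
move=> j js; have w0 : 0 < w by apply: lt_le_trans w_ge; rewrite ltr0n /addable_density addn_gt0 addn_gt0 orbT.
have sw : s%:R < target_rate * w + 1.
  have := ceilB1_lt (target_rate * w).
  have -> : Num.ceil (target_rate * w) = s%:Z by rewrite -ts /t /tn /w mulrA.
  by rewrite intrB /= -pmulrn; lra.
have := few_comps_ratio (s + j * (8 * h)); rewrite -ler_pdivlMr // => le; apply: le_trans le _.
have -> : (s + j * (8 * h) + 8 * h = s + j.+1 * (8 * h))%N by rewrite mulSn; clear; lia.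
rewrite mulrAC ler_wpM2r //.
set D1 := (72 * h%:R) ^+ h * (4 + (1 + 2 / c) ^+ h).
have DE : switch_factor = D1 * (1 + 8 * h)%:R by [].
have D10 : 0 <= D1.
  have c20 : 0 < 2 / c by rewrite divr_gt0.
  by rewrite mulr_ge0 ?exprn_ge0 ?mulr_ge0 // addr_ge0 ?exprn_ge0 ?addr_ge0 // ltW.
rewrite ler_pdivrMr //.
apply: (@le_trans _ _ (D1 * (s%:R * (1 + 8 * h)%:R))).
  apply: ler_wpM2l => //; rewrite -natrM ler_nat; move: js; clear; nia.
rewrite mulrCA -DE.
have Kw : 2 * switch_factor / decay <= w.
  apply: le_trans w_ge; apply: le_trans (ltW (archi_boundP _)) _; last by rewrite ler_nat leq_addl.
  by apply: divr_ge0; [apply: mulr_ge0 => //; exact: ltW switch_factor_gt0|exact: ltW decay_gt0].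
have lD : target_rate * switch_factor = decay / 2 by rewrite /target_rate; field; rewrite gt_eqF.
have : switch_factor <= decay / 2 * w.
  move: Kw; rewrite ler_pdivrMr //; lra.
have : s%:R * switch_factor <= (target_rate * w + 1) * switch_factor by rewrite ler_pM2r // ltW.
rewrite mulrDl mul1r mulrAC lD; lra.
Qed.

Lemma few_components_prob :
  uniform_graph_prob R (planar_graphs R n m)
    (fun G => (num_order_iso_components H G)%:Z < t) < expR (- t%:~R).
Proof.
have t0 : 0 <= t by rewrite /t /tn ceil_ge0 (lt_le_trans (ltrN10 _)) // divr_ge0 // mulr_ge0 // ltW // target_rate_gt0.
have [s ts] : exists s : nat, t = s%:Z by exists `|t|%N; rewrite gez0_abs.
rewrite /uniform_graph_prob.
have -> : [set x in planar_graphs R n m | (num_order_iso_components H x)%:Z < t]%SET =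
    few_comps P (order_iso_components H) m s.
  by apply/setP => G; rewrite [LHS]inE planar_graphsE inE -andbA ts ltz_nat.
case: (posnP s) => [s0|s0].
  have -> : few_comps P (order_iso_components H) m s = finset.set0.
    by apply/setP => G; rewrite !inE s0 ltn0 !andbF.
  by rewrite cards0 mul0r expR_gt0.
case: (posnP #|planar_graphs R n m|) => [->|A0]; first by rewrite invr0 mulr0 expR_gt0.
rewrite ltr_pdivrMr ?ltr0n //.
apply: le_lt_trans (few_comps_decay ts s0) _.
apply: (@le_lt_trans _ _ (decay ^+ s * #|planar_graphs R n m|%:R)).
  apply: ler_wpM2l; first by rewrite exprn_ge0 // ltW.
  rewrite ler_nat; apply/subset_leq_card/fintype.subsetP => G.
  by rewrite inE planar_graphsE => /and3P[PG -> _]; rewrite andbT; exact: PG.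
rewrite ltr_pM2r ?ltr0n // -expRM_natl ltr_expR ts.
have : (0 : R) < s%:R by rewrite ltr0n.
rewrite -pmulrn; lra.
Qed.

End OneSize.
End LargeGraphs.

Theorem theorem6p4 (R : realType) (h : nat) (H : {set {set 'I_h}}) (c : R)
    (treeH : is_tree H) (c_gt0 : 0 < c) :
  exists2 lambda : R, 0 < lambda &
    forall (m : nat -> nat) (eps : nat -> R),
      eps n @[n --> \oo] --> (0 : R) ->
      (\forall n \near \oo,
         c * n%:R <= (m n)%:R /\ (m n)%:R <= (1 + eps n) * n%:R) ->
      \forall n \near \oo,
        uniform_graph_prob R (planar_graphs R n (m n))
          (fun G => (num_order_iso_components H G)%:Z < tn lambda n (m n))
        < expR (- (tn lambda n (m n))%:~R).
Proof.
exists (target_rate h c); first exact: (target_rate_gt0 treeH c_gt0).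
move=> m eps eps0 hm.
have T0 : (0 : R) < (128 * slack h c)%:R by rewrite ltr0n muln_gt0 /slack addn_gt0 orbT.
near=> n; have [|cm mle] := near hm n; first by [].
apply: (few_components_prob treeH c_gt0) => //.
  split; [by near: n; exact: nbhs_infty_ge|by near: n; exact: nbhs_infty_ge|].
  by rewrite (mulrC c) -ler_pdivrMr //; near: n; exact: nbhs_infty_ger.
have epsn : eps n <= (128 * slack h c)%:R^-1.
  have : `|eps n| <= (128 * slack h c)%:R^-1; last by apply: le_trans; exact: ler_norm.
  near: n; move/cvgr0Pnorm_le : eps0; apply; by rewrite invr_gt0.
rewrite -(ler_nat R) natrD (natrM _ _ (m n)) (natrM _ _ n).
apply: (@le_trans _ _ ((128 * slack h c)%:R * ((1 + (128 * slack h c)%:R^-1) * n%:R))).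
  by rewrite ler_pM2l // (le_trans mle) // ler_wpM2r // lerD2l.
by rewrite mulrA mulrDr mulr1 mulfV ?gt_eqF // mulrDl mul1r.
Unshelve. all: by end_near.
Qed.
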